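(* Let $\Omega\subset\mathbb{R}^k$ be an open set with bounded Lipschitz boundary $\partial\Omega$ and let $T>0$. Let $\mathcal{O}\subset\mathbb{R}^n$ be convex, $A\in C^2(\overline{\mathcal{O}};\mathbb{R}^n)$ and $F\in C^2(\overline{\mathcal{O}};\mathbb{R}^{n\times k})$. Assume there exist $\eta\in C^1(\mathcal{O};\mathbb{R})$, $q\in C^1(\mathcal{O};\mathbb{R}^k)$ and $B\in C^1(\mathcal{O};\mathbb{R}^n)$ such that, for some constant $C$ independent of $V$ and for all $V\in\mathcal{O}$, $$D_UB\in L^\infty(\mathcal{O}),\qquad |B(V)|\le C(1+|V|),\qquad |\eta(V)|+|q(V)|\le C(1+|V|^3),$$ $$\sup_{i,j\in\{1,\dots,n\}}\ \sup_{\mathcal{O}}|\partial_{U_i}\partial_{U_j}A|<+\infty,\qquad \sup_{i,j\in\{1,\dots,n\}}\ \sup_{\mathcal{O}}|\partial_{U_i}\partial_{U_j}F|<+\infty,$$ and such that $$D_U\eta(U)=B(U)D_UA(U),\qquad D_Uq_j(U)=B(U)D_UF_j(U)\quad\text{for }j=1,\dots,k,\ U\in\mathcal{O}.$$ Let $U:\Omega\times(0,T)\to\mathcal{O}$ be a weak solution of $\partial_t(A(U))+\operatorname{div}_xF(U)=0$, i.e. $$\int_0^T\int_\Omega \partial_t\psi(x,t)\cdot A(U(x,t))+\nabla_x\psi(x,t):F(U(x,t))\,dx\,dt=0\qquad\text{for all }\psi\in C^1_c(\Omega\times(0,T);\mathbb{R}^n).$$ Assume that for every $\Omega_1\subset\subset\Omega$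 one has $U\in L^3(\Omega_1\times(0,T))$ and $$\liminf_{\epsilon\to0}\ \frac1\epsilon\int_{\Omega_1\times(0,T)}\frac{1}{|B_\epsilon(X)\cap(\Omega_1\times(0,T))|}\int_{B_\epsilon(X)\cap(\Omega_1\times(0,T))}|U(X)-U(Y)|^3\,dY\,dX=0,$$ and that $$\liminf_{\epsilon\to0}\int_0^T\frac1\epsilon\int_{\{x\in\Omega:\ \frac\epsilon4\le d(x,\partial\Omega)\le\frac\epsilon2\}}\big|q(U(x,t))\cdot n(\sigma(x))\big|\,dx\,dt=0 .$$ Then $$\frac{d}{dt}\int_\Omega\eta(U(x,t))\,dx=0$$ in the sense of distributions, i.e. $\int_0^T\int_\Omega\chi'(t)\,\eta(U(x,t))\,dx\,dt=0$ for every $\chi\in C^1_c(0,T)$.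
   Context: $X=(x,t)$ and $Y$ denote points of space-time $\mathbb{R}^{k+1}$, and $B_\epsilon(X)$ is the ball of radius $\epsilon$ about $X$ in $\mathbb{R}^{k+1}$. $\Omega_1\subset\subset\Omega$ means that the closure of $\Omega_1$ is compact and contained in $\Omega$. $F_j$ is the $j$-th column of $F$, $q_j$ the $j$-th component of $q$; $B$ is regarded as a row vector multiplying the $n\times n$ Jacobians $D_UA$, $D_UF_j$, so $\partial_{U_l}\eta=\sum_iB_i\,\partial_{U_l}A_i$ and $\partial_{U_l}q_j=\sum_iB_i\,\partial_{U_l}F_{ij}$. Boundary notation: $n(x)$ is the exterior unit normal, defined almost everywhere on $\partial\Omega$; $d(x,\partial\Omega)$ is the distance from $x\in\Omega$ to $\partial\Omega$. Throughout it is taken as given that there is a small $\epsilon_0>0$ such that on $\{d(x,\partial\Omega)\le\epsilon_0\}$ the function $x\mapsto d(x,\partial\Omega)$ is in $W^{1,\infty}$, and for almost every $x\in\Omega$ with $d(x,\partial\Omega)<\epsilon_0$ there is a unique point $\sigma(x)\in\partial\Omega$ with $d(x,\partial\Omega)=|x-\sigma(x)|$ and $\nabla_xd(x,\partial\Omega)=-n(\sigma(x))$.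
   Formalization: Added hypothesis: for some r, q(U) is integrable on {x in Ω: |x|>r}×(0,T). It is vacuous for bounded Ω; for unbounded Ω with bounded boundary the claim as printed is false, since entropy can escape to infinity in finite time. *)

(* Defs.v *)
From HB Require Import structures.
From mathcomp Require Import all_boot all_order all_algebra.
From mathcomp Require Import all_classical all_reals all_analysis.
Set Implicit Arguments.
Unset Strict Implicit.
Unset Printing Implicit Defensive.
Import Order.TTheory GRing.Theory Num.Theory.
Import numFieldNormedType.Exports.
Local Open Scope classical_set_scope.
Local Open Scope ring_scope.

(* The coordinate (= Borel) sigma-algebra on 'rV[R]_n, built as for tuples. *)
Definition rV_display : measure_display.
Proof. exact: default_measure_display. Qed.

Section measurable_rV.
Context {R : realType} (n : nat).
Let coord (i : 'I_n) (x : 'rV[R]_n) : R := x 0 i.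
Let rV_measurable : set (set 'rV[R]_n) := g_sigma_preimage coord.
Let rV_measurable0 : rV_measurable set0.
Proof. exact: sigma_algebra0. Qed.
Let rV_measurableC A : rV_measurable A -> rV_measurable (~` A).
Proof. exact: sigma_algebraC. Qed.
Let rV_bigcup (F : _^nat) : (forall i, rV_measurable (F i)) ->
  rV_measurable (\bigcup_i (F i)).
Proof. exact: sigma_algebra_bigcup. Qed.
HB.instance Definition _ := @isMeasurable.Build rV_display
  'rV[R]_n rV_measurable rV_measurable0 rV_measurableC rV_bigcup.

Lemma measurable_coord (i : 'I_n) :
  measurable_fun [set: 'rV[R]_n] (fun x : 'rV[R]_n => x 0 i).
Proof.
move=> _ Y mY; rewrite setTI; apply: sub_sigma_algebra => /=.
rewrite -bigcup_seq/=; exists i => /=; first by rewrite mem_index_enum.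
by exists Y => //; rewrite setTI.
Qed.

Lemma measurable_fun_rV d (T : measurableType d) (f : T -> 'rV[R]_n) :
  (forall i, measurable_fun [set: T] (fun t => f t 0 i)) ->
  measurable_fun [set: T] f.
Proof.
move=> mf; apply: (@measurability _ _ _ _ setT f
  (\big[setU/set0]_(i < n) preimage_set_system setT (coord i) measurable)) => //.
move=> C [B]; rewrite -bigcup_seq => -[i _ [A mA <-]] <-.
by have := mf i measurableT A mA; rewrite !setTI.
Qed.
End measurable_rV.

(* Restates the library's Measure_isSigmaFinite instance for products, which is
   shadowed as a canonical structure by the one for subprobabilities. *)
Lemma sigma_finite_product_measure d1 d2 (T1 : measurableType d1)
    (T2 : measurableType d2) (R : realType)
    (m1 : {sigma_finite_measure set T1 -> \bar R})
    (m2 : {sigma_finite_measure set T2 -> \bar R}) :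
  sigma_finite [set: T1 * T2] (m1 \x m2)%E.
Proof.
have /sigma_finiteP[F [TF ndF Foo]] := sigma_finiteT m1.
have /sigma_finiteP[G [TG ndG Goo]] := sigma_finiteT m2.
exists (fun n => F n `*` G n).
 rewrite -setXTT TF TG predeqE => -[x y]; split.
    move=> [/= [n _ Fnx] [k _ Gky]]; exists (maxn n k) => //; split.
    - by move: x Fnx; exact/subsetPset/ndF/leq_maxl.
    - by move: y Gky; exact/subsetPset/ndG/leq_maxr.
  by move=> [n _ []/= ? ?]; split; exists n.
move=> k; have [? ?] := Foo k; have [? ?] := Goo k.
split; first exact: measurableX.
by rewrite product_measure1E// lte_mul_pinfty// ge0_fin_numE.
Qed.

Section cons_measure.
Context {R : realType} (n : nat).
Variable m : {sigma_finite_measure set 'rV[R]_n -> \bar R}.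

Definition rV_cons (p : measurableTypeR R * 'rV[R]_n) : 'rV[R]_n.+1 :=
  \row_i (if unlift ord0 i is Some j then p.2 0 j else p.1).

Definition rV_uncons (x : 'rV[R]_n.+1) : measurableTypeR R * 'rV[R]_n :=
  (x 0 ord0, \row_j x 0 (lift ord0 j)).

Lemma rV_consK : cancel rV_cons rV_uncons.
Proof.
move=> [a x]; rewrite /rV_cons /rV_uncons !mxE unlift_none; congr pair.
by apply/rowP => j; rewrite !mxE liftK.
Qed.

Lemma rV_unconsK : cancel rV_uncons rV_cons.
Proof.
move=> x; apply/rowP => i; rewrite !mxE /=.
by case: unliftP => [j ->|->]//; rewrite !mxE.
Qed.

Lemma measurable_rV_cons : measurable_fun setT rV_cons.
Proof.
apply: measurable_fun_rV => i; rewrite /rV_cons.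
under eq_fun do rewrite mxE.
case: unliftP => [j _|_]; last exact: measurable_fst.
exact: (measurableT_comp (measurable_coord j) measurable_snd).
Qed.

Lemma measurable_rV_uncons : measurable_fun setT rV_uncons.
Proof.
apply: measurable_fun_pair; first exact: measurable_coord.
apply: measurable_fun_rV => j; under eq_fun do rewrite mxE.
exact: measurable_coord.
Qed.


Definition cons_measure : set 'rV[R]_n.+1 -> \bar R :=
  pushforward (@lebesgue_measure R \x m)%E rV_cons.

Let mcons := measurable_rV_cons.

Let cons_measure0 : cons_measure set0 = 0%E. Proof. exact: measure0. Qed.

Let cons_measure_ge0 A : (0 <= cons_measure A)%E.
Proof. exact: measure_ge0. Qed.

Let cons_measure_sigma_additive : semi_sigma_additive cons_measure.
Proof. exact: measure_semi_sigma_additive. Qed.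

HB.instance Definition _ := isMeasure.Build _ _ _ cons_measure
  cons_measure0 cons_measure_ge0 cons_measure_sigma_additive.

Let cons_measure_sigma_finite : sigma_finite setT cons_measure.
Proof.
have [F FT mF] := sigma_finite_product_measure (@lebesgue_measure R) m.
exists (fun i => rV_uncons @^-1` F i) => [|i].
  by rewrite -preimage_bigcup -FT preimage_setT.
have [mFi Fioo] := mF i; split.
  by rewrite -[X in measurable X]setTI; exact: measurable_rV_uncons.
rewrite /cons_measure /pushforward -comp_preimage.
rewrite (_ : _ \o _ = id) ?preimage_id//.
by apply/funext => p /=; rewrite rV_consK.
Qed.

HB.instance Definition _ := @Measure_isSigmaFinite.Build _ _ _ cons_measure
  cons_measure_sigma_finite.
End cons_measure.

(* n-dimensional Lebesgue measure, as the n-fold product of the linear one. *)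
Fixpoint rV_lebesgue {R : realType} (n : nat) :
    {sigma_finite_measure set 'rV[R]_n -> \bar R} :=
  match n with
  | 0 => [the {sigma_finite_measure set _ -> \bar R} of \d_(0 : 'rV[R]_0)]
  | m.+1 => [the {sigma_finite_measure set _ -> \bar R} of
              cons_measure (rV_lebesgue m)]
  end.

Definition spacetime_lebesgue {R : realType} (k : nat) :
    set ('rV[R]_k * measurableTypeR R) -> \bar R :=
  (rV_lebesgue k \x @lebesgue_measure R)%E.

HB.instance Definition _ (R : realType) (k : nat) :=
  Measure.on (@spacetime_lebesgue R k).
HB.instance Definition _ (R : realType) (k : nat) :=
  @Measure_isSigmaFinite.Build _ _ _ (@spacetime_lebesgue R k)
    (@sigma_finite_product_measure _ _ _ _ _ (rV_lebesgue k)
       (@lebesgue_measure R)).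

Section euclidean.
Context {R : realType}.

Definition dotp n (u v : 'rV[R]_n) : R := \sum_(i < n) u 0 i * v 0 i.

(* The norm `|v| of the library is the sup norm. *)
Definition enorm n (v : 'rV[R]_n) : R := Num.sqrt (dotp v v).

Definition spacetime_ball k (X : 'rV[R]_k * R) (eps : R) : set ('rV[R]_k * R) :=
  [set Y | Num.sqrt (enorm (X.1 - Y.1) ^+ 2 + (X.2 - Y.2) ^+ 2) < eps].

End euclidean.

Section regularity.
Context {R : realType}.

(* Frechet gradients relative to D, so that functions of class C^m on a set
   which is not open need not be extended beyond it.  At an interior point of D
   this is the usual gradient; it is unique at every point of a convex set D
   with nonempty interior, and selected arbitrarily otherwise. *)
Definition is_gradient n (D : set 'rV[R]_n) (g : 'rV[R]_n -> R)
    (x v : 'rV[R]_n) : Prop :=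
  forall eps : R, 0 < eps -> \forall y \near x, D y ->
    `|g y - g x - dotp (y - x) v| <= eps * enorm (y - x).

Definition gradient n (D : set 'rV[R]_n) (g : 'rV[R]_n -> R) (x : 'rV[R]_n) :
  'rV[R]_n := xget 0 [set v | is_gradient D g x v].

Definition partial n (D : set 'rV[R]_n) (l : 'I_n) (g : 'rV[R]_n -> R)
  (x : 'rV[R]_n) : R := gradient D g x 0 l.

Definition C1_on n (D : set 'rV[R]_n) (g : 'rV[R]_n -> R) : Prop :=
  (forall x, D x -> is_gradient D g x (gradient D g x)) /\
  {within D, continuous (gradient D g)}.

Definition C2_on n (D : set 'rV[R]_n) (g : 'rV[R]_n -> R) : Prop :=
  C1_on D g /\ forall l, C1_on D (partial D l g).

Definition C1c (V W : normedModType R) (D : set V) (f : V -> W) : Prop :=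
  [/\ forall x, differentiable f x,
      forall v, continuous (fun x => 'D_v f x),
      compact (closure [set x | f x != 0]) &
      closure [set x | f x != 0] `<=` D].

End regularity.

Section domain.
Context {R : realType} {k : nat}.
Implicit Types (Omega : set 'rV[R]_k) (x y v : 'rV[R]_k).

Definition bdry Omega : set 'rV[R]_k := closure Omega `\` interior Omega.

(* Near each boundary point, Omega is the part above the graph of a Lipschitz
   function in some direction e; gam is applied to the component orthogonal
   to e only. *)
Definition lipschitz_boundary Omega : Prop :=
  forall x0, bdry Omega x0 ->
  exists (r : R) (e : 'rV[R]_k) (gam : 'rV[R]_k -> R),
    [/\ 0 < r, enorm e = 1, lipschitz (gam : _ -> R^o) &
      forall x, enorm (x - x0) < r ->
        Omega x <-> gam (x - dotp x e *: e) < dotp x e].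

(* Equal to +oo when the boundary is empty. *)
Definition bdry_dist Omega x : \bar R :=
  ereal_inf [set (enorm (x - y))%:E | y in bdry Omega].

Definition is_bdry_proj Omega x y : Prop :=
  bdry Omega y /\ bdry_dist Omega x = (enorm (x - y))%:E.

Definition bdry_proj Omega x : 'rV[R]_k := xget 0 [set y | is_bdry_proj Omega x y].

(* For a Lipschitz domain this holds exactly where the local graph is
   differentiable, v being the normal to its tangent plane pointing out of
   Omega. *)
Definition is_outer_normal Omega y v : Prop :=
  enorm v = 1 /\
  forall delta : R, 0 < delta -> \forall z \near y,
    (dotp (z - y) v < - (delta * enorm (z - y)) -> Omega z) /\
    (delta * enorm (z - y) < dotp (z - y) v -> ~ Omega z).

Definition outer_normal Omega y : 'rV[R]_k :=
  xget 0 [set v | is_outer_normal Omega y v].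

(* The distance function is 1-Lipschitz and bounded by eps0 on the collar, hence
   W^{1,oo} there for any Omega; the rest can fail for a Lipschitz Omega (near a
   reentrant corner). *)
Definition regular_collar Omega (eps0 : R) : Prop :=
  {ae rV_lebesgue k, forall x, Omega x -> (bdry_dist Omega x < eps0%:E)%E ->
    [/\ exists! y, is_bdry_proj Omega x y,
        is_outer_normal Omega (bdry_proj Omega x)
          (outer_normal Omega (bdry_proj Omega x)) &
        is_gradient [set: 'rV[R]_k] (fun z => fine (bdry_dist Omega z)) x
          (- outer_normal Omega (bdry_proj Omega x))]}.

Definition compactly_inside (Omega1 Omega : set 'rV[R]_k) : Prop :=
  compact (closure Omega1) /\ closure Omega1 `<=` Omega.

End domain.

Section conservation_law.
Context {R : realType} {k n : nat}.
Implicit Types (U : 'rV[R]_k * R -> 'rV[R]_n) (D : set ('rV[R]_k * R)).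

Definition L3 D U : Prop :=
  measurable_fun D U /\
  (\int[spacetime_lebesgue (k:=k)]_(X in D) (enorm (U X) ^+ 3)%:E < +oo)%E.

Definition time_deriv (psi : 'rV[R]_k * R -> 'rV[R]_n) (i : 'I_n)
  (X : 'rV[R]_k * R) : R := ('D_((0, 1) : 'rV[R]_k * R) psi X) 0 i.

Definition space_deriv (psi : 'rV[R]_k * R -> 'rV[R]_n) (i : 'I_n) (j : 'I_k)
  (X : 'rV[R]_k * R) : R :=
  ('D_((delta_mx 0 j, 0) : 'rV[R]_k * R) psi X) 0 i.

Definition weak_solution (Omega : set 'rV[R]_k) (T : R)
    (A : 'rV[R]_n -> 'rV[R]_n) (F : 'rV[R]_n -> 'M[R]_(n, k)) U : Prop :=
  forall psi : 'rV[R]_k * R -> 'rV[R]_n, C1c (Omega `*` `]0, T[) psi ->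
  \int[spacetime_lebesgue (k:=k)]_(X in Omega `*` `]0, T[)
    ((\sum_(i < n) time_deriv psi i X * A (U X) 0 i) +
     \sum_(i < n) \sum_(j < k) space_deriv psi i j X * F (U X) i j) = 0.

Definition cubic_modulus D U (eps : R) : \bar R :=
  ((eps^-1)%:E * \int[spacetime_lebesgue (k:=k)]_(X in D)
    ((fine (spacetime_lebesgue (spacetime_ball X eps `&` D)))^-1%:E *
     \int[spacetime_lebesgue (k:=k)]_(Y in spacetime_ball X eps `&` D)
       (enorm (U X - U Y) ^+ 3)%:E))%E.

Definition bdry_flux (Omega : set 'rV[R]_k) (T : R)
    (q : 'rV[R]_n -> 'rV[R]_k) U (eps : R) : \bar R :=
  (\int[@lebesgue_measure R]_(t in `]0%R, T[)
    ((eps^-1)%:E * \int[rV_lebesgue k]_(x in [set x | Omega x /\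
        ((eps / 4)%:E <= bdry_dist Omega x <= (eps / 2)%:E)%E])
      `|dotp (q (U (x, t))) (outer_normal Omega (bdry_proj Omega x))|%:E))%E.

(* Vacuous when Omega is bounded.  A bounded boundary also allows exterior
   domains, where entropy may escape to infinity in finite time unless the flux
   is controlled there: on ]0, +oo[, with A the identity, F(V) = (0, V_1 V_2),
   eta(V) = V_2, B = (0, 1), the solution
   U(x, t) = (1 + x^2, phi(atan x - t) / (1 + x^2)), phi a bump, loses its whole
   mass. *)
Definition flux_integrable_at_infinity (Omega : set 'rV[R]_k) (T : R)
    (q : 'rV[R]_n -> 'rV[R]_k) U : Prop :=
  exists r : R, (spacetime_lebesgue (k:=k)).-integrable
    ([set x | Omega x /\ r < enorm x] `*` `]0, T[)
    (fun X => (enorm (q (U X)))%:E).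

End conservation_law.

(* Main.v *)
Require Import Defs.
From HB Require Import structures.
From mathcomp Require Import all_boot all_order all_algebra.
From mathcomp Require Import all_classical all_reals all_analysis.
From mathcomp Require Import measurable_realfun.
From mathcomp Require Import ring lra.
Set Implicit Arguments.
Unset Strict Implicit.
Unset Printing Implicit Defensive.
Import Order.TTheory GRing.Theory Num.Theory.
Import numFieldNormedType.Exports.
Local Open Scope classical_set_scope.
Local Open Scope ring_scope.

(** The entropy balance is an Onsager type statement: a solution whose cubic
    modulus of continuity is o(e) is regular enough for the chain rule.

    Write a for an index that is either time (flux A, entropy eta) or a space
    direction j (flux F_j, entropy flux q_j), so that the system reads
    sum_a d_a G_a(U) = 0 and the claim sum_a d_a Q_a(U) = 0, where DQ_a = B DG_a.
    Let W be the mollification of U at scale e, with values in O because O is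
    convex (convex_mean), and R_a the commutator, that is the mollification of
    G_a(U) minus G_a(W).  Testing the system with the mollification of
    phi B(W) (tested_equation) and integrating the derivative of
    phi (B(W) R_a + Q_a(W)) to zero (integrated_by_parts) give

      sum_a int d_a phi Q_a(U) = sum_a int d_a phi (Q_a(U) - Q_a(W) - B(W) R_a)
                                 - sum_a int phi d_a(B(W)) R_a.

    A Taylor expansion at the mean value W shows that R_a is quadratic in the
    oscillation of U (defect_near), and d_a(B(W)) is at most 1 / e times the
    oscillation.  By Young's inequality the right hand side is bounded by
    sqrt e times the integral of (1 + |U|)^3, plus the cubic modulus
    (entropy_defect_le).  Along a sequence of scales it vanishes, so that the
    entropy balance holds in the interior, for Lipschitz weights phi
    (local_entropy_balance).

    The weight is then chi(t) times a cutoff of the distance to the boundary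
    between e / 4 and e / 2, times a cutoff at distance r from the origin.  The
    first gradient is, almost everywhere, a multiple of the normal at the nearest
    boundary point, so that it produces the normal entropy flux in the boundary
    layer; the second one is O(1 / r) on the set |x| > r, where the flux is
    integrable (localized_estimate).  Sending e to 0 along scales that make the
    boundary flux small and r to infinity, dominated convergence yields the
    conservation of entropy.

    Three points need care.  The boundary distance is replaced by depth, the
    truncated distance to the complement, which is Lipschitz on the whole space
    and agrees with it where it matters.  Neither the normal field nor the
    averages of the cubic modulus are known to be measurable: the derivatives of
    the cutoff are represented by upper limits of difference quotients
    (upper_deriv), and the given integrals are bounded from below through the
    definition of the integral as a supremum (le_integral_sub).  Finally the
    nonlinearities are differentiable relative to convex sets only, so that the
    calculus takes place along segments and along sequences. *)


(** * Translation invariance of Lebesgue measure *)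

Lemma lebesgue_measure_shift {R : realType} (v : R) (A : set R) :
  measurable A ->
  lebesgue_measure ((fun x : R => x + v) @^-1` A) = lebesgue_measure A.
Proof.
move=> mA.
have mf : measurable_fun setT ((fun x => x + v) : measurableTypeR R -> measurableTypeR R).
  by apply: measurable_funD => //; exact: measurable_cst.
pose f_pack : {mfun _ >-> _} := HB.pack ((fun x => x + v) : measurableTypeR R -> measurableTypeR R) (isMeasurableFun.Build _ _ _ _ _ mf).
apply/esym; apply: (@lebesgue_measure_unique R (pushforward (@lebesgue_measure R) f_pack)) => //.
move=> _ [[a b]] _ <-; rewrite /pushforward.
rewrite [X in _ = lebesgue_measure X](_ : _ = [set` `]a - v, b - v]]); last first.
  by apply/seteqP; split => x /=; rewrite !in_itv/= ltrBlDr lerBrDr.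
rewrite !lebesgue_measure_itv/= !lte_fin ltrD2r; case: ifP => // _.
by rewrite -!EFinB; congr EFin; lra.
Qed.

Lemma product_measure_map d1 d2 (T1 : measurableType d1) (T2 : measurableType d2)
    (R : realType) (m1 : {sigma_finite_measure set T1 -> \bar R})
    (m2 : {sigma_finite_measure set T2 -> \bar R}) (f1 : T1 -> T1) (f2 : T2 -> T2) :
  measurable_fun setT f1 -> measurable_fun setT f2 ->
  (forall A, measurable A -> m1 (f1 @^-1` A) = m1 A) ->
  (forall A, measurable A -> m2 (f2 @^-1` A) = m2 A) ->
  forall A, measurable A ->
    (m1 \x m2)%E ((fun p => (f1 p.1, f2 p.2)) @^-1` A) = (m1 \x m2)%E A.
Proof.
move=> mf1 mf2 h1 h2 A mA.
pose f (p : T1 * T2) := (f1 p.1, f2 p.2).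
have mf : measurable_fun setT f.
  by apply: measurable_fun_pair; exact: measurableT_comp.
pose f_pack : {mfun _ >-> _} := HB.pack f (isMeasurableFun.Build _ _ _ _ _ mf).
apply/esym; apply: (@product_measure_unique _ _ _ _ _ _ _ (pushforward (m1 \x m2)%E f_pack)) => //.
move=> B C mB mC; rewrite /pushforward.
transitivity ((m1 \x m2)%E ((f1 @^-1` B) `*` (f2 @^-1` C))); first by [].
rewrite product_measure1E.
- by congr (_ * _)%E; [exact: h1|exact: h2].
- by rewrite -[f1 @^-1` B]setTI; exact: mf1.
- by rewrite -[f2 @^-1` C]setTI; exact: mf2.
Qed.

Lemma measurable_rV_shift {R : realType} n (v : 'rV[R]_n) :
  measurable_fun setT (fun x : 'rV[R]_n => x + v).
Proof.
apply: measurable_fun_rV => i; under eq_fun do rewrite mxE.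
by apply: measurable_funD => //; exact: measurable_coord.
Qed.

Lemma rV_lebesgue_shift {R : realType} n (v : 'rV[R]_n) (A : set 'rV[R]_n) :
  measurable A -> rV_lebesgue n ((fun x => x + v) @^-1` A) = rV_lebesgue n A.
Proof.
elim: n v A => [|n ih] v A mA.
  by congr (rV_lebesgue _ _); apply/seteqP; split=> x /=; rewrite (_ : x + v = x)//;
   apply/rowP => -[].
rewrite /= /cons_measure /pushforward.
pose v' := \row_j v 0 (lift ord0 j).
have mA' : measurable (@rV_cons _ _ @^-1` A).
  by rewrite -[@rV_cons _ _ @^-1` A]setTI; exact: measurable_rV_cons.
rewrite -[RHS](@product_measure_map _ _ (measurableTypeR R) 'rV[R]_n R
  (@lebesgue_measure R) (rV_lebesgue n) (fun x : R => x + v 0 ord0)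
  (fun x => x + v') _ _ _ _ _ mA').
- congr (_ _); apply/seteqP; split => -[a x] /=; rewrite /rV_cons/=;
  (set y := (X in A X); set z := (X in _ -> A X); suff -> : z = y by []);
  apply/rowP => i; rewrite !mxE; case: unliftP => [j ->|->] //; rewrite !mxE//.
- by apply: measurable_funD => //; exact: measurable_cst.
- exact: measurable_rV_shift.
- by move=> B mB; exact: lebesgue_measure_shift.
- by move=> B mB; exact: ih.
Qed.

Lemma spacetime_shift {R : realType} k (v : 'rV[R]_k * R) (A : set ('rV[R]_k * R)) :
  measurable (A : set ('rV[R]_k * measurableTypeR R)) ->
  spacetime_lebesgue (k:=k) ((fun X => X + v) @^-1` A) = spacetime_lebesgue A.
Proof.
move=> mA; rewrite /spacetime_lebesgue.
rewrite -[RHS](@product_measure_map _ _ 'rV[R]_k (measurableTypeR R) R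
  (rV_lebesgue k) (@lebesgue_measure R) (fun x => x + v.1)
  (fun x : R => x + v.2) _ _ _ _ _ mA) //.
- exact: measurable_rV_shift.
- by apply: measurable_funD => //; exact: measurable_cst.
- by move=> B mB; exact: rV_lebesgue_shift.
- by move=> B mB; exact: lebesgue_measure_shift.
Qed.

(** * Sup norms, open sets and balls *)

Section sup_norm.
Context {R : realType}.

Lemma rV_norm_ltP n (x : 'rV[R]_n) (r : R) : 0 < r ->
  `|x| < r <-> forall i, `|x 0 i| < r.
Proof.
move=> r0; rewrite [`|x|]mx_normrE; split.
  by move=> /bigmax_ltP[_ h] i; exact: (h (0, i)).
by move=> h; apply/bigmax_ltP; split => // -[i j] _ /=; rewrite ord1.
Qed.

Lemma rV_norm_leP n (x : 'rV[R]_n) (r : R) : 0 <= r ->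
  `|x| <= r <-> forall i, `|x 0 i| <= r.
Proof.
move=> r0; rewrite [`|x|]mx_normrE; split.
  by move=> /bigmax_leP[_ h] i; exact: (h (0, i)).
by move=> h; apply/bigmax_leP; split => // -[i j] _ /=; rewrite ord1.
Qed.

Lemma le_rV_norm n (x : 'rV[R]_n) i : `|x 0 i| <= `|x|.
Proof. by have /(_ i) := (rV_norm_leP x (normr_ge0 x)).1 (lexx _). Qed.

Lemma spacetime_norm_ltP k (X : 'rV[R]_k * R) (r : R) :
  `|X| < r <-> `|X.1| < r /\ `|X.2| < r.
Proof. by rewrite [`|X|]/Num.norm/= gt_max; split=> /andP. Qed.

Lemma spacetime_norm_leP k (X : 'rV[R]_k * R) (r : R) :
  `|X| <= r <-> `|X.1| <= r /\ `|X.2| <= r.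
Proof. by rewrite [`|X|]/Num.norm/= ge_max; split=> /andP. Qed.

End sup_norm.

Section measurable_open.
Context {R : realType}.

(** Boxes with rational centres and rational radii form a countable base. *)
Lemma measurable_open_coord d (T : measurableType d) (S : topologicalType)
    (f : T -> S) (J : finType) (co : J -> S -> R) (A : set S) :
  (forall j, measurable_fun setT (co j \o f)) ->
  (forall x, A x -> exists2 e : R, 0 < e &
     forall y, (forall j, `|co j y - co j x| < e) -> A y) ->
  measurable (f @^-1` A).
Proof.
move=> mco oA.
pose box (cm : {ffun J -> rat} * nat) : set S :=
  [set y | forall j, `|co j y - ratr (cm.1 j)| < cm.2.+1%:R^-1].
have mbox cm : measurable (f @^-1` box cm).
  rewrite [X in measurable X](_ : _ = \bigcap_(j in [set: J])
    ((fun x => co j (f x)) @^-1` (ball (ratr (cm.1 j) : R) (cm.2.+1%:R^-1)))).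
    apply: fin_bigcap_measurable => // j _.
    by rewrite -[X in measurable X]setTI; apply: mco => //; exact: measurable_ball.
  apply/seteqP; split => x /=.
    by move=> h j _ /=; rewrite -ball_normE /= distrC; exact: h.
  by move=> h j; have := h j I; rewrite /= -ball_normE /= distrC.
rewrite [X in measurable X](_ : _ = \bigcup_(cm in [set: {ffun J -> rat} * nat])
    (if pselect (box cm `<=` A) then f @^-1` box cm else set0)).
  apply: countable_bigcupT_measurable; first exact: countableP.
  by move=> cm; case: (pselect _) => h; [exact: mbox|exact: measurable0].
apply/seteqP; split => x /=; last first.
  by move=> [cm _]; case: pselect => //= h /h.
move=> /oA[e e0 he].
have [m m2 _] : exists2 m : nat, m.+1%:R^-1 < e / 2 & True.
  have e20 : 0 < e / 2 by lra.
  have := near_infty_natSinv_lt (PosNum e20).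
  by move=> [m _ /(_ m (leqnn _)) /= hm]; exists m.
have : forall j, exists q : rat, `|co j (f x) - ratr q| < m.+1%:R^-1.
  move=> j.
  have h : co j (f x) - m.+1%:R^-1 < co j (f x) by rewrite ltrBlDr ltrDl invr_gt0.
  have [q] := rat_in_itvoo h; rewrite in_itv /= => /andP[q1 q2].
  by exists q; rewrite ger0_norm ?subr_ge0 ?(ltW q2)// ltrBlDr addrC -ltrBlDr.
move=> /choice[c hc].
exists ([ffun j => c j], m) => //.
case: pselect => [_ j /=|]; first by rewrite ffunE; exact: hc.
case=> y hy; apply: he => j; move: (hy j) (hc j); rewrite /= ffunE.
move: (ratr (c j)) (m.+1%:R^-1) m2 => q u m2 h1 h2.
rewrite (_ : _ - _ = (co j y - q) - (co j (f x) - q)); last lra.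
by rewrite (le_lt_trans (ler_normB _ _))//; lra.
Qed.

Lemma measurable_rV_open n (A : set 'rV[R]_n) : open A -> measurable A.
Proof.
move=> oA.
have := @measurable_open_coord _ 'rV[R]_n 'rV[R]_n idfun 'I_n
   (fun i (x : 'rV[R]_n) => x 0 i) A.
apply; first by move=> j; exact: measurable_coord.
move=> x Ax.
have := open_nbhs_nbhs (conj oA Ax); rewrite -nbhs_ballE => -[e /= e0 he].
exists e => // y hy; apply: he; rewrite -ball_normE /= distrC.
by apply/rV_norm_ltP => // i; rewrite !mxE.
Qed.

Lemma measurable_spacetime_open k (A : set ('rV[R]_k * R)) : open A ->
  measurable (A : set ('rV[R]_k * measurableTypeR R)).
Proof.
move=> oA.
have := @measurable_open_coord _ ('rV[R]_k * measurableTypeR R)%type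
  ('rV[R]_k * R)%type idfun (option 'I_k)
  (fun i (X : 'rV[R]_k * R) => if i is Some j then X.1 0 j else X.2) A.
apply.
  case=> [j|]; last exact: measurable_snd.
  by apply: (measurableT_comp (measurable_coord j)); exact: measurable_fst.
move=> X AX.
have := open_nbhs_nbhs (conj oA AX); rewrite -nbhs_ballE => -[e /= e0 he].
exists e => // Y hY; apply: he; rewrite -ball_normE /= distrC.
apply/spacetime_norm_ltP; split; last exact: (hY None).
by apply/rV_norm_ltP => // i; rewrite !mxE; exact: (hY (Some i)).
Qed.

Lemma continuous_measurable_spacetime k (D : set ('rV[R]_k * R))
    (f : 'rV[R]_k * R -> R) : open D -> {in D, continuous f} ->
  measurable_fun (D : set ('rV[R]_k * measurableTypeR R)) f.
Proof.
move=> oD cf; apply: (measurability _ (RGenOpens.measurableE R)) => _ [_ [a [b ->] <-]].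
apply: measurable_spacetime_open; rewrite openE => X [DX fX] /=; rewrite /interior.
have h1 : nbhs X D by exact: open_nbhs_nbhs.
have h2 : nbhs X (f @^-1` `]a, b[).
  by apply: cf; [exact: mem_set|exact: open_nbhs_nbhs].
by near=> Y; split; near: Y.
Unshelve. all: by end_near. Qed.


End measurable_open.

Section box_measure.
Context {R : realType}.

(** Balls of the sup norm are cubes, whose measure is computed side by side. *)
Lemma rV_lebesgue_ball0 n (r : R) : 0 < r ->
  rV_lebesgue n [set x : 'rV[R]_n | `|x| < r] = ((r *+ 2) ^+ n)%:E.
Proof.
move=> r0; elim: n => [|n ih].
  rewrite expr0 /= diracE mem_set //=.
  by apply/rV_norm_ltP => // -[].
rewrite /= /cons_measure /pushforward.
rewrite [X in (_ \x _)%E X](_ : _ = (ball (0:R) r) `*` [set x : 'rV[R]_n | `|x| < r]).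
  rewrite product_measure1E //; last 2 first.
  - exact: measurable_ball.
  - apply: measurable_rV_open.
    have -> : [set x : 'rV[R]_n | `|x| < r] = ball 0 r.
      by apply/seteqP; split => x /=; rewrite -ball_normE /= sub0r normrN.
    exact: ball_open.
  rewrite [X in (X * _)%E](lebesgue_measure_ball 0 (ltW r0)) exprS EFinM.
  by congr (_ * _)%E; exact: ih.
apply/seteqP; split => -[a x] /=; rewrite -ball_normE /= sub0r normrN.
  move/(rV_norm_ltP _ r0) => h; split.
    by have := h ord0; rewrite mxE unlift_none.
  by apply/rV_norm_ltP => // i; have := h (lift ord0 i); rewrite mxE liftK.
move=> [ha /(rV_norm_ltP _ r0) h]; apply/rV_norm_ltP => // i; rewrite mxE /=.
by case: unliftP.
Qed.

Lemma spacetime_lebesgue_ball k (X : 'rV[R]_k * R) (r : R) : 0 < r ->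
  spacetime_lebesgue (ball X r) = ((r *+ 2) ^+ k.+1)%:E.
Proof.
move=> r0.
have mB0 Y : measurable (ball (Y : 'rV[R]_k * R) r : set ('rV[R]_k * measurableTypeR R)).
  by apply: measurable_spacetime_open; exact: ball_open.
have <- := @spacetime_shift _ _ X _ (mB0 X).
have -> : (fun Y => Y + X) @^-1` ball X r = [set x : 'rV[R]_k | `|x| < r] `*` ball (0:R) r.
  apply/seteqP; split => -[x t] /=; rewrite -!ball_normE /=.
    rewrite sub0r normrN distrC addrK => /spacetime_norm_ltP//.
  by rewrite sub0r normrN => h; rewrite distrC addrK; apply/spacetime_norm_ltP.
rewrite /spacetime_lebesgue product_measure1E; last 2 first.
- apply: measurable_rV_open.
  have -> : [set x : 'rV[R]_k | `|x| < r] = ball 0 r.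
    by apply/seteqP; split => x /=; rewrite -ball_normE /= sub0r normrN.
  exact: ball_open.
- exact: measurable_ball.
rewrite exprSr EFinM; congr (_ * _)%E; first exact: rV_lebesgue_ball0.
exact: (lebesgue_measure_ball 0 (ltW r0)).
Qed.
End box_measure.

(** * Real-valued integrals and means in convex sets *)

Section integration.
Context d (T : measurableType d) (R : realType) (mu : {measure set T -> \bar R}).
Implicit Types (D : set T) (f g h : T -> R).

(** Integrability of real-valued functions, stated so that its rules do not mention extended
    reals. *)
Definition rint D f := mu.-integrable D (EFin \o f).

Lemma rint_measurable D f : rint D f -> measurable_fun D f.
Proof. by move=> /measurable_int /measurable_EFinP. Qed.

Lemma rint_le D f g : measurable D -> measurable_fun D f -> rint D g ->
  (forall x, D x -> `|f x| <= g x) -> rint D f.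
Proof.
move=> mD mf ig fg; apply: le_integrable ig => //; first exact/measurable_EFinP.
by move=> x Dx /=; rewrite lee_fin (le_trans (fg x Dx))// ler_norm.
Qed.

Lemma eq_rint D f g : measurable D -> (forall x, D x -> f x = g x) ->
  rint D f -> rint D g.
Proof. by move=> mD e; apply: eq_integrable => // x /set_mem Dx /=; rewrite e. Qed.

Lemma rintD D f g : measurable D -> rint D f -> rint D g ->
  rint D (fun x => f x + g x).
Proof. by move=> mD hf hg; exact: (integrableD mD hf hg). Qed.

Lemma rintZl D c f : measurable D -> rint D f -> rint D (fun x => c * f x).
Proof. by move=> mD hf; exact: (integrableZl mD c hf). Qed.

Lemma rintN D f : measurable D -> rint D f -> rint D (fun x => - f x).
Proof. by move=> mD hf; exact: (integrableN hf). Qed.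

Lemma rintB D f g : measurable D -> rint D f -> rint D g ->
  rint D (fun x => f x - g x).
Proof. by move=> mD hf hg; apply: rintD => //; exact: rintN. Qed.

Lemma rint_norm D f : measurable D -> rint D f -> rint D (fun x => `|f x|).
Proof.
move=> mD hf; exact: (integrable_abse hf).
Qed.

Lemma rint0 D : rint D (fun=> 0).
Proof. exact: integrable0. Qed.

Lemma rint_sum D I (s : seq I) (F : I -> T -> R) : measurable D ->
  (forall i, rint D (F i)) -> rint D (fun x => \sum_(i <- s) F i x).
Proof.
move=> mD hF; elim: s => [|i s ih].
  by apply: eq_rint (rint0 D) => // x _; rewrite big_nil.
by apply: eq_rint (rintD mD (hF i) ih) => // x _; rewrite big_cons.
Qed.

Lemma rintMb D f g (M : R) : measurable D -> measurable_fun D f ->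
  (forall x, D x -> `|f x| <= M) -> rint D g -> rint D (fun x => f x * g x).
Proof.
move=> mD mf fM ig.
apply: (@rint_le D _ (fun x => M * `|g x|)) => //.
- by apply: measurable_funM => //; exact: rint_measurable.
- by apply: rintZl => //; exact: rint_norm.
by move=> x Dx; rewrite normrM ler_wpM2r// fM.
Qed.

Lemma rint_bounded D f (M : R) : measurable D -> (mu D < +oo)%E ->
  measurable_fun D f -> (forall x, D x -> `|f x| <= M) -> rint D f.
Proof.
move=> mD Doo mf fM; apply: measurable_bounded_integrable => //.
exists M; split; first exact: num_real.
by move=> x Mx y /= Dy; rewrite (le_trans (fM y Dy))// ltW.
Qed.

Lemma rint_indic (A : set T) : measurable A -> (mu A < +oo)%E ->
  rint setT (\1_A : T -> R).
Proof.
move=> mA Aoo; apply/integrableP; split; first exact/measurable_EFinP.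
under eq_integral do rewrite /= ger0_norm//.
by rewrite integral_indic// setIT.
Qed.

Lemma rintS D E f : measurable D -> measurable E -> E `<=` D ->
  rint D f -> rint E f.
Proof. by move=> mD mE ED; exact: integrableS. Qed.

Lemma Rintegral_sum D I (s : seq I) (F : I -> T -> R) : measurable D ->
  (forall i, rint D (F i)) ->
  Rintegral mu D (fun x => \sum_(i <- s) F i x) =
  \sum_(i <- s) Rintegral mu D (F i).
Proof.
move=> mD hF; elim: s => [|i s ih].
  under eq_Rintegral do rewrite big_nil.
  by rewrite big_nil Rintegral_cst// mul0r.
under eq_Rintegral do rewrite big_cons.
by rewrite big_cons (RintegralD mD (hF i) (rint_sum s mD hF)) ih.
Qed.

Lemma eq_RintegralS D f g : (forall x, D x -> f x = g x) ->
  Rintegral mu D f = Rintegral mu D g.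
Proof. by move=> fg; apply: eq_Rintegral => x /set_mem; exact: fg. Qed.

Lemma norm_Rintegral_le D f g : measurable D -> measurable_fun D f ->
  rint D g -> (forall x, D x -> `|f x| <= g x) ->
  `|Rintegral mu D f| <= Rintegral mu D g.
Proof.
move=> mD mf ig fg.
have i_f : rint D f by exact: rint_le ig fg.
apply: (le_trans (le_normr_Rintegral mD i_f)).
by apply: le_Rintegral => //; exact: rint_norm.
Qed.

Lemma eq_Rintegral_ae D f g : measurable D -> measurable_fun D f ->
  measurable_fun D g -> {ae mu, forall x, D x -> f x = g x} ->
  Rintegral mu D f = Rintegral mu D g.
Proof.
move=> mD mf mg fg; rewrite /Rintegral; congr fine.
apply: ae_eq_integral => //; [exact/measurable_EFinP|exact/measurable_EFinP|].
by move: fg; apply: filterS => x /= h Dx; rewrite h.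
Qed.

Lemma Rintegral_dominated_cvg D (F : nat -> T -> R) f g :
  measurable D -> (forall m, measurable_fun D (F m)) -> measurable_fun D f ->
  {ae mu, forall x, D x -> F ^~ x @ \oo --> f x} -> rint D g ->
  (forall m x, D x -> `|F m x| <= g x) ->
  (fun m => Rintegral mu D (F m)) @ \oo --> Rintegral mu D f.
Proof.
move=> mD mF mf Ff ig Fg.
have FfE : {ae mu, forall x, D x -> (fun m => (EFin \o F m) x) @ \oo --> (EFin \o f) x}.
  move: Ff; apply: filterS => x /= h Dx; apply: cvg_EFin; first by near=> m.
  exact: h.
have FgE : {ae mu, forall x m, D x -> (`|(EFin \o F m) x| <= (EFin \o g) x)%E}.
  by apply: aeW => x m Dx /=; rewrite lee_fin; exact: Fg.
have [i_f _ h] := @dominated_convergence _ _ _ mu D mD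
  (fun m => EFin \o F m) (EFin \o f) (EFin \o g)
  (fun m => (measurable_EFinP _ _).2 (mF m)) ((measurable_EFinP _ _).2 mf)
  FfE ig FgE.
have h' : (fun m => \int[mu]_(x in D) (F m x)%:E)%E @ \oo --> (Rintegral mu D f)%:E.
  rewrite /Rintegral fineK; first exact: h.
  exact: integrable_fin_num.
exact: fine_cvg h'.
Unshelve. all: by end_near. Qed.

Lemma ae_imp (P Q : T -> Prop) : (forall x, P x -> Q x) ->
  {ae mu, forall x, P x} -> {ae mu, forall x, Q x}.
Proof. by move=> PQ; apply: filterS. Qed.

Lemma Rintegral_eq0_ae D f : measurable D -> rint D f ->
  (forall x, D x -> 0 <= f x) -> Rintegral mu D f = 0 ->
  {ae mu, forall x, D x -> f x = 0}.
Proof.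
move=> mD i_f f0 If.
have mf : measurable_fun D (EFin \o f) by exact: measurable_int i_f.
have : (\int[mu]_(x in D) `|(EFin \o f) x| = 0)%E.
  have e : (\int[mu]_(x in D) (f x)%:E = 0)%E.
    rewrite -[LHS]fineK; first by rewrite -/(Rintegral mu D f) If.
    exact: integrable_fin_num.
  rewrite -[RHS]e; apply: eq_integral => x /set_mem Dx /=.
  by rewrite ger0_norm// f0.
move=> /(ae_eq_integral_abs mu mD mf).
by apply: filterS => x /= h Dx; have := h Dx; move=> [].
Qed.

Lemma Rintegral_gt0_ex D f : measurable D -> rint D f ->
  0 < Rintegral mu D f -> exists2 x, D x & 0 < f x.
Proof.
move=> mD i_f f0; apply: contrapT => h.
have : Rintegral mu D f <= Rintegral mu D (fun=> 0).
  apply: le_Rintegral => //; first exact: rint0.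
  by move=> x Dx; rewrite leNgt; apply/negP => ?; apply: h; exists x.
by rewrite Rintegral_cst// mul0r leNgt f0.
Qed.

End integration.

Section convex_mean.
Context {R : realType}.

(** Convexity with unnormalised weights, which avoids carrying elements of the
    unit interval as a type. *)
Definition convexly_closed n (C : set 'rV[R]_n) := forall x y (a b : R),
  0 <= a -> 0 <= b -> 0 < a + b -> C x -> C y ->
  C ((a + b)^-1 *: (a *: x + b *: y)).

Lemma convex_setP n (O : set 'rV[R]_n) : convex_set O -> convexly_closed O.
Proof.
move=> cO x y a b a0 b0 ab Ox Oy.
have h0 : 0 <= a / (a + b) by rewrite divr_ge0// ltW.
have h1 : a / (a + b) <= 1 by rewrite ler_pdivrMr// mul1r lerDl.
have := cO x y (Itv01 h0 h1) (mem_set Ox) (mem_set Oy).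
move=> /set_mem.
suff -> : (a + b)^-1 *: (a *: x + b *: y) =
  (a / (a + b)) *: x + (1 - a / (a + b)) *: y by [].
rewrite scalerDr !scalerA ![(a+b)^-1 * _]mulrC; congr (_ + _ *: _).
by field; rewrite gt_eqF.
Qed.

Lemma dotp_rV_cons n (p r : R * 'rV[R]_n) :
  dotp (rV_cons p) (rV_cons r) = p.1 * r.1 + dotp p.2 r.2.
Proof.
rewrite /dotp big_ord_recl !mxE !unlift_none; congr (_ + _).
by apply: eq_bigr => i _; rewrite !mxE liftK.
Qed.

Lemma dotpDr n (u v w : 'rV[R]_n) : dotp u (v + w) = dotp u v + dotp u w.
Proof. by rewrite /dotp -big_split; apply: eq_bigr => i _; rewrite mxE mulrDr. Qed.
Lemma dotpZr n a (u v : 'rV[R]_n) : dotp u (a *: v) = a * dotp u v.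
Proof. by rewrite /dotp mulr_sumr; apply: eq_bigr => i _; rewrite mxE mulrCA. Qed.
Lemma dotpC n (u v : 'rV[R]_n) : dotp u v = dotp v u.
Proof. by apply: eq_bigr => i _; rewrite mulrC. Qed.
Lemma dotp0r n (u : 'rV[R]_n) : dotp u 0 = 0.
Proof. by rewrite /dotp big1// => i _; rewrite mxE mulr0. Qed.

Lemma rV_consD n (p r : R * 'rV[R]_n) :
  rV_cons p + rV_cons r = rV_cons (p.1 + r.1, p.2 + r.2).
Proof. by apply/rowP => i; rewrite !mxE; case: unliftP => [j|] _ //=; rewrite mxE. Qed.
Lemma rV_consZ n a (p : R * 'rV[R]_n) :
  a *: rV_cons p = rV_cons (a * p.1, a *: p.2).
Proof. by apply/rowP => i; rewrite !mxE; case: unliftP => [j|] _ //=; rewrite mxE. Qed.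

(** A point outside a convex set, closed or not, is weakly separated from it:
    the slope that extends a separating functional from a hyperplane is a
    supremum, and no compactness enters. *)
Lemma convex_separation n (C : set 'rV[R]_n) : convexly_closed C -> ~ C 0 ->
  (forall x, ~ C x) \/ exists2 v, v != 0 & forall x, C x -> 0 <= dotp v x.
Proof.
elim: n C => [|n ih] C cC C0.
  by left => x Cx; apply: C0; rewrite (_ : 0 = x)//; apply/rowP => -[].
have nz a (v : 'rV[R]_n) : a != 0 -> rV_cons (a, v) != 0.
  apply: contra_neq => /rowP/(_ ord0); rewrite !mxE unlift_none //.
have [[N nN]|noN] := pselect (exists N : R * 'rV[R]_n, C (rV_cons N) /\ N.1 < 0);
  last first.
  right; exists (rV_cons (1, 0)); first by rewrite nz// oner_neq0.
  move=> x; rewrite -(rV_unconsK x) => Cx; rewrite dotp_rV_cons mul1r dotpC dotp0r.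
  rewrite addr0 leNgt; apply/negP => h; apply: noN; by exists (rV_uncons x).
have [[P nP]|noP] := pselect (exists P : R * 'rV[R]_n, C (rV_cons P) /\ 0 < P.1);
  last first.
  right; exists (rV_cons (-1, 0)); first by rewrite nz// oppr_eq0 oner_neq0.
  move=> x; rewrite -(rV_unconsK x) => Cx; rewrite dotp_rV_cons mulN1r dotpC dotp0r.
  rewrite addr0 oppr_ge0 leNgt; apply/negP => h; apply: noP; by exists (rV_uncons x).
pose C1 := [set x : 'rV[R]_n | C (rV_cons (0, x))].
have cC1 : convexly_closed C1.
  move=> x y a b a0 b0 ab Cx Cy; rewrite /C1 /=.
  have := cC _ _ a b a0 b0 ab Cx Cy.
  by rewrite !rV_consZ rV_consD rV_consZ /= !mulr0 addr0 mulr0.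
have C10 : ~ C1 0.
  apply: contra_not C0; rewrite /C1 /=; congr C.
  by apply/rowP => i; rewrite !mxE; case: unliftP => [j|] _ //=; rewrite mxE.
(* the point where the segment from p to q meets the hyperplane *)
have comb (p q : R * 'rV[R]_n) : C (rV_cons p) -> 0 < p.1 -> C (rV_cons q) ->
    q.1 < 0 -> C1 ((- q.1 + p.1)^-1 *: ((- q.1) *: p.2 + p.1 *: q.2)).
  move=> Cp p0 Cq q0; rewrite /C1 /=.
  have h : 0 < - q.1 + p.1 by lra.
  have := cC _ _ (- q.1) p.1 _ _ h Cp Cq.
  rewrite !rV_consZ rV_consD rV_consZ /= (_ : - q.1 * _ + _ = 0) ?mulr0; last ring.
  by apply; lra.
have [noC1|[v v0 hv]] := ih _ cC1 C10.
  by exfalso; apply: (noC1 _ (comb P N nP.1 nP.2 nN.1 nN.2)).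
pose S := [set - dotp v p.2 / p.1 | p in [set p | C (rV_cons p) /\ 0 < p.1]].
have ub (q : R * 'rV[R]_n) : C (rV_cons q) -> q.1 < 0 -> ubound S (dotp v q.2 / - q.1).
  move=> Cq q0 _ [p [Cp p0] <-].
  have := hv _ (comb p q Cp p0 Cq q0).
  rewrite dotpZr dotpDr !dotpZr pmulr_rge0; last by rewrite invr_gt0; lra.
  move=> h; rewrite ler_pdivrMr// mulrAC ler_pdivlMr ?oppr_gt0//; nra.
have hS : has_sup S.
  split; first by exists (- dotp v P.2 / P.1); exists P.
  by exists (dotp v N.2 / - N.1); apply: ub; case: nN.
right; exists (rV_cons (sup S, v)).
  apply: contra_neq v0 => /rowP h; apply/rowP => i.
  by have := h (lift ord0 i); rewrite !mxE liftK.
move=> x; rewrite -(rV_unconsK x); move: (rV_uncons x) => {x} p Cp.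
rewrite dotp_rV_cons /=; have [p0|p0|p0] := ltgtP p.1 0.
- have := ge_sup (ex_intro _ _ (ex_intro2 _ _ P nP erefl)) (ub _ Cp p0).
  rewrite ler_pdivlMr ?oppr_gt0//; lra.
- have := ub_le_sup hS.2 (ex_intro2 _ _ p (conj Cp p0) erefl).
  rewrite ler_pdivrMr//; lra.
- by rewrite p0 mulr0 add0r; apply: hv; rewrite /C1 /= -p0 -surjective_pairing.
Qed.

Lemma convex_mean_eq0 d (T : measurableType d) (mu : {measure set T -> \bar R})
    n (C : set 'rV[R]_n) (w : T -> R) (f : T -> 'rV[R]_n) :
  convexly_closed C -> (forall x, 0 <= w x) -> (forall x, 0 < w x -> C (f x)) ->
  rint mu setT w -> (forall i, rint mu setT (fun x => w x * f x 0 i)) ->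
  0 < Rintegral mu setT w ->
  (forall i, Rintegral mu setT (fun x => w x * f x 0 i) = 0) -> C 0.
Proof.
elim: n C w f => [|n ih] C w f cC w0 wC iw iwf Iw Iwf.
  have [x _ wx] := Rintegral_gt0_ex measurableT iw Iw.
  by have := wC x wx; congr C; apply/rowP => -[].
apply: contrapT => C0.
have [noC|[v v0 hv]] := convex_separation cC C0.
  by have [x _ wx] := Rintegral_gt0_ex measurableT iw Iw; exact: noC (wC x wx).
have [i vi] : exists i, v 0 i != 0.
  apply: contrapT => h; move/eqP: v0; apply; apply/rowP => i; rewrite mxE.
  by apply/eqP/negPn/negP => vi; apply: h; exists i.
pose g x := w x * dotp v (f x).
have gE x : g x = \sum_i v 0 i * (w x * f x 0 i).
  by rewrite /g /dotp mulr_sumr; apply: eq_bigr => j _; ring.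
have ig : rint mu setT g.
  apply: (@eq_rint _ _ _ _ _ (fun x => \sum_i v 0 i * (w x * f x 0 i))) => //.
  by apply: rint_sum => // j; exact: rintZl.
have g0 x : 0 <= g x.
  have [wx|wx] := ltP 0 (w x); first by rewrite mulr_ge0// hv//; exact: wC.
  by rewrite /g (_ : w x = 0) ?mul0r//; apply/eqP; rewrite eq_le wx w0.
have Ig : Rintegral mu setT g = 0.
  rewrite (eq_RintegralS _ (fun x _ => gE x)) Rintegral_sum//; last first.
    by move=> j; exact: rintZl.
  by rewrite big1// => j _; rewrite RintegralZl ?Iwf ?mulr0//; exact: iwf.
have gae := Rintegral_eq0_ae measurableT ig (fun x _ => g0 x) Ig.
pose Z := g @^-1` [set 0].
have mZ : measurable Z.
  by rewrite -[Z]setTI; apply: (rint_measurable ig) => //; exact: measurable_set1.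
pose w' x := \1_Z x * w x.
have mind : measurable_fun setT (\1_Z : T -> R) by exact: measurable_indic.
have b1 x : setT x -> `|\1_Z x : R| <= 1.
  by move=> _; rewrite indicE; case: (_ \in _); rewrite ?normr1 ?normr0.
have w'ae h : rint mu setT (fun x => w x * h x) ->
    Rintegral mu setT (fun x => w' x * h x) = Rintegral mu setT (fun x => w x * h x).
  move=> ih'; apply: eq_Rintegral_ae => //.
  - apply: (@eq_measurable_fun _ _ _ _ _ (fun x => \1_Z x * (w x * h x))).
      by move=> x _; rewrite /w'; ring.
    by apply: measurable_funM => //; exact: rint_measurable ih'.
  - exact: rint_measurable ih'.
  apply: filterS gae => x gx _; rewrite /w' indicE mem_set ?mul1r//.
  exact: gx.
have iw'h h : rint mu setT (fun x => w x * h x) ->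
    rint mu setT (fun x => w' x * h x).
  move=> ih'; apply: eq_rint (rintMb measurableT mind b1 ih') => // x _.
  by rewrite /w'; ring.
have iw1 : rint mu setT (fun x => w x * 1) by apply: eq_rint iw => // x _; rewrite mulr1.
pose C' := [set y | exists c, [/\ C c, dotp v c = 0 & y = col' i c]].
have : C' 0.
  apply: (ih C' w' (fun x => col' i (f x))).
  - move=> _ _ a b a0 b0 ab [c [Cc vc ->]] [e [Ce ve ->]].
    exists ((a + b)^-1 *: (a *: c + b *: e)); split.
    + exact: cC.
    + by rewrite dotpZr dotpDr !dotpZr vc ve !mulr0 addr0 mulr0.
    + by apply/rowP => j; rewrite !mxE.
  - by move=> x; rewrite /w' mulr_ge0// indicE.
  - move=> x; rewrite /w' indicE; have [Zx|Zx] := boolP (x \in Z); last by rewrite mul0r ltxx.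
    rewrite mul1r => wx; exists (f x); split => //; first exact: wC.
    have : g x = 0 by move: Zx; rewrite inE.
    by rewrite /g => /eqP; rewrite mulf_eq0 gt_eqF//= => /eqP.
  - by apply: eq_rint (iw'h _ iw1) => // x _; rewrite mulr1.
  - by move=> j; apply: eq_rint (iw'h _ (iwf (lift i j))) => // x _; rewrite mxE.
  - have := w'ae _ iw1.
    rewrite (eq_RintegralS _ (_ : forall x, setT x -> w' x * 1 = w' x)); last by move=> x _; rewrite mulr1.
    rewrite (eq_RintegralS _ (_ : forall x, setT x -> w x * 1 = w x)); last by move=> x _; rewrite mulr1.
    by move=> ->.
  - move=> j; rewrite -(Iwf (lift i j)) -w'ae//.
    by apply: eq_RintegralS => x _; rewrite mxE.
move=> [c [Cc vc c0]]; apply: C0; rewrite (_ : 0 = c)//.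
have cj j : c 0 (lift i j) = 0 by move/rowP: c0 => /(_ j); rewrite !mxE.
apply/rowP => j; rewrite mxE; have [k ->|->] := unliftP i j; first by rewrite cj.
move: vc; rewrite /dotp (bigD1 i)//= big1 ?addr0.
  by move=> /eqP; rewrite mulf_eq0 (negbTE vi)/= => /eqP.
by move=> l; have [k ->|->] := unliftP i l; rewrite ?eqxx// cj mulr0.
Qed.

(** The barycentre of a probability carried by a convex set lies in that set,
    even when the set is neither closed nor of full dimension. *)
Lemma convex_mean d (T : measurableType d) (mu : {measure set T -> \bar R})
    n (O : set 'rV[R]_n) (w : T -> R) (f : T -> 'rV[R]_n) :
  convex_set O -> (forall x, 0 <= w x) -> (forall x, 0 < w x -> O (f x)) ->
  rint mu setT w -> (forall i, rint mu setT (fun x => w x * f x 0 i)) ->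
  Rintegral mu setT w = 1 ->
  O (\row_i Rintegral mu setT (fun x => w x * f x 0 i)).
Proof.
move=> /convex_setP cO w0 wO iw iwf Iw; set m := \row_i _.
suff : [set y | O (y + m)] 0 by rewrite /= add0r.
have iwm i : rint mu setT (fun x => w x * m 0 i).
  by apply: eq_rint (rintZl (m 0 i) measurableT iw) => // x _; rewrite mulrC.
apply: (@convex_mean_eq0 _ _ mu _ _ w (fun x => f x - m)) => //.
- move=> x y a b a0 b0 ab Ox Oy /=.
  have -> : (a + b)^-1 *: (a *: x + b *: y) + m =
            (a + b)^-1 *: (a *: (x + m) + b *: (y + m)).
    rewrite [a *: (x + m)]scalerDr [b *: (y + m)]scalerDr addrACA -[a *: m + _]scalerDl.
    by rewrite [in RHS]scalerDr [in RHS]scalerA mulVf ?scale1r// gt_eqF.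
  exact: cO.
- by move=> x /wO /=; rewrite subrK.
- move=> i; apply: eq_rint (rintB measurableT (iwf i) (iwm i)) => // x _.
  by rewrite !mxE mulrBr.
- by rewrite Iw.
- move=> i.
  rewrite (eq_RintegralS _ (_ : forall x, setT x -> _ = w x * f x 0 i - w x * m 0 i)); last first.
    by move=> x _; rewrite !mxE mulrBr.
  rewrite RintegralB//; [|exact: iwf|exact: iwm].
  under [X in _ - X]eq_Rintegral do rewrite mulrC.
  by rewrite RintegralZl// Iw mulr1 mxE subrr.
Qed.

End convex_mean.

(** * The mollifying kernel *)

Section kernel.
Context {R : realType} {k : nat}.
Notation ST := ('rV[R]_k * R)%type.
Notation mST := ('rV[R]_k * measurableTypeR R)%type.
Notation mu := (@spacetime_lebesgue R k).
Notation K := (k.+1%:R : R).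

Definition sdot (X Y : ST) : R := dotp X.1 Y.1 + X.2 * Y.2.
Definition sq (X : ST) : R := sdot X X.

Lemma dotpDl n (u v w : 'rV[R]_n) : dotp (u + v) w = dotp u w + dotp v w.
Proof. by rewrite dotpC dotpDr !(dotpC w). Qed.
Lemma dotpZl n a (u v : 'rV[R]_n) : dotp (a *: u) v = a * dotp u v.
Proof. by rewrite dotpC dotpZr dotpC. Qed.
Lemma dotpNl n (u v : 'rV[R]_n) : dotp (- u) v = - dotp u v.
Proof. by rewrite -scaleN1r dotpZl mulN1r. Qed.
Lemma dotpNr n (u v : 'rV[R]_n) : dotp u (- v) = - dotp u v.
Proof. by rewrite dotpC dotpNl dotpC. Qed.
Lemma dotp_ge0 n (u : 'rV[R]_n) : 0 <= dotp u u.
Proof. by apply: sumr_ge0 => i _; rewrite -expr2 sqr_ge0. Qed.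

Lemma le_norm_dotp n (u v : 'rV[R]_n) : `|dotp u v| <= n%:R * (`|u| * `|v|).
Proof.
rewrite /dotp (le_trans (ler_norm_sum _ _ _))//.
apply: (@le_trans _ _ (\sum_(i < n) `|u| * `|v|)).
  by apply: ler_sum => i _; rewrite normrM ler_pM// le_rV_norm.
by rewrite sumr_const card_ord mulr_natl.
Qed.

Lemma sqr_norm_le_dotp n (u : 'rV[R]_n) : `|u| ^+ 2 <= dotp u u.
Proof.
have h : forall i, `|u 0 i| <= Num.sqrt (dotp u u).
  move=> i; rewrite -sqrtr_sqr ler_wsqrtr// /dotp (bigD1 i)//= -expr2 lerDl.
  by apply: sumr_ge0 => j _; rewrite -expr2 sqr_ge0.
have : `|u| <= Num.sqrt (dotp u u) by apply/rV_norm_leP; first exact: sqrtr_ge0.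
by rewrite -ler_sqr ?nnegrE ?sqrtr_ge0// sqr_sqrtr// dotp_ge0.
Qed.

Lemma sdotDl (X Y Z : ST) : sdot (X + Y) Z = sdot X Z + sdot Y Z.
Proof. by rewrite /sdot /= dotpDl; ring. Qed.
Lemma sdotDr (X Y Z : ST) : sdot X (Y + Z) = sdot X Y + sdot X Z.
Proof. by rewrite /sdot /= dotpDr; ring. Qed.
Lemma sdotZr a (X Y : ST) : sdot X (a *: Y) = a * sdot X Y.
Proof. by rewrite /sdot /= dotpZr mulrDr mulrCA. Qed.
Lemma sdotNl (X Y : ST) : sdot (- X) Y = - sdot X Y.
Proof. by rewrite /sdot /= dotpNl; ring. Qed.
Lemma sdotC (X Y : ST) : sdot X Y = sdot Y X.
Proof. by rewrite /sdot dotpC mulrC. Qed.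

Lemma sqD (X Y : ST) : sq (X + Y) = sq X + (sdot X Y *+ 2 + sq Y).
Proof. by rewrite /sq sdotDl !sdotDr (sdotC Y X); ring. Qed.
Lemma sqN X : sq (- X) = sq X.
Proof. by rewrite /sq sdotNl sdotC sdotNl opprK. Qed.
Lemma sq_ge0 X : 0 <= sq X.
Proof. by rewrite addr_ge0 ?dotp_ge0// -expr2 sqr_ge0. Qed.

Lemma le_norm_sdot (X Y : ST) : `|sdot X Y| <= K * (`|X| * `|Y|).
Proof.
rewrite /sdot (le_trans (ler_normD _ _))// -natr1 mulrDl mul1r lerD//.
  rewrite (le_trans (le_norm_dotp _ _))// ler_wpM2l// ler_pM//.
    by have /spacetime_norm_leP[] := lexx `|X|.
  by have /spacetime_norm_leP[] := lexx `|Y|.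
rewrite normrM ler_pM//.
  by have /spacetime_norm_leP[] := lexx `|X|.
by have /spacetime_norm_leP[] := lexx `|Y|.
Qed.

Lemma sq_le (X : ST) : sq X <= K * `|X| ^+ 2.
Proof. by rewrite (le_trans (ler_norm _))// (le_trans (le_norm_sdot _ _))// expr2. Qed.

Lemma sqr_norm_le_sq (X : ST) : `|X| ^+ 2 <= sq X.
Proof.
have : `|X| <= Num.sqrt (sq X).
  apply/spacetime_norm_leP; split.
    rewrite -(ger0_norm (normr_ge0 X.1)) -sqrtr_sqr ler_wsqrtr// /sq /sdot.
    by rewrite (le_trans (sqr_norm_le_dotp _))// lerDl -expr2 sqr_ge0.
  by rewrite -sqrtr_sqr ler_wsqrtr// /sq /sdot -expr2 lerDr dotp_ge0.
by rewrite -ler_sqr ?nnegrE ?sqrtr_ge0// sqr_sqrtr// sq_ge0.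
Qed.

Lemma norm_lt_sq (X : ST) e : 0 < e -> sq X < e ^+ 2 -> `|X| < e.
Proof.
move=> e0 h; rewrite -ltr_sqr ?nnegrE// ?(ltW e0)//.
exact: le_lt_trans (sqr_norm_le_sq X) h.
Qed.

Lemma spacetime_ballP (X Y : ST) e : 0 < e -> spacetime_ball X e Y <-> sq (X - Y) < e ^+ 2.
Proof.
move=> e0; rewrite /spacetime_ball /=.
have -> : enorm (X.1 - Y.1) ^+ 2 + (X.2 - Y.2) ^+ 2 = sq (X - Y).
  by rewrite /enorm sqr_sqrtr ?dotp_ge0// expr2.
by rewrite -{1}(ger0_norm (ltW e0)) -sqrtr_sqr ltr_sqrt// exprn_gt0.
Qed.

Variable e : R.
Hypothesis e0 : 0 < e.

Let m0 (s : R) : R := Num.max 0 s.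

(** Quadratic bump: of class C^{1,1}, supported exactly in the Euclidean ball
    of radius e, and explicit enough for its Taylor remainder to be bounded by
    hand. *)
Definition rho (Z : ST) : R := m0 (1 - sq Z / e ^+ 2) ^+ 2.
Definition drho (Z V : ST) : R :=
  2 * m0 (1 - sq Z / e ^+ 2) * (- (2 * sdot Z V) / e ^+ 2).

Let e20 : 0 < e ^+ 2. Proof. by rewrite exprn_gt0. Qed.
Let K0 : 0 < K. Proof. by rewrite ltr0n. Qed.
Let K1 : 1 <= K. Proof. by rewrite ler1n. Qed.

Let m0_ge0 s : 0 <= m0 s. Proof. by rewrite /m0 le_max lexx. Qed.
Let m0_le1 Z : m0 (1 - sq Z / e ^+ 2) <= 1.
Proof. by rewrite /m0 ge_max ler01/= gerBl divr_ge0 ?sq_ge0// ltW. Qed.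
Let m0_out Z : e ^+ 2 <= sq Z -> m0 (1 - sq Z / e ^+ 2) = 0.
Proof. by move=> h; apply/max_idPl; rewrite subr_le0 ler_pdivlMr// mul1r. Qed.
Let m0_far (Z : ST) : e <= `|Z| -> m0 (1 - sq Z / e ^+ 2) = 0.
Proof.
move=> h; apply: m0_out; rewrite (le_trans _ (sqr_norm_le_sq _))//.
by rewrite ler_sqr ?nnegrE// ltW.
Qed.

Lemma rho_ge0 Z : 0 <= rho Z. Proof. by rewrite exprn_ge0// m0_ge0. Qed.
Lemma rho_le1 Z : rho Z <= 1. Proof. by rewrite exprn_ile1// ?m0_le1// m0_ge0. Qed.
Lemma norm_rho_le1 Z : `|rho Z| <= 1.
Proof. by rewrite ger0_norm ?rho_ge0// rho_le1. Qed.
Lemma rho_out Z : e ^+ 2 <= sq Z -> rho Z = 0.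
Proof. by move=> h; rewrite /rho m0_out// expr0n. Qed.
Lemma rho_supp Z : rho Z != 0 -> sq Z < e ^+ 2.
Proof. by apply: contra_neqT; rewrite -leNgt; exact: rho_out. Qed.
Lemma drho_out Z V : e ^+ 2 <= sq Z -> drho Z V = 0.
Proof. by move=> h; rewrite /drho m0_out// mulr0 mul0r. Qed.
Lemma drho_supp Z V : drho Z V != 0 -> sq Z < e ^+ 2.
Proof. by apply: contra_neqT; rewrite -leNgt; exact: drho_out. Qed.
Lemma drhoN Z V : drho (- Z) V = - drho Z V.
Proof. by rewrite /drho sqN sdotNl; ring. Qed.
Lemma drhoD Z V W : drho Z (V + W) = drho Z V + drho Z W.
Proof. by rewrite /drho sdotDr; ring. Qed.
Lemma drhoZ Z a V : drho Z (a *: V) = a * drho Z V.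
Proof. by rewrite /drho sdotZr; ring. Qed.

Definition drho_bound : R := 4 * K / e.
Lemma drho_bound_ge0 : 0 <= drho_bound.
Proof. by rewrite divr_ge0 ?mulr_ge0// ltW. Qed.

Lemma drho_le (Z V : ST) : `|drho Z V| <= drho_bound * `|V|.
Proof.
have [Ze|eZ] := leP e `|Z|.
  by rewrite /drho m0_far// mulr0 mul0r normr0 mulr_ge0// drho_bound_ge0.
have hs := le_norm_sdot Z V.
have b : `|m0 (1 - sq Z / e ^+ 2)| <= 1 by rewrite ger0_norm.
have c : `|sdot Z V| <= K * (e * `|V|).
  by apply: (le_trans hs); rewrite ler_wpM2l// ler_wpM2r// ltW.
rewrite /drho /drho_bound !normrM normrN normrM normfV.
rewrite (ger0_norm (ltW e20)) !normr_nat (ger0_norm (m0_ge0 _)).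
have -> : 4 * K / e * `|V| = 2 * 1 * (2 * (K * (e * `|V|)) / e ^+ 2).
  by field; rewrite gt_eqF.
apply: ler_pM.
- by rewrite mulr_ge0// m0_ge0.
- by rewrite divr_ge0 ?(ltW e20)// mulr_ge0.
- by rewrite ler_wpM2l// m0_le1.
- by rewrite ler_wpM2r ?invr_ge0 ?(ltW e20)// ler_wpM2l.
Qed.

Let bump_taylor s u : `|m0 (s + u) ^+ 2 - m0 s ^+ 2 - 2 * m0 s * u| <= u ^+ 2.
Proof.
rewrite /m0 /Num.max; case: ltP => h1; case: ltP => h2;
  rewrite ler_norml; apply/andP; split; nra.
Qed.

Let m0_lip s u : `|m0 (s + u) - m0 s| <= `|u|.
Proof.
rewrite /m0 /Num.max; case: ltP => h1; case: ltP => h2; rewrite ler_norml;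
  have := ler_norm u; have := ler_norm (- u); rewrite normrN; move=> *;
  apply/andP; split; lra.
Qed.

Let u_ (Z H : ST) : R := - (sdot Z H *+ 2 + sq H) / e ^+ 2.
Let arg_shift (Z H : ST) : 1 - sq (Z + H) / e ^+ 2 = 1 - sq Z / e ^+ 2 + u_ Z H.
Proof. by rewrite sqD /u_; field; rewrite gt_eqF. Qed.

Let u_le (Z H : ST) : `|H| <= e -> `|Z| <= 2 * e -> `|u_ Z H| <= 5 * K / e * `|H|.
Proof.
move=> He Z2.
rewrite /u_ normrM normrN normfV (ger0_norm (ltW e20)) ler_pdivrMr//.
have -> : 5 * K / e * `|H| * e ^+ 2 = 5 * K * e * `|H| by field; rewrite gt_eqF.
have h1 := le_norm_sdot Z H; have h2 := sq_le H; have h3 := sq_ge0 H.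
have h4 : K * (`|Z| * `|H|) <= K * (2 * e * `|H|).
  by rewrite ler_wpM2l// ler_wpM2r.
have h5 : K * `|H| ^+ 2 <= K * (e * `|H|).
  by rewrite ler_wpM2l// expr2 ler_wpM2r.
rewrite (le_trans (ler_normD _ _))// normrMn (ger0_norm h3); lra.
Qed.

Let far (Z H : ST) : `|H| <= e -> 2 * e < `|Z| -> e <= `|Z + H|.
Proof.
move=> He Z2; have : `|Z| <= `|Z + H| + `|H|.
  by rewrite -{1}(addrK H Z) ler_normB.
lra.
Qed.

Definition rho_taylor_cst : R := (5 * K / e) ^+ 2 + 2 * K / e ^+ 2.
Lemma rho_taylor_cst_ge0 : 0 <= rho_taylor_cst.
Proof. by rewrite addr_ge0 ?sqr_ge0// divr_ge0 ?mulr_ge0// ltW. Qed.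

(** The argument of the bump is a quadratic polynomial and the squared positive
    part has a 2-Lipschitz derivative.  Far from the support, where the
    polynomial is unbounded, both sides vanish instead. *)
Lemma rho_taylor (Z H : ST) : `|H| <= e ->
  `|rho (Z + H) - rho Z - drho Z H| <= rho_taylor_cst * `|H| ^+ 2.
Proof.
move=> He; have [Z2|Z2] := leP `|Z| (2 * e); last first.
  have Ze : e <= `|Z| by have := e0; lra.
  rewrite /rho /drho (m0_far Ze) (m0_far (far He Z2)) mulr0 mul0r !subrr normr0.
  by rewrite mulr_ge0 ?rho_taylor_cst_ge0.
set s := 1 - sq Z / e ^+ 2; set u := u_ Z H.
have -> : rho (Z + H) - rho Z - drho Z H =
   (m0 (s + u) ^+ 2 - m0 s ^+ 2 - 2 * m0 s * u) - 2 * m0 s * (sq H / e ^+ 2).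
  rewrite /rho /drho arg_shift -/s -/u {3}/u /u_.
  by field; rewrite gt_eqF.
rewrite (le_trans (ler_normB _ _))// [leRHS]mulrDl lerD//.
  apply: (le_trans (bump_taylor _ _)); rewrite -exprMn -(real_normK (num_real u)).
  by rewrite ler_sqr ?nnegrE//; [exact: u_le|rewrite mulr_ge0// divr_ge0 ?mulr_ge0// ltW].
rewrite ger0_norm; last by rewrite !mulr_ge0 ?sq_ge0// invr_ge0 ltW.
have -> : 2 * K / e ^+ 2 * `|H| ^+ 2 = 2 * 1 * (K * `|H| ^+ 2 / e ^+ 2) by ring.
apply: ler_pM.
- by rewrite mulr_ge0// m0_ge0.
- by rewrite divr_ge0 ?sq_ge0// ltW.
- by rewrite ler_wpM2l// /s m0_le1.
- by rewrite ler_wpM2r ?invr_ge0 ?(ltW e20)// sq_le.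
Qed.

Definition drho_lip_cst : R := 60 * K ^+ 2 / e ^+ 2 + 4 * K / e ^+ 2.
Lemma drho_lip_cst_ge0 : 0 <= drho_lip_cst.
Proof. by rewrite addr_ge0// divr_ge0 ?mulr_ge0 ?exprn_ge0// ltW. Qed.

Lemma drho_lip (Z H V : ST) : `|H| <= e ->
  `|drho (Z + H) V - drho Z V| <= drho_lip_cst * `|H| * `|V|.
Proof.
move=> He; have [Z2|Z2] := leP `|Z| (2 * e); last first.
  have Ze : e <= `|Z| by have := e0; lra.
  rewrite /drho (m0_far Ze) (m0_far (far He Z2)) mulr0 !mul0r subrr normr0.
  by rewrite !mulr_ge0 ?drho_lip_cst_ge0.
set s := 1 - sq Z / e ^+ 2; set u := u_ Z H.
have -> : drho (Z + H) V - drho Z V =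
   (m0 (s + u) - m0 s) * (- (4 * sdot (Z + H) V) / e ^+ 2) +
   m0 s * (- (4 * sdot H V) / e ^+ 2).
  by rewrite /drho arg_shift -/s -/u sdotDl; ring.
have -> : drho_lip_cst * `|H| * `|V| =
  (5 * K / e * `|H|) * (4 * (K * (3 * e * `|V|)) / e ^+ 2) +
  1 * (4 * (K * (`|H| * `|V|)) / e ^+ 2).
  by rewrite /drho_lip_cst; field; rewrite gt_eqF.
rewrite (le_trans (ler_normD _ _))// lerD//.
  rewrite normrM ler_pM//.
    by rewrite (le_trans (m0_lip _ _))// u_le.
  rewrite normrM normrN normrM normfV (ger0_norm (ltW e20)).
  rewrite ler_wpM2r ?invr_ge0 ?(ltW e20)// normr_nat ler_wpM2l//.
  rewrite (le_trans (le_norm_sdot _ _))// ler_wpM2l// ler_wpM2r//.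
  by rewrite (le_trans (ler_normD _ _))//; lra.
rewrite normrM ler_pM//.
  by rewrite ger0_norm ?m0_ge0// /s m0_le1.
rewrite normrM normrN normrM normfV (ger0_norm (ltW e20)).
by rewrite ler_wpM2r ?invr_ge0 ?(ltW e20)// normr_nat ler_wpM2l// le_norm_sdot.
Qed.

End kernel.
Arguments drho_bound {R} k e.
Arguments rho_taylor_cst {R} k e.
Arguments drho_lip_cst {R} k e.

(** * Mollification *)

Section convolution.
Context {R : realType} {k : nat}.
Notation ST := ('rV[R]_k * R)%type.
Notation mST := ('rV[R]_k * measurableTypeR R)%type.
Notation mu := (@spacetime_lebesgue R k).
Notation K := (k.+1%:R : R).

Lemma Rintegral_shift (V : ST) (f : ST -> R) : rint mu setT f ->
  Rintegral mu setT (fun X => f (X + V)) = Rintegral mu setT f.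
Proof.
move=> i_f.
have mf : measurable_fun setT (f : mST -> R) by exact: rint_measurable i_f.
have ms : measurable_fun setT ((fun X : ST => X + V) : mST -> mST).
  apply: measurable_fun_pair.
    exact: (measurableT_comp (measurable_rV_shift V.1) measurable_fst).
  by apply: measurable_funD => //; exact: measurable_cst.
have pE A : measurable (A : set mST) -> A `<=` setT ->
    pushforward mu ((fun X : ST => X + V) : mST -> mST) A = mu A.
  by move=> mA _; exact: spacetime_shift.
have i_fs : rint mu setT (fun X : ST => f (X + V)).
  apply/integrableP; split.
    by apply/measurable_EFinP; exact: measurableT_comp.
  have /integrableP[_] := i_f; apply: le_lt_trans.
  rewrite -[leRHS](eq_measure_integral _ pE).
  by rewrite ge0_integral_pushforward//; apply: measurableT_comp => //; exact/measurable_EFinP.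
rewrite /Rintegral; congr fine.
rewrite -[RHS](eq_measure_integral _ pE).
rewrite integral_pushforward//.
exact/measurable_EFinP.
Qed.

Lemma Rintegral_supp d (T : measurableType d) (m : {measure set T -> \bar R})
    (D E : set T) (f : T -> R) :
  (forall x, f x != 0 -> D x <-> E x) -> Rintegral m D f = Rintegral m E f.
Proof.
move=> h; rewrite Rintegral_mkcond [RHS]Rintegral_mkcond.
apply: eq_RintegralS => x _; rewrite /patch.
have [->|/h fx] := eqVneq (f x) 0; first by case: ifP; case: ifP.
by have -> : (x \in D) = (x \in E) by apply/idP/idP; rewrite !inE => /fx.
Qed.

Lemma measurable_dotp d (T : measurableType d) n (f g : T -> 'rV[R]_n) :
  measurable_fun setT f -> measurable_fun setT g ->
  measurable_fun setT (fun x => dotp (f x) (g x)).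
Proof.
move=> mf mg; apply: measurable_sum => i; apply: measurable_funM.
  exact: (measurableT_comp (measurable_coord i) mf).
exact: (measurableT_comp (measurable_coord i) mg).
Qed.

Lemma measurable_diff_sdot (V : ST) :
  measurable_fun setT (fun p : mST * mST => sdot ((p.1 : ST) - p.2) V).
Proof.
apply: measurable_funD.
  apply: measurable_dotp; last exact: measurable_cst.
  apply: measurable_fun_rV => i; under eq_fun do rewrite mxE [X in _ + X]mxE.
  apply: measurable_funB.
    apply: (measurableT_comp (measurable_coord i)).
    exact: (measurableT_comp measurable_fst measurable_fst).
  apply: (measurableT_comp (measurable_coord i)).
  exact: (measurableT_comp measurable_fst measurable_snd).
apply: measurable_funM; last exact: measurable_cst.
apply: measurable_funB.
  exact: (measurableT_comp measurable_snd measurable_fst).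
exact: (measurableT_comp measurable_snd measurable_snd).
Qed.

Lemma measurable_diff_sq :
  measurable_fun setT (fun p : mST * mST => sq ((p.1 : ST) - p.2)).
Proof.
have m1 : measurable_fun setT (fun p : mST * mST => ((p.1 : ST) - p.2).1).
  apply: measurable_fun_rV => i; under eq_fun do rewrite mxE [X in _ + X]mxE.
  apply: measurable_funB.
    apply: (measurableT_comp (measurable_coord i)).
    exact: (measurableT_comp measurable_fst measurable_fst).
  apply: (measurableT_comp (measurable_coord i)).
  exact: (measurableT_comp measurable_fst measurable_snd).
have m2 : measurable_fun setT (fun p : mST * mST => ((p.1 : ST) - p.2).2).
  apply: measurable_funB.
    exact: (measurableT_comp measurable_snd measurable_fst).
  exact: (measurableT_comp measurable_snd measurable_snd).
apply: measurable_funD; last exact: measurable_funM.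
exact: measurable_dotp.
Qed.

Variable e : R.
Hypothesis e0 : 0 < e.
Let e20 : 0 < e ^+ 2. Proof. by rewrite exprn_gt0. Qed.
Let K0 : 0 < K. Proof. by rewrite ltr0n. Qed.

Lemma measurable_diff_rho :
  measurable_fun setT (fun p : mST * mST => rho e ((p.1 : ST) - p.2)).
Proof.
apply: measurable_funX; apply: measurable_maxr; first exact: measurable_cst.
apply: measurable_funB; first exact: measurable_cst.
by apply: measurable_funM; [exact: measurable_diff_sq|exact: measurable_cst].
Qed.

Lemma measurable_diff_drho V :
  measurable_fun setT (fun p : mST * mST => drho e ((p.1 : ST) - p.2) V).
Proof.
apply: measurable_funM.
  apply: measurable_funM; first exact: measurable_cst.
  apply: measurable_maxr; first exact: measurable_cst.
  apply: measurable_funB; first exact: measurable_cst.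
  by apply: measurable_funM; [exact: measurable_diff_sq|exact: measurable_cst].
apply: measurable_funM; last exact: measurable_cst.
apply: measurable_funN; apply: measurable_funM; first exact: measurable_cst.
exact: measurable_diff_sdot.
Qed.

Let measurable_slice (f : ST -> R) (Y : ST) :
  measurable_fun setT (fun p : mST * mST => f ((p.1 : ST) - p.2)) ->
  measurable_fun setT ((fun X : ST => f (Y - X)) : mST -> R).
Proof.
move=> mf.
have mp : measurable_fun setT ((fun X : ST => (Y, X)) : mST -> mST * mST).
  by apply: measurable_fun_pair => //; exact: measurable_cst.
exact: (measurableT_comp mf mp).
Qed.

Lemma measurable_rho_sub (Y : ST) :
  measurable_fun setT ((fun X : ST => rho e (Y - X)) : mST -> R).
Proof. exact: measurable_slice measurable_diff_rho. Qed.
Lemma measurable_drho_sub (Y V : ST) :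
  measurable_fun setT ((fun X : ST => drho e (Y - X) V) : mST -> R).
Proof. exact: (@measurable_slice (fun Z => drho e Z V)) (measurable_diff_drho V). Qed.

Lemma measurable_spacetime_ball0 (Y : ST) (r : R) : measurable (ball Y r : set mST).
Proof. by apply: measurable_spacetime_open; exact: ball_open. Qed.

Lemma spacetime_ball_lty (Y : ST) (r : R) : 0 < r -> (mu (ball Y r : set mST) < +oo)%E.
Proof. by move=> r0; rewrite spacetime_lebesgue_ball// ltry. Qed.

Lemma mem_ball_sub (Y X : ST) (r : R) : ball Y r X <-> `|Y - X| < r.
Proof. by rewrite -ball_normE. Qed.

(** Functions supported near Y are integrable as soon as they are bounded. *)
Lemma rint_ball_supp (D : set ST) (f : ST -> R) (Y : ST) (M : R) :
  measurable (D : set mST) -> measurable_fun (D : set mST) f ->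
  (forall X, `|f X| <= M) ->
  (forall X, f X != 0 -> `|Y - X| < e) -> rint mu D f.
Proof.
move=> mD mf fM fs.
have mB := measurable_spacetime_ball0 Y e.
apply: (@rint_le _ mST R mu _ _ (fun X => M * \1_(ball Y e) X)) => //.
  apply: rintZl => //; apply: (rintS _ mD (@subsetT _ _)) => //.
  by apply: rint_indic => //; exact: spacetime_ball_lty.
move=> X _; rewrite indicE; have [/mem_set ->|h] := pselect (ball Y e X).
  by rewrite mulr1.
rewrite memNset// mulr0.
have [->|/fs] := eqVneq (f X) 0; first by rewrite normr0.
by move/mem_ball_sub.
Qed.

Let rho_near (Y X : ST) : rho e (Y - X) != 0 -> `|Y - X| < e.
Proof. by move=> /rho_supp => /(_ e0); exact: norm_lt_sq. Qed.
Let drho_near (Y X V : ST) : drho e (Y - X) V != 0 -> `|Y - X| < e.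
Proof. by move=> /drho_supp => /(_ e0); exact: norm_lt_sq. Qed.

Lemma rint_rho (D : set ST) (Y : ST) : measurable (D : set mST) ->
  rint mu D (fun X => rho e (Y - X)).
Proof.
move=> mD; apply: (@rint_ball_supp _ _ Y 1) => //.
- by apply: measurable_funTS; exact: measurable_rho_sub.
- by move=> X; exact: norm_rho_le1.
- by move=> X; exact: rho_near.
Qed.

Lemma rint_drho (D : set ST) (Y V : ST) : measurable (D : set mST) ->
  rint mu D (fun X => drho e (Y - X) V).
Proof.
move=> mD; apply: (@rint_ball_supp _ _ Y (drho_bound k e * `|V|)) => //.
- by apply: measurable_funTS; exact: measurable_drho_sub.
- by move=> X; exact: drho_le.
- by move=> X; exact: drho_near.
Qed.

Definition rho_mass : R := Rintegral mu setT (fun X => rho e (0 - X)).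

Lemma rho_massE (Y : ST) : Rintegral mu setT (fun X => rho e (Y - X)) = rho_mass.
Proof.
rewrite /rho_mass -(@Rintegral_shift (- Y) (fun X => rho e (0 - X))); last exact: rint_rho.
by apply: eq_RintegralS => X _; rewrite sub0r opprB.
Qed.

(** Comparison with the cube inscribed in the ball of radius e/2. *)
Lemma rho_mass_ge : 2^-1 * (e / K) ^+ k.+1 <= rho_mass.
Proof.
have r0 : 0 < e / (2 * K) by rewrite divr_gt0// mulr_gt0.
have mB := measurable_spacetime_ball0 0 (e / (2 * K)).
have : Rintegral mu setT (fun X => 2^-1 * \1_(ball (0 : ST) (e / (2 * K))) X) <= rho_mass.
  apply: le_Rintegral => //.
  - apply: rintZl => //.
    by apply: rint_indic => //; exact: spacetime_ball_lty.
  - exact: rint_rho.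
  move=> X _; rewrite indicE.
  have [h|h] := pselect (ball (0 : ST) (e / (2 * K)) X); last first.
    by rewrite memNset// mulr0 rho_ge0.
  rewrite mem_set// mulr1 /rho.
  have q : sq (0 - X) / e ^+ 2 <= 4^-1.
    rewrite ler_pdivrMr//.
    have h' : `|0 - X| <= e / (2 * K) by apply: ltW; apply/mem_ball_sub.
    have h2 : `|0 - X| ^+ 2 <= (e / (2 * K)) ^+ 2 by rewrite ler_sqr ?nnegrE// ltW.
    apply: (le_trans (sq_le _)); apply: (le_trans (ler_wpM2l (ltW K0) h2)).
    have -> : K * (e / (2 * K)) ^+ 2 = 4^-1 * e ^+ 2 / K by field; rewrite gt_eqF.
    by rewrite ler_pdivrMr// ler_peMr ?ler1n// mulr_ge0 ?(ltW e20)// invr_ge0.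
  rewrite /Num.max; case: ltP => h1; nra.
rewrite RintegralZl//; last first.
  by apply: rint_indic => //; exact: spacetime_ball_lty.
have -> : Rintegral mu setT (\1_(ball (0 : ST) (e / (2 * K)))) = (e / K) ^+ k.+1.
  rewrite /Rintegral integral_indic// setIT.
  transitivity (fine (((e / (2 * K)) *+ 2) ^+ k.+1)%:E).
    by congr fine; exact: spacetime_lebesgue_ball.
  by rewrite /=; congr (_ ^+ _); rewrite -mulr_natl; field; rewrite gt_eqF.
by [].
Qed.

Lemma rho_mass_gt0 : 0 < rho_mass.
Proof.
by apply: (lt_le_trans _ rho_mass_ge); rewrite mulr_gt0// exprn_gt0// divr_gt0.
Qed.
Let N0 := rho_mass_gt0.

Section moll.
Variable D : set ST.
Hypothesis mD : measurable (D : set mST).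

Implicit Types (f g : ST -> R) (X Y V W H : ST).

(** The sign convention rho e (Y - X) and the integral restricted to D make moll
    the convolution of the kernel with f extended by zero outside D. *)
Definition moll (f : ST -> R) (Y : ST) : R :=
  rho_mass^-1 * Rintegral mu D (fun X => f X * rho e (Y - X)).
Definition dmoll (f : ST -> R) (V Y : ST) : R :=
  rho_mass^-1 * Rintegral mu D (fun X => f X * drho e (Y - X) V).

Lemma rint_moll f Y : rint mu D f -> rint mu D (fun X => f X * rho e (Y - X)).
Proof.
move=> i_f; apply: (@eq_rint _ mST R mu _ (fun X => rho e (Y - X) * f X)) => //.
  by move=> X _; rewrite mulrC.
apply: (@rintMb _ mST R mu _ _ _ 1) => //.
  by apply: measurable_funTS; exact: measurable_rho_sub.
by move=> X _; exact: norm_rho_le1.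
Qed.

Lemma rint_dmoll f V Y : rint mu D f -> rint mu D (fun X => f X * drho e (Y - X) V).
Proof.
move=> i_f; apply: (@eq_rint _ mST R mu _ (fun X => drho e (Y - X) V * f X)) => //.
  by move=> X _; rewrite mulrC.
apply: (@rintMb _ mST R mu _ _ _ (drho_bound k e * `|V|)) => //.
  by apply: measurable_funTS; exact: measurable_drho_sub.
by move=> X _; exact: drho_le.
Qed.

Definition moll_cst (f : ST -> R) : R := rho_mass^-1 * Rintegral mu D (fun X : ST => `|f X|).
Lemma moll_cst_ge0 f : 0 <= moll_cst f.
Proof. by rewrite mulr_ge0 ?invr_ge0 ?(ltW N0)// Rintegral_ge0. Qed.

(* every bound below integrates a pointwise bound on the kernel *)
Let moll_le (f g : ST -> R) (c : R) : rint mu D f ->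
  measurable_fun (D : set mST) g -> (forall X, `|g X| <= c) ->
  `|rho_mass^-1 * Rintegral mu D (fun X => f X * g X)| <= c * moll_cst f.
Proof.
move=> i_f mg gc; rewrite normrM (ger0_norm (_ : 0 <= rho_mass^-1)) ?invr_ge0 ?(ltW N0)//.
rewrite /moll_cst mulrCA ler_wpM2l ?invr_ge0 ?(ltW N0)//.
rewrite -RintegralZl//; last exact: rint_norm.
apply: norm_Rintegral_le => //.
- by apply: measurable_funM => //; exact: rint_measurable i_f.
- by apply: rintZl => //; exact: rint_norm.
- by move=> X _; rewrite normrM mulrC ler_wpM2r.
Qed.

Lemma moll_bound f Y : rint mu D f -> `|moll f Y| <= moll_cst f.
Proof.
move=> i_f; rewrite -[leRHS]mul1r; apply: moll_le => //.
- by apply: measurable_funTS; exact: measurable_rho_sub.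
- by move=> X; exact: norm_rho_le1.
Qed.

Lemma dmoll_bound f V Y : rint mu D f ->
  `|dmoll f V Y| <= drho_bound k e * `|V| * moll_cst f.
Proof.
move=> i_f; apply: moll_le => //.
- by apply: measurable_funTS; exact: measurable_drho_sub.
- by move=> X; exact: drho_le.
Qed.

(** The estimate is inherited from the kernel, f being merely integrable. *)
Lemma moll_taylor f (Y H : ST) : rint mu D f -> `|H| <= e ->
  `|moll f (Y + H) - moll f Y - dmoll f H Y| <=
    rho_taylor_cst k e * `|H| ^+ 2 * moll_cst f.
Proof.
move=> i_f He.
have -> : moll f (Y + H) - moll f Y - dmoll f H Y = rho_mass^-1 *
   Rintegral mu D (fun X => f X * (rho e (Y + H - X) - rho e (Y - X) - drho e (Y - X) H)).
  rewrite /moll /dmoll -!mulrBr; congr (_ * _).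
  rewrite -RintegralB//; [|exact: rint_moll|exact: rint_moll].
  rewrite -RintegralB//; [|exact: (rintB mD (rint_moll _ i_f) (rint_moll _ i_f))|exact: rint_dmoll].
  by apply: eq_RintegralS => X _; rewrite !mulrBr.
apply: moll_le => //.
- apply: measurable_funTS; apply: measurable_funB; last exact: measurable_drho_sub.
  by apply: measurable_funB; exact: measurable_rho_sub.
- by move=> X; rewrite [Y + H - X]addrAC; exact: rho_taylor.
Qed.

Lemma dmoll_lip f (Y H V : ST) : rint mu D f -> `|H| <= e ->
  `|dmoll f V (Y + H) - dmoll f V Y| <= drho_lip_cst k e * `|H| * `|V| * moll_cst f.
Proof.
move=> i_f He.
have -> : dmoll f V (Y + H) - dmoll f V Y = rho_mass^-1 *
   Rintegral mu D (fun X => f X * (drho e (Y + H - X) V - drho e (Y - X) V)).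
  rewrite /dmoll -!mulrBr; congr (_ * _).
  rewrite -RintegralB//; [|exact: rint_dmoll|exact: rint_dmoll].
  by apply: eq_RintegralS => X _; rewrite !mulrBr.
apply: moll_le => //.
- by apply: measurable_funTS; apply: measurable_funB; exact: measurable_drho_sub.
- by move=> X; rewrite [Y + H - X]addrAC; exact: drho_lip.
Qed.

Lemma dmollD f V W Y : rint mu D f -> dmoll f (V + W) Y = dmoll f V Y + dmoll f W Y.
Proof.
move=> i_f; rewrite /dmoll.
rewrite (@eq_RintegralS _ mST R mu _ _
  (fun X : ST => f X * drho e (Y - X) V + f X * drho e (Y - X) W)); last first.
  by move=> X _; rewrite drhoD mulrDr.
rewrite RintegralD; [by rewrite mulrDr|exact: mD|exact: rint_dmoll|exact: rint_dmoll].
Qed.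

Lemma dmollZ f a V Y : rint mu D f -> dmoll f (a *: V) Y = a * dmoll f V Y.
Proof.
move=> i_f; rewrite /dmoll.
rewrite (@eq_RintegralS _ mST R mu _ _ (fun X : ST => a * (f X * drho e (Y - X) V))).
  by rewrite RintegralZl; [rewrite mulrCA|exact: mD|exact: rint_dmoll].
by move=> X _; rewrite drhoZ mulrCA.
Qed.

Lemma moll_lip f (Y H : ST) : rint mu D f -> `|H| <= e ->
  `|moll f (Y + H) - moll f Y| <=
    (rho_taylor_cst k e * e + drho_bound k e) * moll_cst f * `|H|.
Proof.
move=> i_f He; have h1 := moll_taylor Y i_f He; have h2 := dmoll_bound H Y i_f.
rewrite -(subrK (dmoll f H Y) (_ - _)) (le_trans (ler_normD _ _))//.
apply: (le_trans (lerD h1 h2)).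
have -> : (rho_taylor_cst k e * e + drho_bound k e) * moll_cst f * `|H| =
  rho_taylor_cst k e * (e * `|H|) * moll_cst f + drho_bound k e * `|H| * moll_cst f by ring.
rewrite lerD2r ler_wpM2r ?moll_cst_ge0// ler_wpM2l ?rho_taylor_cst_ge0//.
by rewrite expr2 ler_wpM2r.
Qed.

Lemma continuous_of_lip (g : ST -> R) (L : R) :
  (forall Y H : ST, `|H| <= e -> `|g (Y + H) - g Y| <= L * `|H|) -> continuous g.
Proof.
move=> hg Y; apply/cvgrPdist_le => eps eps0.
have L0 : 0 < `|L| + 1 by rewrite ltr_pwDr.
near=> Z.
have h1 : `|Z - Y| <= e.
  rewrite distrC; near: Z; apply: cvgr_dist_le => //; exact: cvg_id.
have h2 : `|Z - Y| <= eps / (`|L| + 1).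
  rewrite distrC; near: Z; apply: cvgr_dist_le; [exact: cvg_id|by rewrite divr_gt0].
rewrite distrC -{1}(subrK Y Z) [_ - Y + Y]addrC (le_trans (hg _ _ h1))//.
apply: (@le_trans _ _ ((`|L| + 1) * (eps / (`|L| + 1)))).
  apply: (@le_trans _ _ ((`|L| + 1) * `|Z - Y|)).
    by rewrite ler_wpM2r// (le_trans (ler_norm L))// lerDl.
  by rewrite ler_wpM2l// ltW.
by rewrite mulrCA divff ?mulr1// gt_eqF.
Unshelve. all: by end_near. Qed.

Lemma moll_continuous f : rint mu D f -> continuous (moll f).
Proof. by move=> i_f; apply: continuous_of_lip => Y H; exact: moll_lip. Qed.

Lemma dmoll_continuous f V : rint mu D f -> continuous (dmoll f V).
Proof.
move=> i_f; apply: (@continuous_of_lip _ (drho_lip_cst k e * `|V| * moll_cst f)) => Y H He.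
by rewrite (le_trans (dmoll_lip Y V i_f He))// le_eqVlt; apply/orP; left; apply/eqP; ring.
Qed.

Lemma moll_supp f Y : moll f Y != 0 -> exists2 X, f X != 0 & `|Y - X| < e.
Proof.
move=> h; apply: contrapT => nh; move/eqP: h; apply.
rewrite /moll (_ : Rintegral _ _ _ = 0) ?mulr0//.
rewrite (@eq_RintegralS _ mST R mu _ _ (fun=> 0)); first by rewrite Rintegral_cst// mul0r.
move=> X _; have [->|fX] := eqVneq (f X) 0; first by rewrite mul0r.
have [->|/rho_near rX] := eqVneq (rho e (Y - X)) 0; first by rewrite mulr0.
by exfalso; apply: nh; exists X.
Qed.

Lemma dmoll_supp f V Y : dmoll f V Y != 0 -> exists2 X, f X != 0 & `|Y - X| < e.
Proof.
move=> h; apply: contrapT => nh; move/eqP: h; apply.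
rewrite /dmoll (_ : Rintegral _ _ _ = 0) ?mulr0//.
rewrite (@eq_RintegralS _ mST R mu _ _ (fun=> 0)); first by rewrite Rintegral_cst// mul0r.
move=> X _; have [->|fX] := eqVneq (f X) 0; first by rewrite mul0r.
have [->|/drho_near rX] := eqVneq (drho e (Y - X) V) 0; first by rewrite mulr0.
by exfalso; apply: nh; exists X.
Qed.

Lemma rho_mass_deep (Y : ST) : (forall X, `|Y - X| < e -> D X) ->
  Rintegral mu D (fun X => rho e (Y - X)) = rho_mass.
Proof.
move=> h; rewrite -(rho_massE Y); apply: Rintegral_supp => X /rho_near hX.
by split => // _; exact: h.
Qed.

(** The mollified constant 1 is locally constant, so its derivative vanishes. *)
Lemma drho_deep (Y V : ST) : (forall X, `|Y - X| < e -> D X) ->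
  Rintegral mu D (fun X => drho e (Y - X) V) = 0.
Proof.
move=> h.
have -> : Rintegral mu D (fun X => drho e (Y - X) V) =
          Rintegral mu setT (fun X => drho e (Y - X) V).
  apply: Rintegral_supp => X /drho_near hX; split => // _; exact: h.
set I := Rintegral _ _ _.
have I1 : I = Rintegral mu setT (fun X => drho e (0 - X) V).
  rewrite -(@Rintegral_shift (- Y) (fun X => drho e (0 - X) V)); last exact: rint_drho.
  by apply: eq_RintegralS => X _; rewrite sub0r opprB.
pose B := ball (0 : ST) (3 * e).
have mB : measurable (B : set mST) by exact: measurable_spacetime_ball0.
have Boo : (mu (B : set mST) < +oo)%E by apply: spacetime_ball_lty; rewrite mulr_gt0.
have key (H : ST) : `|H| <= e ->
   `|Rintegral mu setT (fun X => drho e (0 - X) H)| <=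
   rho_taylor_cst k e * `|H| ^+ 2 * fine (mu (B : set mST)).
  move=> He.
  have eB : Rintegral mu setT (fun X => drho e (0 - X) H) =
            Rintegral mu B (fun X => drho e (0 - X) H).
    apply: Rintegral_supp => X /drho_near hX; split => // _; apply/mem_ball_sub.
    by rewrite (lt_le_trans hX)//; have := e0; lra.
  have rB (Z : ST) : `|Z| <= e -> Rintegral mu B (fun X => rho e (Z - X)) = rho_mass.
    move=> Ze; rewrite -(rho_massE Z); apply: Rintegral_supp => X /rho_near hX.
    split => // _; apply/mem_ball_sub; rewrite sub0r normrN.
    have : `|X| <= `|Z - X| + `|Z| by rewrite addrC (le_trans _ (ler_normB Z (Z - X)))// subKr.
    by have := e0; lra.
  have z : Rintegral mu B (fun X => drho e (0 - X) H) =
      - Rintegral mu B (fun X => rho e (H - X) - rho e (0 - X) - drho e (0 - X) H).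
    rewrite RintegralB//; [|exact: (rintB mB (rint_rho _ mB) (rint_rho _ mB))|exact: rint_drho].
    rewrite RintegralB//; [|exact: rint_rho|exact: rint_rho].
    by rewrite !rB ?normr0 ?(ltW e0)//; ring.
  rewrite eB z normrN -Rintegral_cst//.
  apply: norm_Rintegral_le => //.
  - apply: measurable_funTS; apply: measurable_funB; last exact: measurable_drho_sub.
    by apply: measurable_funB; exact: measurable_rho_sub.
  - by apply: (@rint_bounded _ mST R mu _ _ `|rho_taylor_cst k e * `|H| ^+ 2|) => //; exact: measurable_cst.
  - move=> X _; have := @rho_taylor _ _ _ e0 (0 - X) H He.
    by rewrite [0 - X + H]addrC addrA addr0.
apply/eqP; rewrite I1 -normr_eq0 eq_le normr_ge0 andbT; apply/ler_addgt0Pl => d d0; rewrite addr0.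
set c := rho_taylor_cst k e * fine (mu (B : set mST)).
have c0 : 0 <= c by rewrite mulr_ge0 ?rho_taylor_cst_ge0// fine_ge0.
have V0 : 0 < `|V| + 1 by rewrite ltr_pwDr.
pose s := Num.min (e / (`|V| + 1)) (d / (c * (`|V| + 1) ^+ 2 + 1)).
have q0 : 0 < c * (`|V| + 1) ^+ 2 + 1 by rewrite ltr_wpDl// mulr_ge0// exprn_ge0// ltW.
have s0 : 0 < s by rewrite /s lt_min !divr_gt0.
have s1 : s * (`|V| + 1) <= e by rewrite -ler_pdivlMr// /s ge_min lexx.
have s2 : s * (c * (`|V| + 1) ^+ 2 + 1) <= d by rewrite -ler_pdivlMr// /s ge_min lexx orbT.
have nsV : `|s *: V| = s * `|V| by rewrite normrZ (gtr0_norm s0).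
have := key (s *: V) _; rewrite nsV => /(_ _)/wrap[].
  by rewrite (le_trans _ s1)// ler_wpM2l ?(ltW s0)// lerDl.
have -> : Rintegral mu setT (fun X => drho e (0 - X) (s *: V)) =
    s * Rintegral mu setT (fun X => drho e (0 - X) V).
  rewrite -RintegralZl//; last exact: rint_drho.
  by apply: eq_RintegralS => X _; rewrite drhoZ.
rewrite normrM (gtr0_norm s0) => h1.
rewrite -(ler_pM2l s0) (le_trans h1)//.
have h2 : `|V| ^+ 2 <= (`|V| + 1) ^+ 2 by rewrite ler_sqr ?nnegrE ?lerDl// ltW.
have -> : rho_taylor_cst k e * (s * `|V|) ^+ 2 * fine (mu (B : set mST)) = s * (s * (c * `|V| ^+ 2)).
  by rewrite /c; ring.
rewrite ler_wpM2l ?(ltW s0)// (le_trans _ s2)// ler_wpM2l ?(ltW s0)//.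
by rewrite (@le_trans _ _ (c * (`|V| + 1) ^+ 2))// ?ler_wpM2l// lerDl.
Qed.

End moll.
End convolution.
Arguments rho_mass {R} k e.

Section moll_unfold.
Context {R : realType} {k : nat} (e : R) (D : set ('rV[R]_k * R)).
Implicit Types (f : 'rV[R]_k * R -> R) (V Y : 'rV[R]_k * R).

Lemma mollE f Y : moll e D f Y = (rho_mass k e)^-1 *
  Rintegral (@spacetime_lebesgue R k) D (fun X => f X * rho e (Y - X)).
Proof. by []. Qed.

Lemma dmollE f V Y : dmoll e D f V Y = (rho_mass k e)^-1 *
  Rintegral (@spacetime_lebesgue R k) D (fun X => f X * drho e (Y - X) V).
Proof. by []. Qed.

Lemma drho_boundE : drho_bound k e = 4 * k.+1%:R / e.
Proof. by []. Qed.

End moll_unfold.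

(* Conversion would otherwise unfold these integrals over and over. *)
#[global] Opaque rho drho rho_mass moll dmoll moll_cst drho_bound
  rho_taylor_cst drho_lip_cst.

(** * Mollified test functions and integration by parts *)

Section differentiability.
Context {R : realType}.

(** A quadratic remainder yields differentiability without any choice of a
    little-o. *)
Lemma differentiable_quad (V W : normedModType R) (f : V -> W) (x : V)
    (L : {linear V -> W}) (c r : R) : 0 < r -> continuous L ->
  (forall h, `|h| <= r -> `|f (x + h) - f x - L h| <= c * `|h| ^+ 2) ->
  differentiable f x /\ forall v, 'D_v f x = L v.
Proof.
move=> r0 cL hf.
have e : f \o shift x = cst (f x) + L +o_ 0 id.
  apply/eqaddoP => _/posnumP[eps]; near=> h.
  rewrite !fctE /= opprD addrA [h + x]addrC.
  have hr : `|h| <= r.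
    by near: h; apply: nbhs0_le.
  have hc : `|h| <= eps%:num / (`|c| + 1).
    by near: h; apply: nbhs0_le; rewrite divr_gt0// ltr_pwDr.
  apply: (le_trans (hf h hr)); rewrite expr2 mulrA ler_wpM2r//.
  apply: (@le_trans _ _ ((`|c| + 1) * `|h|)).
    by rewrite ler_wpM2r// (le_trans (ler_norm c))// lerDl.
  by rewrite mulrC -ler_pdivlMr// ltr_pwDr.
have dL : 'd f x = L :> (V -> W) by exact: diff_unique.
have df : differentiable f x by apply/diff_locallyP; rewrite dL.
by split => // v; rewrite deriveE// dL.
Unshelve. all: by end_near. Qed.

End differentiability.

Section moll_C1.
Context {R : realType} {k : nat}.
Notation ST := ('rV[R]_k * R)%type.
Notation mST := ('rV[R]_k * measurableTypeR R)%type.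
Notation mu := (@spacetime_lebesgue R k).
Variable e : R.
Hypothesis e0 : 0 < e.
Variable D : set ST.
Hypothesis mD : measurable (D : set mST).

Section derivative.
Variables (n : nat) (f : 'I_n -> ST -> R).
Hypothesis i_f : forall i, rint mu D (f i).

Definition vmoll (X : ST) : 'rV[R]_n := \row_(i < n) moll e D (f i) X.
Definition vdmoll (X V : ST) : 'rV[R]_n := \row_(i < n) dmoll e D (f i) V X.

Let vdmoll_linear X : linear (vdmoll X).
Proof.
move=> a V W; apply/rowP => i; rewrite !mxE dmollD ?dmollZ//.
Qed.

HB.instance Definition _ X :=
  GRing.isLinear.Build R ST 'rV[R]_n _ (vdmoll X) (vdmoll_linear X).

Let rowsum_le (v : 'rV[R]_n) (c : 'I_n -> R) :
  (forall i, 0 <= c i) -> (forall i, `|v 0 i| <= c i) -> `|v| <= \sum_i c i.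
Proof.
move=> c0 h; apply/rV_norm_leP; first by apply: sumr_ge0.
move=> i; rewrite (le_trans (h i))// (bigD1 i)//= lerDl.
by apply: sumr_ge0.
Qed.

Let continuous_row (g : ST -> 'rV[R]_n) : (forall i, continuous (fun x => g x 0 i)) ->
  continuous g.
Proof.
move=> h x; apply/cvgrPdist_le => eps eps0; near=> y.
apply/rV_norm_leP; first exact: ltW.
have : forall i, `|(g x - g y) 0 i| <= eps; last by [].
near: y; apply: filter_forall => i.
have /cvgrPdist_le/(_ _ eps0) := h i x.
by apply: filterS => y; rewrite !mxE.
Unshelve. all: by end_near. Qed.

Lemma vmoll_differentiable X :
  differentiable vmoll X /\ forall V, 'D_V vmoll X = vdmoll X V.
Proof.
pose c := \sum_i rho_taylor_cst k e * moll_cst e D (f i).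
apply: (@differentiable_quad R ST 'rV[R]_n vmoll X (vdmoll X) c e) => //.
  apply: bounded_linear_continuous; apply/linear_boundedP.
  exists (\sum_i drho_bound k e * moll_cst e D (f i)); split; first exact: num_real.
  move=> r Mr V.
  apply: (@le_trans _ _ ((\sum_i drho_bound k e * moll_cst e D (f i)) * `|V|)); last first.
    by rewrite ler_wpM2r// ltW.
  rewrite mulr_suml; apply: rowsum_le => i.
    by apply: mulr_ge0 => //; apply: mulr_ge0; [exact: drho_bound_ge0|exact: moll_cst_ge0].
  by rewrite mxE mulrAC dmoll_bound.
move=> H He; rewrite /c mulr_suml; apply: rowsum_le => i.
  apply: mulr_ge0; last exact: exprn_ge0.
  by apply: mulr_ge0; [exact: rho_taylor_cst_ge0|exact: moll_cst_ge0].
by rewrite !mxE mulrAC moll_taylor.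
Qed.

Lemma vmoll_derive_continuous V : continuous (fun X => 'D_V vmoll X).
Proof.
have -> : (fun X => 'D_V vmoll X) = (fun X => vdmoll X V).
  by apply/funext => X; have [_ ->] := vmoll_differentiable X.
apply: continuous_row => i; under eq_fun do rewrite mxE.
exact: dmoll_continuous.
Qed.

(** This is what makes mollified functions admissible in the weak formulation. *)
Lemma vmoll_C1c (Dom P Kc : set ST) : compact Kc -> Kc `<=` Dom -> P `<=` Kc ->
  (forall i X Y, f i Y != 0 -> `|X - Y| < e -> P X) -> C1c Dom vmoll.
Proof.
move=> cK KD PK fP.
have sub : [set X | vmoll X != 0] `<=` Kc.
  move=> X /= vX; apply: PK.
  have [i] : exists i, moll e D (f i) X != 0.
    apply: contrapT => h; move/eqP: vX; apply; apply/rowP => i; rewrite !mxE.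
    by apply/eqP/negPn/negP => ?; apply: h; exists i.
  by move=> /(moll_supp e0 mD)[Y fY XY]; exact: fP fY XY.
have cl : closed Kc.
  apply: compact_closed => //; exact: norm_hausdorff.
have sub' : closure [set X | vmoll X != 0] `<=` Kc.
  by move/closure_id: cl => ->; exact: closureS.
split.
- by move=> X; have [] := vmoll_differentiable X.
- exact: vmoll_derive_continuous.
- by apply: subclosed_compact cK sub'; exact: closed_closure.
- by move=> X /sub' /KD.
Qed.

End derivative.
End moll_C1.

Section integration_by_parts.
Context {R : realType} {k : nat}.
Notation ST := ('rV[R]_k * R)%type.
Notation mST := ('rV[R]_k * measurableTypeR R)%type.
Notation mu := (@spacetime_lebesgue R k).

(** The derivative of a compactly supported function integrates to zero:
    difference quotients do, by translation invariance, and they converge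
    boundedly.  Only their convergence along one sequence almost everywhere is
    used, which suits functions that are merely Lipschitz. *)
Lemma Rintegral_derivative_eq0 (D : set ST) (V : ST) (h dh : ST -> R) (t : nat -> R) (M : R) :
  measurable (D : set mST) -> (mu (D : set mST) < +oo)%E ->
  rint mu setT h -> measurable_fun setT (dh : mST -> R) ->
  {ae mu, forall X, (fun m => t m * (h (X + (t m)^-1 *: V) - h X)) @ \oo --> dh X} ->
  (forall m X, `|t m * (h (X + (t m)^-1 *: V) - h X)| <= M * \1_D X) ->
  Rintegral mu setT dh = 0.
Proof.
move=> mD Doo ih mdh hdh hM.
have mh : measurable_fun setT (h : mST -> R) by exact: rint_measurable ih.
have ms (W : ST) : measurable_fun setT ((fun X : ST => X + W) : mST -> mST).
  apply: measurable_fun_pair.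
    exact: (measurableT_comp (measurable_rV_shift W.1) measurable_fst).
  by apply: measurable_funD => //; exact: measurable_cst.
have mhs (W : ST) : measurable_fun setT ((fun X : ST => h (X + W)) : mST -> R).
  exact: (measurableT_comp mh (ms W)).
pose F m X := t m * (h (X + (t m)^-1 *: V) - h X).
have mF m : measurable_fun setT (F m : mST -> R).
  apply: measurable_funM; first exact: measurable_cst.
  by apply: measurable_funB; [exact: mhs|exact: mh].
have iD : rint mu setT (fun X => M * \1_D X) by apply: rintZl => //; exact: rint_indic.
have c : (fun m => Rintegral mu setT (F m)) @ \oo --> Rintegral mu setT dh.
  apply: (Rintegral_dominated_cvg measurableT mF mdh _ iD) => //.
  - by apply: ae_imp hdh => X /= hX _.
  - by move=> m X _; exact: hM.
have F0 m : Rintegral mu setT (F m) = 0.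
  have [t0|t0] := eqVneq (t m) 0.
    rewrite (@eq_RintegralS _ mST R mu _ _ (fun=> 0)); first by rewrite Rintegral_cst// mul0r.
    by move=> X _; rewrite /F t0 mul0r.
  have iF : rint mu setT (F m).
    by apply: (@rint_le _ mST R mu _ _ (fun X => M * \1_D X)) => // X _; exact: hM.
  have ihs : rint mu setT (fun X => h (X + (t m)^-1 *: V)).
    apply: (@eq_rint _ mST R mu _ (fun X => (t m)^-1 * F m X + h X)) => //.
      by move=> X _; rewrite /F mulKf// subrK.
    by apply: rintD => //; exact: rintZl.
  rewrite /F RintegralZl//; last exact: (rintB measurableT ihs ih).
  rewrite RintegralB//.
  have := Rintegral_shift ((t m)^-1 *: V) ih.
  by move=> ->; rewrite subrr mulr0.
apply: (cvg_unique _ c) => //.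
rewrite (_ : (fun m => _) = cst 0); first exact: cvg_cst.
by apply/funext => m; exact: F0.
Qed.

End integration_by_parts.

(** * Differentiability relative to a convex set *)

Lemma cvg_sumr {R : realType} (I : Type) (r : seq I) (f : I -> nat -> R) (l : I -> R) :
  (forall i, f i @ \oo --> l i) ->
  (fun m => \sum_(i <- r) f i m) @ \oo --> \sum_(i <- r) l i.
Proof.
move=> h; apply: cvg_big => [|i _]; last exact: h.
exact: add_continuous.
Qed.

Section calculus.
Context {R : realType} {n : nat}.
Notation V := 'rV[R]_n.

Lemma enorm_le (u : V) : enorm u <= n.+1%:R * `|u|.
Proof.
rewrite /enorm -(ger0_norm (_ : 0 <= n.+1%:R * `|u|)) ?mulr_ge0//.
rewrite -sqrtr_sqr ler_wsqrtr// (le_trans (ler_norm _))//.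
rewrite (le_trans (le_norm_dotp _ _))// exprMn -expr2 ler_wpM2r ?exprn_ge0//.
by rewrite -natrX ler_nat (leq_trans (leqnSn n))// leq_pmulr.
Qed.

Lemma norm_le_enorm (u : V) : `|u| <= enorm u.
Proof.
rewrite /enorm -(ger0_norm (normr_ge0 u)) -sqrtr_sqr ler_wsqrtr//.
exact: sqr_norm_le_dotp.
Qed.

Lemma enorm_ge0 (u : V) : 0 <= enorm u. Proof. exact: sqrtr_ge0. Qed.

(** Gradients are defined with the Euclidean norm; the estimates of this file use
    the sup norm, which is equivalent. *)
Lemma is_gradient_sup (D : set V) (g : V -> R) (x v : V) (eps : R) :
  is_gradient D g x v -> 0 < eps ->
  exists2 d : R, 0 < d & forall y, D y -> `|y - x| < d ->
    `|g y - g x - dotp (y - x) v| <= eps * `|y - x|.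
Proof.
move=> hg eps0.
have h0 : 0 < eps / n.+1%:R by rewrite divr_gt0.
have /nbhs_ballP[d /= d0 hd] := hg _ h0.
exists d => // y Dy yx.
have := hd y; rewrite -ball_normE /= distrC => /(_ yx Dy) h.
apply: (le_trans h); rewrite -mulrA ler_wpM2l ?(ltW eps0)//.
by rewrite ler_pdivrMl// enorm_le.
Qed.

Lemma is_gradient_sub (D E : set V) (g : V -> R) (x v : V) :
  D `<=` E -> is_gradient E g x v -> is_gradient D g x v.
Proof.
move=> DE hg eps /hg; apply: filterS => y h /DE; exact: h.
Qed.

Lemma segment_mem (O : set V) (x y : V) (s : R) : convex_set O -> O x -> O y ->
  0 <= s -> s <= 1 -> O (x + s *: (y - x)).
Proof.
move=> /convex_setP cO Ox Oy s0 s1.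
have h : 0 < (1 - s) + s by rewrite subrK.
have h1 : 0 <= 1 - s by rewrite subr_ge0.
have := cO x y (1 - s) s h1 s0 h Ox Oy.
rewrite subrK invr1 scale1r; congr O.
by rewrite scalerBr scalerBl scale1r addrAC -addrA.
Qed.

(** Mean value theorem along a segment for a function that is differentiable
    relative to a convex set. *)
Lemma convex_mvt (O : set V) (g : V -> R) (dg : V -> V) (x y : V) :
  convex_set O -> (forall z, O z -> is_gradient O g z (dg z)) -> O x -> O y ->
  exists z, [/\ O z, `|z - x| <= `|y - x| & g y - g x = dotp (y - x) (dg z)].
Proof.
move=> cO hg Ox Oy.
pose p (s : R) := x + s *: (y - x); pose f (s : R) : R := g (p s).
have Op (s : R) : 0 <= s -> s <= 1 -> O (p s) by move=> ? ?; exact: segment_mem.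
have pB s t : p s - p t = (s - t) *: (y - x).
  by rewrite /p opprD addrACA subrr add0r scalerBl.
have N0 : 0 < `|y - x| + 1 by rewrite ltr_pwDr.
(* relative differentiability at a point of the segment, in the parameter *)
have key (t eps : R) : 0 <= t -> t <= 1 -> 0 < eps -> exists2 d : R, 0 < d &
    forall s : R, 0 <= s -> s <= 1 -> `|s - t| < d ->
    `|f s - f t - (s - t) * dotp (y - x) (dg (p t))| <= eps * `|s - t|.
  move=> t0 t1 eps0.
  have e1 : 0 < eps / (`|y - x| + 1) by rewrite divr_gt0.
  have [d d0 hd] := is_gradient_sup (hg _ (Op t t0 t1)) e1.
  exists (d / (`|y - x| + 1)); first by rewrite divr_gt0.
  move=> s s0 s1 st; have := hd (p s) (Op s s0 s1).
  rewrite pB dotpZl normrZ => /(_ _)/wrap[].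
    rewrite (@le_lt_trans _ _ (`|s - t| * (`|y - x| + 1)))//.
      by rewrite ler_wpM2l// lerDl.
    by rewrite -ltr_pdivlMr.
  move=> h; apply: (le_trans h); rewrite [`|s - t| * _]mulrC mulrA ler_wpM2r//.
  by rewrite -mulrA ler_piMr ?(ltW eps0)// mulrC ler_pdivrMr// mul1r lerDl.
pose df t := dotp (y - x) (dg (p t)).
have f_deriv (t : R) : t \in `]0, 1[%R -> is_derive t 1 f (df t).
  rewrite in_itv /= => /andP[t0 t1].
  have c : (fun h : R => h^-1 *: ((f (h *: (1 : R^o) + t) - f t) : R^o)) @ 0^' --> (df t : R^o).
    apply/cvgrPdist_le => eps eps0.
    have [d d0 hd] := key t eps (ltW t0) (ltW t1) eps0.
    near=> h.
    have h0 : h != 0 by near: h; exact: nbhs_dnbhs_neq.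
    have hd' : `|h| < d by near: h; apply: dnbhs0_lt.
    have ht : `|h| < t by near: h; apply: dnbhs0_lt.
    have ht1 : `|h| < 1 - t by near: h; apply: dnbhs0_lt; rewrite subr_gt0.
    have a1 : 0 <= h + t by move: ht; rewrite ltr_norml => /andP[]; lra.
    have a2 : h + t <= 1 by move: ht1; rewrite ltr_norml => /andP[_]; lra.
    have := hd (h + t) a1 a2; rewrite addrK => /(_ hd').
    rewrite [h *: (1 : R^o)]mulr1 distrC => hh.
    rewrite -(ler_pM2l (_ : 0 < `|h|)) ?normr_gt0// [leRHS]mulrC.
    apply: le_trans hh; rewrite -normrM mulrBr.
    by rewrite [h * (_ *: _)]mulrA divff// mul1r.
  split; first by apply/cvg_ex; exists (df t).
  by apply: cvg_lim.
have f_cont : {within `[0, 1], continuous f}.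
  apply/subspace_continuousP => t /=; rewrite in_itv /= => /andP[t0 t1].
  apply/cvgrPdist_le => eps eps0.
  have [d d0 hd] := key t 1 t0 t1 ltr01.
  have M0 : 0 < `|df t| + 1 by rewrite ltr_pwDr.
  rewrite near_withinE; near=> s => /=; rewrite in_itv /= => /andP[s0 s1].
  have h1 : `|s - t| < d.
    by rewrite distrC; near: s; apply: cvgr_dist_lt => //; exact: cvg_id.
  have h2 : `|s - t| <= eps / (`|df t| + 1).
    by rewrite distrC; near: s; apply: cvgr_dist_le; [exact: cvg_id|rewrite divr_gt0].
  have := hd s s0 s1 h1; rewrite mul1r -/(df t) => h3.
  suff : `|f s - f t| <= eps by rewrite distrC.
  have -> : f s - f t = (f s - f t - (s - t) * df t) + (s - t) * df t by ring.
  rewrite (le_trans (ler_normD _ _))//.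
  rewrite normrM (@le_trans _ _ (`|s - t| * (`|df t| + 1)))//; last by rewrite -ler_pdivlMr.
  by lra.
have [c] := MVT ltr01 f_deriv f_cont.
rewrite in_itv /= subr0 mulr1 => /andP[c0 c1] e.
exists (p c); split; first by apply: Op; exact: ltW.
  by rewrite /p addrC addKr normrZ ler_piMl// ger0_norm ltW.
by move: e; rewrite /f /p scale0r addr0 scale1r [x + (y - x)]addrC subrK.
Unshelve. all: by end_near. Qed.

Lemma dotp_le_coord (u v : V) (M : R) : (forall l, `|v 0 l| <= M) ->
  `|dotp u v| <= n%:R * M * `|u|.
Proof.
move=> h; rewrite /dotp (le_trans (ler_norm_sum _ _ _))//.
apply: (@le_trans _ _ (\sum_(i < n) M * `|u|)).
  apply: ler_sum => i _; rewrite normrM mulrC ler_pM//; first exact: le_rV_norm.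
by rewrite sumr_const card_ord -mulrA mulr_natl.
Qed.

Lemma convex_lip (O : set V) (g : V -> R) (dg : V -> V) (M : R) :
  convex_set O -> (forall z, O z -> is_gradient O g z (dg z)) ->
  (forall z l, O z -> `|dg z 0 l| <= M) ->
  forall x y, O x -> O y -> `|g y - g x| <= n%:R * M * `|y - x|.
Proof.
move=> cO hg hM x y Ox Oy; have [z [Oz _ ->]] := convex_mvt cO hg Ox Oy.
by apply: dotp_le_coord => l; exact: hM.
Qed.

Lemma convex_taylor (O : set V) (g : V -> R) (dg : V -> V) (M : R) :
  convex_set O -> 0 <= M -> (forall z, O z -> is_gradient O g z (dg z)) ->
  (forall x y l, O x -> O y -> `|dg y 0 l - dg x 0 l| <= M * `|y - x|) ->
  forall x y, O x -> O y ->
    `|g y - g x - dotp (y - x) (dg x)| <= n%:R * M * `|y - x| ^+ 2.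
Proof.
move=> cO M0 hg hM x y Ox Oy; have [z [Oz zx ->]] := convex_mvt cO hg Ox Oy.
rewrite -dotpNr -dotpDr.
have : `|dotp (y - x) (dg z - dg x)| <= n%:R * (M * `|y - x|) * `|y - x|.
  apply: dotp_le_coord => l; rewrite !mxE (le_trans (hM _ _ _ Ox Oz))//.
  by rewrite ler_wpM2l.
by rewrite -!mulrA -expr2.
Qed.

(** Chain rule along a sequence approaching a point of O from within O. *)
Lemma gradient_chain_seq (O : set V) (g : V -> R) (w v d : V) (u : nat -> V)
    (t : nat -> R) (L : R) :
  is_gradient O g w v -> (forall m, 0 < t m) -> t @ \oo --> +oo ->
  (\forall m \near \oo, O (u m)) -> (forall m, `|u m - w| <= L / t m) ->
  (forall l, (fun m => t m * (u m 0 l - w 0 l)) @ \oo --> d 0 l) ->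
  (fun m => t m * (g (u m) - g w)) @ \oo --> dotp d v.
Proof.
move=> hg t0 too Ou uw ud.
have L0 : 0 <= L.
  have := le_trans (normr_ge0 _) (uw 0%N).
  by rewrite ler_pdivlMr// mul0r.
have lin : (fun m => t m * dotp (u m - w) v) @ \oo --> dotp d v.
  rewrite (_ : (fun m => _) = (fun m => \sum_(l < n) (t m * (u m 0 l - w 0 l)) * v 0 l)); last first.
    by apply/funext => m; rewrite /dotp mulr_sumr; apply: eq_bigr => l _; rewrite !mxE mulrA.
  rewrite /dotp; apply: cvg_sumr => l.
  by apply: cvgM; [exact: ud|exact: cvg_cst].
have rem : (fun m => t m * (g (u m) - g w - dotp (u m - w) v)) @ \oo --> (0 : R).
  apply/cvgrPdist_le => eps eps0.
  have e1 : 0 < eps / (L + 1) by rewrite divr_gt0// ltr_wpDl.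
  have [r r0 hr] := is_gradient_sup hg e1.
  near=> m; rewrite sub0r normrN normrM gtr0_norm//.
  have tm : L / r < t m.
    near: m; move/cvgryPgt: too; apply.
  have h1 : `|u m - w| < r.
    by rewrite (le_lt_trans (uw m))// ltr_pdivrMr// -ltr_pdivrMl// mulrC.
  have Oum : O (u m) by near: m.
  rewrite (le_trans (ler_wpM2l (ltW (t0 m)) (hr _ Oum h1)))//.
  rewrite mulrCA (@le_trans _ _ (eps / (L + 1) * L))//.
    by rewrite ler_wpM2l ?(ltW e1)// mulrC -ler_pdivlMr.
  by rewrite mulrAC ler_pdivrMr ?ltr_wpDl// ler_wpM2l ?(ltW eps0)// lerDl.
rewrite -[X in _ --> X]add0r (_ : (fun m => t m * (g (u m) - g w)) =
  (fun m => t m * (g (u m) - g w - dotp (u m - w) v)) \+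
  (fun m => t m * dotp (u m - w) v)); first exact: cvgD.
by apply/funext => m /=; rewrite -mulrDr subrK.
Unshelve. all: by end_near. Qed.

End calculus.

(** * Averages of powers, relative continuity *)

Section averages.
Context d (T : measurableType d) (R : realType) (mu : {measure set T -> \bar R}).
Variables (E : set T) (x : T -> R) (N : R).
Hypotheses (mE : measurable E) (Eoo : (mu E < +oo)%E) (mx : measurable_fun E x)
  (x0 : forall t, 0 <= x t) (i_x3 : rint mu E (fun t => x t ^+ 3)) (N0 : 0 < N).

Lemma rint_cst (r : R) : rint mu E (fun=> r).
Proof. by apply: (@rint_bounded _ T R mu _ _ `|r|) => //; exact: measurable_cst. Qed.

Lemma rint_pow (p : nat) : (p <= 3)%N -> rint mu E (fun t => x t ^+ p).
Proof.
move=> p3; apply: (@rint_le _ T R mu _ _ (fun t => 1 + x t ^+ 3)) => //.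
- exact: measurable_funX.
- by apply: rintD => //; exact: rint_cst.
- move=> t _; rewrite ger0_norm ?exprn_ge0//.
  have [x1|x1] := leP (x t) 1.
    by rewrite ler_wpDr ?exprn_ge0// exprn_ile1.
  by rewrite ler_wpDl// ler_eXn2l// ltW.
Qed.

Definition mean_pow (p : nat) : R := N^-1 * Rintegral mu E (fun t => x t ^+ p).
Notation a := (mean_pow 1).
Notation b := (mean_pow 2).
Notation c := (mean_pow 3).
Notation kappa := (N^-1 * fine (mu E)).

Lemma mean_pow_ge0 p : 0 <= mean_pow p.
Proof.
by rewrite mulr_ge0 ?invr_ge0 ?(ltW N0)// Rintegral_ge0// => t _; rewrite exprn_ge0.
Qed.

Let kappa_ge0 : 0 <= kappa.
Proof. by rewrite mulr_ge0 ?invr_ge0 ?(ltW N0)// fine_ge0. Qed.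

(* integrates an inequality between polynomials in x t of degree at most 3 *)
Let mean_ineq (s1 s2 u0 u2 u3 : R) :
  (forall t, s1 * x t ^+ 1 + s2 * x t ^+ 2 <= u0 + u2 * x t ^+ 2 + u3 * x t ^+ 3) ->
  s1 * a + s2 * b <= u0 * kappa + u2 * b + u3 * c.
Proof.
move=> h.
have i1 := rint_pow (isT : (1 <= 3)%N); have i2 := rint_pow (isT : (2 <= 3)%N).
have e1 : s1 * a + s2 * b =
    N^-1 * Rintegral mu E (fun t => s1 * x t ^+ 1 + s2 * x t ^+ 2).
  by rewrite RintegralD ?RintegralZl//; [rewrite /mean_pow; ring|exact: rintZl|exact: rintZl].
have e2 : u0 * kappa + u2 * b + u3 * c =
    N^-1 * Rintegral mu E (fun t => u0 + u2 * x t ^+ 2 + u3 * x t ^+ 3).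
  rewrite RintegralD//; [|by apply: rintD; [|exact: rint_cst|exact: rintZl]|exact: rintZl].
  rewrite RintegralD//; [|exact: rint_cst|exact: rintZl].
  by rewrite !RintegralZl// Rintegral_cst// /mean_pow; ring.
rewrite e1 e2 ler_wpM2l ?invr_ge0 ?(ltW N0)//; apply: le_Rintegral => //.
- by apply: rintD => //; exact: rintZl.
- by apply: rintD => //; [apply: rintD => //; [exact: rint_cst|exact: rintZl]|exact: rintZl].
Qed.

(** Cauchy-Schwarz against the constant 1, by optimising over s below. *)
Lemma mean_sqr : a ^+ 2 <= kappa * b.
Proof.
have a0 := mean_pow_ge0 1; have b0 := mean_pow_ge0 2.
have h (s : R) : 0 <= s -> 2 * s * a <= s ^+ 2 * kappa + b.
  move=> s0; have := @mean_ineq (2 * s) 0 (s ^+ 2) 1 0.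
  rewrite !mul0r !mul1r !addr0; apply => t.
  have := sqr_ge0 (s - x t); rewrite expr1; nra.
have [k0|k0] := eqVneq kappa 0.
  rewrite k0 mul0r.
  have [->|an0] := eqVneq a 0; first by rewrite expr0n.
  have a_gt0 : 0 < a by rewrite lt_def an0.
  have := h ((b + 1) / a) (divr_ge0 (addr_ge0 b0 ler01) a0).
  have -> : 2 * ((b + 1) / a) * a = 2 * (b + 1).
    by rewrite -mulrA divfK.
  by rewrite k0 mulr0 add0r; lra.
have k_gt0 : 0 < kappa by rewrite lt_def k0.
have := h (a / kappa) (divr_ge0 a0 kappa_ge0).
move: (a) (kappa) (b) k_gt0 => aa kk bb k_gt0; rewrite -(ler_pM2r k_gt0).
have -> : 2 * (aa / kk) * aa * kk = 2 * aa ^+ 2 by field; rewrite gt_eqF.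
have -> : ((aa / kk) ^+ 2 * kk + bb) * kk = aa ^+ 2 + kk * bb by field; rewrite gt_eqF.
lra.
Qed.

(** This and the next bound split the values of x at the threshold l y: below it
    y pays, above it the third moment does. *)
Lemma mean_young1 (y l : R) : 0 <= y -> 0 < l ->
  y * b <= l ^+ 2 * y ^+ 3 * kappa + c / l.
Proof.
move=> y0 l0; have := @mean_ineq 0 y (l ^+ 2 * y ^+ 3) 0 l^-1.
rewrite !mul0r add0r addr0 [l^-1 * _]mulrC; apply => t.
rewrite !mul0r add0r addr0; have := x0 t; move: (x t) => z z0.
have [h|h] := leP z (l * y).
  rewrite ler_wpDr ?mulr_ge0 ?invr_ge0 ?exprn_ge0 ?(ltW l0)//.
  have : z ^+ 2 <= (l * y) ^+ 2 by rewrite ler_sqr ?nnegrE ?mulr_ge0 ?(ltW l0).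
  nra.
rewrite ler_wpDl ?mulr_ge0 ?exprn_ge0 ?(ltW l0)// [leRHS]mulrC ler_pdivlMr//.
have -> : y * z ^+ 2 * l = (l * y) * z ^+ 2 by ring.
by rewrite [z ^+ 3]exprS ler_wpM2r ?exprn_ge0// ltW.
Qed.

Lemma mean_young2 (y l : R) : 0 <= y -> 0 < l ->
  y ^+ 2 * a <= l * y ^+ 3 * kappa + c / l ^+ 2.
Proof.
move=> y0 l0; have := @mean_ineq (y ^+ 2) 0 (l * y ^+ 3) 0 (l ^+ 2)^-1.
rewrite !mul0r !addr0 [(l ^+ 2)^-1 * c]mulrC; apply => t.
rewrite !mul0r !addr0; have := x0 t; move: (x t) => z z0.
have l20 : 0 < l ^+ 2 by rewrite exprn_gt0.
rewrite expr1; have [h|h] := leP z (l * y).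
  rewrite ler_wpDr//; first by rewrite mulr_ge0 ?exprn_ge0// invr_ge0 ltW.
  have -> : l * y ^+ 3 = y ^+ 2 * (l * y) by ring.
  by rewrite ler_wpM2l ?exprn_ge0.
rewrite ler_wpDl ?mulr_ge0 ?exprn_ge0 ?(ltW l0)// [leRHS]mulrC ler_pdivlMr//.
have : (l * y) ^+ 2 <= z ^+ 2 by rewrite ler_sqr ?nnegrE ?mulr_ge0 ?(ltW l0)// ltW.
move=> h2; have -> : y ^+ 2 * z * l ^+ 2 = (l * y) ^+ 2 * z by ring.
by rewrite [z ^+ 3]exprSr ler_wpM2r.
Qed.

Lemma mean_mul : a * b <= 2 * kappa * c.
Proof.
have a0 := mean_pow_ge0 1; have b0 := mean_pow_ge0 2.
have c0 := mean_pow_ge0 3.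
have h (z : R) : 0 <= z -> z * b <= z ^+ 3 * kappa + c.
  by move=> z0; have := mean_young1 z0 ltr01; rewrite expr1n mul1r divr1.
have i1 := rint_pow (isT : (1 <= 3)%N).
have e1 : a * b = N^-1 * Rintegral mu E (fun t => b * x t ^+ 1).
  by rewrite RintegralZl// /mean_pow; ring.
have e2 : 2 * kappa * c =
    N^-1 * Rintegral mu E (fun t => kappa * x t ^+ 3 + c).
  rewrite RintegralD//; [|exact: rintZl|exact: rint_cst].
  by rewrite RintegralZl// Rintegral_cst// /mean_pow; ring.
rewrite e1 e2 ler_wpM2l ?invr_ge0 ?(ltW N0)//; apply: le_Rintegral => //.
- exact: rintZl.
- by apply: rintD => //; [exact: rintZl|exact: rint_cst].
- by move=> t _; rewrite expr1 mulrC [kappa * _]mulrC; exact: h.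
Qed.

End averages.

Section measurable_comp.
Context {R : realType}.

Definition rel_continuous n (O : set 'rV[R]_n) (f : 'rV[R]_n -> R) :=
  forall x, O x -> forall eps : R, 0 < eps -> exists2 r : R, 0 < r &
    forall y, O y -> `|y - x| < r -> `|f y - f x| < eps.

(** Composition with a function that is only continuous relative to a possibly
    non-measurable set O containing the values of U. *)
Lemma measurable_comp_rel d (T : measurableType d) n (O : set 'rV[R]_n)
    (f : 'rV[R]_n -> R) (D : set T) (U : T -> 'rV[R]_n) :
  rel_continuous O f -> measurable D -> measurable_fun D U ->
  (forall t, D t -> O (U t)) -> measurable_fun D (fun t => f (U t)).
Proof.
move=> cf mD mU UO.
apply: (measurability _ (RGenOpens.measurableE R)) => _ [_ [a [b ->] <-]].
pose A := [set y : 'rV[R]_n | exists x r, [/\ 0 < r, `|y - x| < r &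
   forall z, O z -> `|z - x| < r -> f z \in `]a, b[%R]].
have oA : open A.
  rewrite openE => y [x [r [r0 yx h]]].
  apply/nbhs_ballP; exists (r - `|y - x|); first by rewrite /= subr_gt0.
  move=> z; rewrite -ball_normE /= => yz; exists x, r; split => //.
  rewrite (le_lt_trans (ler_distD y _ _))// [`|z - y|]distrC; lra.
have -> : D `&` (fun t => f (U t)) @^-1` `]a, b[ = D `&` U @^-1` A.
  apply/seteqP; split => t [Dt] /= h; split => //; last first.
    have [x [r [r0 yx h']]] := h; exact: h' (UO _ Dt) yx.
  move: h; rewrite in_itv /= => /andP[h1 h2].
  pose e := Num.min (f (U t) - a) (b - f (U t)).
  have e0 : 0 < e by rewrite lt_min !subr_gt0 h1.
  have [r r0 hr] := cf _ (UO _ Dt) _ e0.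
  exists (U t), r; split => //; first by rewrite subrr normr0.
  move=> z Oz /(hr _ Oz); rewrite /e lt_min => /andP[k1 k2].
  rewrite in_itv /=; move: k1 k2; rewrite !ltr_norml => /andP[k1 _] /andP[_ k2].
  by apply/andP; split; lra.
by apply: mU => //; exact: measurable_rV_open.
Qed.

Lemma measurable_norm_comp d (T : measurableType d) n (D : set T) (U : T -> 'rV[R]_n) :
  measurable D -> measurable_fun D U -> measurable_fun D (fun t => `|U t|).
Proof.
move=> mD mU; apply: (@measurable_comp_rel _ _ _ setT (fun v => `|v|)) => //.
move=> x _ eps eps0; exists eps => // y _ h.
by rewrite (le_lt_trans (ler_dist_dist _ _)).
Qed.

Lemma measurable_fun_rVD d (T : measurableType d) n (D : set T) (f : T -> 'rV[R]_n) :
  measurable D -> (forall i, measurable_fun D (fun t => f t 0 i)) ->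
  measurable_fun D f.
Proof.
move=> mD mf.
have : measurable_fun setT (f \_ D).
  apply: measurable_fun_rV => i.
  have mfi : measurable_fun (setT `&` D) (fun t => f t 0 i) by rewrite setTI.
  have h := (measurable_restrict _ mD measurableT).1 mfi.
  apply: eq_measurable_fun h.
  by move=> t _; rewrite /patch; case: ifP => //; rewrite mxE.
move=> h; have := (measurable_restrict f mD measurableT).2 h.
by rewrite setTI.
Qed.

End measurable_comp.

(** * The adjoint of mollified differentiation *)

Section fubini_kernel.
Context {R : realType}.

Lemma EFin_Rintegral d (T : measurableType d) (m : {measure set T -> \bar R})
    (D : set T) (f : T -> R) : measurable D -> rint m D f ->
  (\int[m]_(x in D) (f x)%:E)%E = (Rintegral m D f)%:E.
Proof. by move=> mD i_f; rewrite /Rintegral fineK//; exact: integrable_fin_num. Qed.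

Lemma rint_patch d (T : measurableType d) (m : {measure set T -> \bar R})
    (D : set T) (f : T -> R) : measurable D -> rint m D f -> rint m setT (f \_ D).
Proof.
move=> mD i_f; have := (integrable_mkcond (EFin \o f) mD).1 i_f.
by apply: eq_integrable => // x _; rewrite /= restrict_EFin.
Qed.

Lemma measurable_patch d (T : measurableType d) (D : set T) (f : T -> R) :
  measurable D -> measurable_fun D f -> measurable_fun setT (f \_ D).
Proof.
by move=> mD mf; apply/(measurable_restrict f mD measurableT); rewrite setTI.
Qed.

(** Fubini for a product of integrable functions coupled by a bounded kernel. *)
Lemma Rintegral_swap d1 d2 (T1 : measurableType d1) (T2 : measurableType d2)
    (m1 : {sigma_finite_measure set T1 -> \bar R})
    (m2 : {sigma_finite_measure set T2 -> \bar R})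
    (g : T1 -> R) (f : T2 -> R) (kap : T1 * T2 -> R) (M : R) :
  rint m1 setT g -> rint m2 setT f -> measurable_fun setT kap ->
  (forall p, `|kap p| <= M) ->
  Rintegral m1 setT (fun x => g x * Rintegral m2 setT (fun y => f y * kap (x, y))) =
  Rintegral m2 setT (fun y => f y * Rintegral m1 setT (fun x => g x * kap (x, y))).
Proof.
move=> ig i_f mk kM.
have mf := rint_measurable i_f; have mg := rint_measurable ig.
pose F (p : T1 * T2) : R := g p.1 * f p.2 * kap p.
have mF : measurable_fun setT F.
  apply: measurable_funM => //; apply: measurable_funM.
    exact: (measurableT_comp mg measurable_fst).
  exact: (measurableT_comp mf measurable_snd).
have mEF : measurable_fun setT (EFin \o F) by exact/measurable_EFinP.
pose A := Rintegral m2 setT (fun y => M * `|f y|).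
have iA : rint m2 setT (fun y => M * `|f y|) by apply: rintZl => //; exact: rint_norm.
have iF : (m1 \x m2)%E.-integrable setT (EFin \o F).
  apply/(integrable12ltyP _ _ mEF).
  have h : rint m1 setT (fun x => A * `|g x|) by apply: rintZl => //; exact: rint_norm.
  apply: (@le_lt_trans _ _ (\int[m1]_x (A * `|g x|)%:E)%E); last first.
    by rewrite (EFin_Rintegral measurableT h) ltry.
  apply: ge0_le_integral => //.
  - by move=> x _; exact: integral_ge0.
  - apply: (measurable_fun_fubini_tonelli_F (abse \o (EFin \o F))) => //=.
    exact: measurableT_comp.
  - by apply/measurable_EFinP; exact: rint_measurable h.
  move=> x _.
  have h1 : rint m2 setT (fun y => `|g x| * (M * `|f y|)) by exact: rintZl.
  rewrite [A * _]mulrC /A -RintegralZl// -EFin_Rintegral//.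
  apply: ge0_le_integral => //.
  - apply: measurableT_comp => //; exact: (measurableT_comp mEF (measurable_pair1 _)).
  - by apply/measurable_EFinP; exact: rint_measurable h1.
  move=> y _; rewrite lee_fin /F /= normrM normrM -mulrA ler_wpM2l// mulrC ler_wpM2r//.
have := Fubini iF.
have E1 x : (\int[m2]_y ((EFin \o F) (x, y)) =
    (g x * Rintegral m2 setT (fun y => f y * kap (x, y)))%:E)%E.
  have i1 : rint m2 setT (fun y => f y * kap (x, y)).
    apply: (@eq_rint _ T2 R m2 _ (fun y => kap (x, y) * f y)) => //.
      by move=> y _; rewrite mulrC.
    apply: (@rintMb _ T2 R m2 _ _ _ M) => //.
    exact: (measurableT_comp mk (measurable_pair1 _)).
  rewrite -RintegralZl// -EFin_Rintegral//; last exact: rintZl.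
  by apply: eq_integral => y _; rewrite /= /F mulrA.
have E2 y : (\int[m1]_x ((EFin \o F) (x, y)) =
    (f y * Rintegral m1 setT (fun x => g x * kap (x, y)))%:E)%E.
  have i1 : rint m1 setT (fun x => g x * kap (x, y)).
    apply: (@eq_rint _ T1 R m1 _ (fun x => kap (x, y) * g x)) => //.
      by move=> x _; rewrite mulrC.
    apply: (@rintMb _ T1 R m1 _ _ _ M) => //.
    exact: (measurableT_comp mk (measurable_pair2 _)).
  rewrite -RintegralZl// -EFin_Rintegral//; last exact: rintZl.
  by apply: eq_integral => x _; rewrite /= /F mulrA [f y * _]mulrC.
rewrite (eq_integral _ _ (fun x _ => E1 x)) (eq_integral _ _ (fun y _ => E2 y)).
by move=> /(congr1 fine).
Qed.

End fubini_kernel.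

Section adjoint.
Context {R : realType} {k : nat}.
Notation ST := ('rV[R]_k * R)%type.
Notation mST := ('rV[R]_k * measurableTypeR R)%type.
Notation mu := (@spacetime_lebesgue R k).
Variable e : R.
Hypothesis e0 : 0 < e.

(** Up to sign, mollified differentiation is its own adjoint. *)
Lemma dmoll_adjoint (D P : set ST) (f g : ST -> R) (V : ST) :
  measurable (D : set mST) -> measurable (P : set mST) ->
  rint mu P f -> rint mu D g ->
  Rintegral mu D (fun X => dmoll e P f V X * g X) =
  - Rintegral mu P (fun Y => f Y * dmoll e D g V Y).
Proof.
move=> mD mP i_f i_g.
pose N := rho_mass k e.
have if1 : rint mu setT (f \_ P) by exact: rint_patch.
have ig1 : rint mu setT (g \_ D) by exact: rint_patch.
have i1 : rint mu D (fun X => dmoll e P f V X * g X).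
  apply: (@rintMb _ mST R mu _ _ _ (drho_bound k e * `|V| * moll_cst e P f)) => //.
    by apply: measurable_funTS; apply: continuous_measurable_spacetime;
      [exact: openT|move=> X _; exact: dmoll_continuous].
  by move=> X _; exact: dmoll_bound.
have i2 : rint mu P (fun Y => f Y * dmoll e D g V Y).
  apply: (@eq_rint _ mST R mu _ (fun Y => dmoll e D g V Y * f Y)) => //.
    by move=> Y _; rewrite mulrC.
  apply: (@rintMb _ mST R mu _ _ _ (drho_bound k e * `|V| * moll_cst e D g)) => //.
    by apply: measurable_funTS; apply: continuous_measurable_spacetime;
      [exact: openT|move=> X _; exact: dmoll_continuous].
  by move=> Y _; exact: dmoll_bound.
have N0 : N != 0 by rewrite gt_eqF// rho_mass_gt0.
apply: (mulfI N0); rewrite mulrN -mulNr -(RintegralZl N mD i1) -(RintegralZl (- N) mP i2).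
rewrite Rintegral_mkcond [RHS]Rintegral_mkcond.
transitivity (Rintegral mu setT (fun X => (g \_ D) X *
     Rintegral mu setT (fun Y => (f \_ P) Y * drho e ((X : ST) - Y) V))).
  apply: eq_RintegralS => X _; rewrite /patch; case: ifP => _; last by rewrite mul0r.
  rewrite dmollE mulrA mulrA (divff N0) mul1r mulrC; congr (_ * _).
  rewrite Rintegral_mkcond; apply: eq_RintegralS => Y _; rewrite /patch.
  by case: ifP; rewrite ?mul0r.
rewrite (@Rintegral_swap R _ _ mST mST mu mu _ _
    (fun p => drho e ((p.1 : ST) - p.2) V) (drho_bound k e * `|V|) ig1 if1
    (measurable_diff_drho e V) (fun p => drho_le e0 _ _)).
apply: eq_RintegralS => Y _; rewrite /patch; case: ifP => _; last by rewrite mul0r.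
rewrite dmollE mulNr mulrCA [N * _]mulrA (divff N0) mul1r -mulrN; congr (_ * _).
rewrite -mulN1r -(RintegralZl (-1) mD (rint_dmoll e0 mD V Y i_g)) [RHS]Rintegral_mkcond.
apply: eq_RintegralS => X _; rewrite /patch.
case: ifP => _; last by rewrite mul0r.
by rewrite -(opprB (Y : ST) X) drhoN mulN1r mulrN.
Qed.

End adjoint.

(** * Entropy systems, derivatives along sequences *)

Section entropy_system.
Context {R : realType}.

(** The bounds on the nonlinearities that the commutator estimate uses, with
    one constant C. The index None of option 'I_k stands for time, with flux A
    and entropy eta. *)
Record entropy_system (k n : nat) (O : set 'rV[R]_n)
    (G : option 'I_k -> 'I_n -> 'rV[R]_n -> R)
    (DG : option 'I_k -> 'I_n -> 'rV[R]_n -> 'rV[R]_n)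
    (Q : option 'I_k -> 'rV[R]_n -> R)
    (B : 'I_n -> 'rV[R]_n -> R) (DB : 'I_n -> 'rV[R]_n -> 'rV[R]_n)
    (C : R) : Prop := {
  es_ge0 : 0 <= C;
  es_growB : forall i V, O V -> `|B i V| <= C * (1 + `|V|);
  es_lipB : forall i V W, O V -> O W -> `|B i V - B i W| <= C * `|V - W|;
  es_boundDB : forall i V l, O V -> `|DB i V 0 l| <= C;
  es_contDB : forall i l, rel_continuous O (fun V => DB i V 0 l);
  es_gradB : forall i V, O V -> is_gradient O (B i) V (DB i V);
  es_growG : forall a i V, O V -> `|G a i V| <= C * (1 + `|V|) ^+ 2;
  es_lipG : forall a i V W, O V -> O W ->
    `|G a i V - G a i W| <= C * (1 + `|V| + `|W|) ^+ 1 * `|V - W|;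
  es_taylorG : forall a i V W, O V -> O W ->
    `|G a i V - G a i W - dotp (V - W) (DG a i W)| <= C * `|V - W| ^+ 2;
  es_gradG : forall a i V, O V -> is_gradient O (G a i) V (DG a i V);
  es_growQ : forall a V, O V -> `|Q a V| <= C * (1 + `|V|) ^+ 3;
  es_lipQ : forall a V W, O V -> O W ->
    `|Q a V - Q a W| <= C * (1 + `|V| + `|W|) ^+ 2 * `|V - W|;
  es_gradQ : forall a V, O V ->
    is_gradient O (Q a) V (\sum_(i < n) B i V *: DG a i V) }.

Lemma rel_continuous_lip n (O : set 'rV[R]_n) (f : 'rV[R]_n -> R) (C : R) (p : nat) :
  0 <= C -> (forall V W, O V -> O W ->
    `|f V - f W| <= C * (1 + `|V| + `|W|) ^+ p * `|V - W|) -> rel_continuous O f.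
Proof.
move=> C0 hf x Ox eps eps0.
pose L := C * (2 + `|x| *+ 2) ^+ p + 1.
have L0 : 0 < L by rewrite ltr_wpDl// mulr_ge0// exprn_ge0// addr_ge0// mulrn_wge0.
exists (Num.min 1 (eps / L)); first by rewrite lt_min ltr01 divr_gt0.
move=> y Oy; rewrite lt_min => /andP[y1 y2].
apply: (le_lt_trans (hf _ _ Oy Ox)).
apply: (@le_lt_trans _ _ (L * `|y - x|)); last by rewrite mulrC -ltr_pdivlMr.
rewrite ler_wpM2r// /L ler_wpDr// ler_wpM2l// lerXn2r ?nnegrE ?addr_ge0 ?mulrn_wge0//.
have : `|y| <= `|y - x| + `|x| by rewrite -{1}(subrK x y) ler_normD.
by rewrite mulr2n; lra.
Qed.

End entropy_system.

Lemma eq_cvg_seq {R : realType} (u w : nat -> R) (l : R) : (forall m, u m = w m) ->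
  u @ \oo --> l -> w @ \oo --> l.
Proof. by move=> /funext ->. Qed.

Section sequence_derivative.
Context {R : realType} {k : nat}.
Notation ST := ('rV[R]_k * R)%type.
Variables (t : nat -> R) (v X : ST).
Hypotheses (t0 : forall m, 0 < t m) (too : t @ \oo --> +oo).

(** Derivative along the sequence of steps 1 / t m. *)
Definition seq_deriv (f : ST -> R) (d : R) :=
  (fun m => t m * (f (X + (t m)^-1 *: v) - f X)) @ \oo --> d.

Lemma inv_t_cvg0 : (fun m => (t m)^-1) @ \oo --> (0 : R).
Proof.
apply/cvgrPdist_le => e e0; near=> m.
rewrite sub0r normrN ger0_norm ?invr_ge0 ?(ltW (t0 m))//.
rewrite -[e]invrK lef_pV2 ?posrE ?invr_gt0//.
by apply: ltW; near: m; move/cvgryPgt: too; apply.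
Unshelve. all: by end_near. Qed.

Lemma seq_deriv_cvg f d : seq_deriv f d -> (fun m => f (X + (t m)^-1 *: v)) @ \oo --> f X.
Proof.
move=> hf; rewrite -[f X in X in _ --> X]add0r -(mul0r d).
apply: (@eq_cvg_seq _ (fun m => (t m)^-1 * (t m * (f (X + (t m)^-1 *: v) - f X)) + f X)).
  by move=> m; rewrite mulKf ?gt_eqF// subrK.
by apply: cvgD; [apply: cvgM => //; exact: inv_t_cvg0|exact: cvg_cst].
Qed.

Lemma seq_derivD f g d d' : seq_deriv f d -> seq_deriv g d' ->
  seq_deriv (fun Y => f Y + g Y) (d + d').
Proof.
move=> hf hg; rewrite /seq_deriv; set Z := fun m : nat => X + (t m)^-1 *: v.
apply: (@eq_cvg_seq _ (fun m => t m * (f (Z m) - f X) + t m * (g (Z m) - g X))).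
  by move=> m; ring.
exact: cvgD.
Qed.

Lemma seq_derivM f g d d' : seq_deriv f d -> seq_deriv g d' ->
  seq_deriv (fun Y => f Y * g Y) (d * g X + f X * d').
Proof.
move=> hf hg; rewrite /seq_deriv; set Z := fun m : nat => X + (t m)^-1 *: v.
apply: (@eq_cvg_seq _ (fun m => (t m * (f (Z m) - f X)) * g (Z m) +
   f X * (t m * (g (Z m) - g X)))).
  by move=> m; rewrite -/(Z m); ring.
by apply: cvgD; apply: cvgM => //; [exact: seq_deriv_cvg hg|exact: cvg_cst].
Qed.

Lemma seq_derivN f d : seq_deriv f d -> seq_deriv (fun Y => - f Y) (- d).
Proof.
move=> hf; rewrite /seq_deriv; set Z := fun m : nat => X + (t m)^-1 *: v.
apply: (@eq_cvg_seq _ (fun m => - (t m * (f (Z m) - f X)))).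
  by move=> m; rewrite -/(Z m); ring.
exact: cvgN.
Qed.

Lemma seq_deriv_sum (I : finType) (f : I -> ST -> R) (d : I -> R) :
  (forall i, seq_deriv (f i) (d i)) ->
  seq_deriv (fun Y => \sum_i f i Y) (\sum_i d i).
Proof.
move=> hf; rewrite /seq_deriv; set Z := fun m : nat => X + (t m)^-1 *: v.
apply: (@eq_cvg_seq _ (fun m => \sum_i t m * (f i (Z m) - f i X))).
  by move=> m; rewrite -sumrB mulr_sumr.
by apply: cvg_sumr => i; exact: hf.
Qed.

Lemma seq_deriv_moll e (e0 : 0 < e) (D : set ST)
    (mD : measurable (D : set ('rV[R]_k * measurableTypeR R))) (f : ST -> R) :
  rint (@spacetime_lebesgue R k) D f -> seq_deriv (moll e D f) (dmoll e D f v X).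
Proof.
move=> i_f; set c := rho_taylor_cst k e * `|v| ^+ 2 * moll_cst e D f.
have c0 : 0 <= c.
  apply: mulr_ge0; last exact: moll_cst_ge0.
  by apply: mulr_ge0; [exact: rho_taylor_cst_ge0|exact: exprn_ge0].
have v0 : 0 < `|v| + 1 by rewrite ltr_pwDr.
apply/cvgrPdist_le => eps eps0; near=> m.
have tm := t0 m.
have h1 : (`|v| + 1) / e < t m by near: m; move/cvgryPgt: too; apply.
have h2 : (c + 1) / eps < t m by near: m; move/cvgryPgt: too; apply.
have nH : `|(t m)^-1 *: v| = (t m)^-1 * `|v|.
  by rewrite normrZ ger0_norm// invr_ge0 ltW.
have He : `|(t m)^-1 *: v| <= e.
  rewrite nH mulrC ler_pdivrMr//; move: h1; rewrite ltr_pdivrMr// mulrC.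
  by move=> h; apply: ltW; apply: le_lt_trans h; rewrite lerDl.
have := moll_taylor e0 mD X i_f He.
rewrite dmollZ// nH exprMn => h3.
rewrite distrC.
have -> : t m * (moll e D f (X + (t m)^-1 *: v) - moll e D f X) - dmoll e D f v X =
  t m * (moll e D f (X + (t m)^-1 *: v) - moll e D f X - (t m)^-1 * dmoll e D f v X).
  by rewrite [RHS]mulrBr mulVKf// gt_eqF.
rewrite normrM (gtr0_norm tm); apply: (le_trans (ler_wpM2l (ltW tm) h3)).
have -> : t m * (rho_taylor_cst k e * ((t m)^-1 ^+ 2 * `|v| ^+ 2) * moll_cst e D f) = c / t m.
  by rewrite /c; field; rewrite gt_eqF.
rewrite ler_pdivrMr// mulrC; move: h2; rewrite ltr_pdivrMr// => h2.
by apply: ltW; apply: le_lt_trans h2; rewrite lerDl.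
Unshelve. all: by end_near. Qed.

End sequence_derivative.

Section bounded_lipschitz.
Context {R : realType} {k : nat}.
Notation ST := ('rV[R]_k * R)%type.
Variables (S : set ST) (e : R).

Definition bounded_lip (f : ST -> R) := exists2 M : R, 0 <= M &
  (forall X, S X -> `|f X| <= M) /\
  (forall X Z, S X -> S Z -> `|Z - X| <= e -> `|f Z - f X| <= M * `|Z - X|).

Lemma bounded_lipW f (M1 M2 : R) : (forall X, S X -> `|f X| <= M1) ->
  (forall X Z, S X -> S Z -> `|Z - X| <= e -> `|f Z - f X| <= M2 * `|Z - X|) ->
  bounded_lip f.
Proof.
move=> h1 h2; exists (`|M1| + `|M2|); first by rewrite addr_ge0.
split=> [X SX|X Z SX SZ XZ].
  by rewrite (le_trans (h1 _ SX))// (le_trans (ler_norm _))// lerDl.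
rewrite (le_trans (h2 _ _ SX SZ XZ))// ler_wpM2r// (le_trans (ler_norm _))//.
by rewrite lerDr.
Qed.

Lemma bounded_lipD f g : bounded_lip f -> bounded_lip g ->
  bounded_lip (fun X => f X + g X).
Proof.
move=> [M M0 [f1 f2]] [M' M'0 [g1 g2]]; apply: (@bounded_lipW _ (M + M') (M + M')).
  by move=> X SX; rewrite (le_trans (ler_normD _ _))// lerD// ?f1 ?g1.
move=> X Z SX SZ XZ; rewrite opprD addrACA (le_trans (ler_normD _ _))// mulrDl.
by rewrite lerD// ?f2 ?g2.
Qed.

Lemma bounded_lipM f g : bounded_lip f -> bounded_lip g ->
  bounded_lip (fun X => f X * g X).
Proof.
move=> [M M0 [f1 f2]] [M' M'0 [g1 g2]].
apply: (@bounded_lipW _ (M * M') (M * M' + M * M')).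
  by move=> X SX; rewrite normrM ler_pM// ?f1 ?g1.
move=> X Z SX SZ XZ.
have -> : f Z * g Z - f X * g X = (f Z - f X) * g Z + f X * (g Z - g X) by ring.
rewrite (le_trans (ler_normD _ _))// !normrM mulrDl lerD//.
  by rewrite mulrAC ler_pM// ?f2 ?g1.
by rewrite -mulrA ler_pM// ?f1 ?g2.
Qed.

Lemma bounded_lipN f : bounded_lip f -> bounded_lip (fun X => - f X).
Proof.
move=> [M M0 [f1 f2]]; apply: (@bounded_lipW _ M M).
  by move=> X SX; rewrite normrN f1.
by move=> X Z SX SZ XZ; rewrite -opprD normrN f2.
Qed.

Lemma bounded_lip_sum (I : Type) (r : seq I) (f : I -> ST -> R) :
  (forall i, bounded_lip (f i)) -> bounded_lip (fun X => \sum_(i <- r) f i X).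
Proof.
move=> hf; elim: r => [|i r ih].
  apply: (@bounded_lipW _ 0 0) => [X _|X Z _ _ _]; rewrite !big_nil ?normr0//.
  by rewrite subrr normr0 mul0r.
have [M M0 [h1 h2]] := bounded_lipD (hf i) ih.
by exists M => //; split=> [X SX|X Z SX SZ XZ]; rewrite !big_cons; auto.
Qed.

Lemma bounded_lip_comp n (O : set 'rV[R]_n) (f : 'rV[R]_n -> R) (W : ST -> 'rV[R]_n)
    (C C' MW LW : R) (p q : nat) : 0 <= C -> 0 <= C' ->
  (forall V, O V -> `|f V| <= C' * (1 + `|V|) ^+ q) ->
  (forall V V', O V -> O V' -> `|f V - f V'| <= C * (1 + `|V| + `|V'|) ^+ p * `|V - V'|) ->
  (forall X, S X -> O (W X)) -> (forall X, S X -> `|W X| <= MW) ->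
  (forall X Z, S X -> S Z -> `|Z - X| <= e -> `|W Z - W X| <= LW * `|Z - X|) ->
  bounded_lip (fun X => f (W X)).
Proof.
move=> C0 C'0 h1 h2 WO WM WL.
apply: (@bounded_lipW _ (C' * (1 + MW) ^+ q) (C * (1 + MW + MW) ^+ p * LW)).
  move=> X SX; rewrite (le_trans (h1 _ (WO _ SX)))// ler_wpM2l//.
  have M0 := le_trans (normr_ge0 _) (WM _ SX).
  by rewrite lerXn2r ?nnegrE ?addr_ge0// lerD2l WM.
move=> X Z SX SZ XZ; rewrite (le_trans (h2 _ _ (WO _ SZ) (WO _ SX)))//.
have M0 := le_trans (normr_ge0 _) (WM _ SX).
rewrite -[leRHS]mulrA ler_pM ?WL// ?mulr_ge0 ?exprn_ge0 ?addr_ge0//.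
by rewrite ler_wpM2l// lerXn2r ?nnegrE ?addr_ge0// !lerD// WM.
Qed.

End bounded_lipschitz.

(** * The commutator estimate *)

Section core.
Context {R : realType} {k n : nat}.
Notation ST := ('rV[R]_k * R)%type.
Notation mST := ('rV[R]_k * measurableTypeR R)%type.
Notation mu := (@spacetime_lebesgue R k).
Variables (O : set 'rV[R]_n) (G : option 'I_k -> 'I_n -> 'rV[R]_n -> R)
  (DG : option 'I_k -> 'I_n -> 'rV[R]_n -> 'rV[R]_n)
  (Q : option 'I_k -> 'rV[R]_n -> R) (B : 'I_n -> 'rV[R]_n -> R)
  (DB : 'I_n -> 'rV[R]_n -> 'rV[R]_n) (C : R).
Hypotheses (cO : convex_set O) (ES : entropy_system O G DG Q B DB C).

Definition evec (a : option 'I_k) : ST :=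
  if a is Some j then (delta_mx 0 j, 0) else (0, 1).

Lemma norm_evec a : `|evec a| <= 1.
Proof.
apply/spacetime_norm_leP; case: a => [j|] /=; rewrite ?normr0 ?normr1 ?ler01 ?lexx//.
split => //; apply/rV_norm_leP => // i; rewrite mxE eqxx /=.
by case: (_ == _); rewrite ?normr1 ?normr0.
Qed.

Variables (U : ST -> 'rV[R]_n) (D : set ST).
Hypotheses (mD : measurable (D : set mST)) (Doo : (mu (D : set mST) < +oo)%E)
  (mU : measurable_fun (D : set mST) U) (UO : forall X, D X -> O (U X))
  (U3 : rint mu D (fun X => `|U X| ^+ 3)).

Let C0 := es_ge0 ES.

Lemma measurable_normU : measurable_fun (D : set mST) (fun X => `|U X|).
Proof. exact: measurable_norm_comp. Qed.

Lemma rint_one : rint mu D (fun=> 1 : R).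
Proof. by apply: (@rint_bounded _ mST R mu _ _ 1) => // X _; rewrite normr1. Qed.

Lemma rint_cubic_weight : rint mu D (fun X => (1 + `|U X|) ^+ 3).
Proof.
apply: (@rint_le _ mST R mu _ _ (fun X => 8 * 1 + 8 * `|U X| ^+ 3)) => //.
- apply: measurable_funX; apply: measurable_funD; first exact: measurable_cst.
  exact: measurable_normU.
- by apply: rintD => //; [apply: rintZl => //; exact: rint_one|exact: rintZl].
move=> X _; rewrite ger0_norm ?exprn_ge0 ?addr_ge0//.
have := normr_ge0 (U X); move: `|U X| => z z0.
have := mulr_ge0 (addr_ge0 ler01 z0) (sqr_ge0 (1 - z)); nra.
Qed.

Lemma rint_cubic_growth (f : ST -> R) (c : R) (p : nat) : measurable_fun (D : set mST) f ->
  0 <= c -> (p <= 3)%N -> (forall X, D X -> `|f X| <= c * (1 + `|U X|) ^+ p) ->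
  rint mu D f.
Proof.
move=> mf c0 p3 hf; apply: (@rint_le _ mST R mu _ _ (fun X => c * (1 + `|U X|) ^+ 3)) => //.
  by apply: rintZl => //; exact: rint_cubic_weight.
move=> X DX; rewrite (le_trans (hf X DX))// ler_wpM2l// ler_weXn2l//.
by rewrite lerDl.
Qed.

Lemma rint_U l : rint mu D (fun X => U X 0 l).
Proof.
apply: (@rint_cubic_growth _ 1 1) => //; first exact: (measurableT_comp (measurable_coord l) mU).
by move=> X _; rewrite mul1r expr1 (le_trans (le_rV_norm _ _))// lerDr.
Qed.

Lemma measurable_G (S : set ST) (W : ST -> 'rV[R]_n) a i :
  measurable (S : set mST) -> measurable_fun (S : set mST) W ->
  (forall X, S X -> O (W X)) -> measurable_fun (S : set mST) (fun X => G a i (W X)).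
Proof.
move=> mS mW WO; apply: (measurable_comp_rel _ mS mW WO).
exact: (rel_continuous_lip C0 (es_lipG ES a i)).
Qed.

Lemma measurable_Q (S : set ST) (W : ST -> 'rV[R]_n) a :
  measurable (S : set mST) -> measurable_fun (S : set mST) W ->
  (forall X, S X -> O (W X)) -> measurable_fun (S : set mST) (fun X => Q a (W X)).
Proof.
move=> mS mW WO; apply: (measurable_comp_rel _ mS mW WO).
exact: (rel_continuous_lip C0 (es_lipQ ES a)).
Qed.

Lemma measurable_B (S : set ST) (W : ST -> 'rV[R]_n) i :
  measurable (S : set mST) -> measurable_fun (S : set mST) W ->
  (forall X, S X -> O (W X)) -> measurable_fun (S : set mST) (fun X => B i (W X)).
Proof.
move=> mS mW WO; apply: (measurable_comp_rel _ mS mW WO).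
apply: (@rel_continuous_lip _ _ _ _ C 0 C0) => V V' OV OV'.
by rewrite expr0 mulr1; exact: (es_lipB ES).
Qed.

Lemma rint_G a i : rint mu D (fun X => G a i (U X)).
Proof.
apply: (@rint_cubic_growth _ C 2) => //; first exact: measurable_G.
by move=> X DX; exact: (es_growG ES a i (UO DX)).
Qed.

Lemma rint_Q a : rint mu D (fun X => Q a (U X)).
Proof.
apply: (@rint_cubic_growth _ C 3) => //; first exact: measurable_Q.
by move=> X DX; exact: (es_growQ ES a (UO DX)).
Qed.

(** P is a neighbourhood of the support of phi and D one of P, both with margin
    r0, so that mollification at scales below r0 never sees the boundary of D. *)
Variables (P : set ST) (r0 : R) (phi : ST -> R) (dphi : option 'I_k -> ST -> R) (C1 : R).
Hypotheses (oP : open P) (PD : P `<=` D)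
  (Pdeep : forall Y X, P Y -> `|Y - X| < r0 -> D X)
  (phi_supp : forall X Y, phi X != 0 -> `|X - Y| < r0 -> P Y)
  (phi_bound : forall X, `|phi X| <= C1)
  (phi_lip : forall X H, `|phi (X + H) - phi X| <= C1 * `|H|)
  (dphi_meas : forall a, measurable_fun setT (dphi a : mST -> R))
  (dphi_bound : forall a X, `|dphi a X| <= C1)
  (dphi_cvg : {ae mu, forall X, forall a (t : nat -> R), (forall m, 0 < t m) ->
     t @ \oo --> +oo -> seq_deriv t (evec a) X phi (dphi a X)}).

Let mP : measurable (P : set mST). Proof. exact: measurable_spacetime_open. Qed.
Let Poo : (mu (P : set mST) < +oo)%E.
Proof. by apply: le_lt_trans Doo; apply: le_measure => //; rewrite inE. Qed.
Let C10 : 0 <= C1. Proof. exact: le_trans (normr_ge0 _) (phi_bound 0). Qed.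

Let mphi : measurable_fun setT (phi : mST -> R).
Proof.
apply: continuous_measurable_spacetime; first exact: openT.
move=> X _; apply: (continuous_of_lip ltr01 (L := C1)) => Y H _; exact: phi_lip.
Qed.

Variable e : R.
Hypotheses (e0 : 0 < e) (er0 : e < r0).

(** The mollified solution W and its partial derivatives dW. *)
Definition W (Y : ST) : 'rV[R]_n := vmoll e D (fun l X => U X 0 l) Y.
Definition dW (a : option 'I_k) (Y : ST) : 'rV[R]_n :=
  vdmoll e D (fun l X => U X 0 l) Y (evec a).

Lemma WE Y l : W Y 0 l = moll e D (fun X => U X 0 l) Y.
Proof. by rewrite mxE. Qed.
Lemma dWE a Y l : dW a Y 0 l = dmoll e D (fun X => U X 0 l) (evec a) Y.
Proof. by rewrite mxE. Qed.

Let deep Y : P Y -> forall X, `|Y - X| < e -> D X.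
Proof. by move=> PY X YX; apply: Pdeep PY _; exact: lt_trans er0. Qed.

(** Well inside D the kernel has unit mass, so that W(Y) is a mean of values of
    U, and the convexity of O keeps it in the domain of the nonlinearities. *)
Lemma W_mem Y : P Y -> O (W Y).
Proof.
move=> PY.
have N0 : 0 < rho_mass k e by exact: rho_mass_gt0.
pose w : ST -> R := (fun X => (rho_mass k e)^-1 * rho e (Y - X)) \_ D.
have wE (f : ST -> R) X : w X * f X = ((fun X => (rho_mass k e)^-1 * (f X * rho e (Y - X))) \_ D) X.
  by rewrite /w /patch; case: ifP => _; [ring|rewrite mul0r].
have iw : rint mu setT w.
  apply: rint_patch; first exact: mD.
  apply: rintZl; first exact: mD.
  exact: rint_rho.
have iwf l : rint mu setT (fun X => w X * U X 0 l).
  apply: (@eq_rint _ mST R mu _ ((fun X => (rho_mass k e)^-1 * (U X 0 l * rho e (Y - X))) \_ D)).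
  - exact: measurableT.
  - by move=> X _; rewrite (wE (fun X => U X 0 l)).
  apply: rint_patch; first exact: mD.
  apply: rintZl; first exact: mD.
  by apply: rint_moll; [exact: e0|exact: mD|exact: rint_U].
suff : O (\row_l Rintegral mu setT (fun X => w X * U X 0 l)).
  congr O; apply/rowP => l; rewrite WE mollE mxE.
  rewrite (@eq_RintegralS _ mST R mu _ _ ((fun X => (rho_mass k e)^-1 * (U X 0 l * rho e (Y - X))) \_ D)); last first.
    by move=> X _; rewrite (wE (fun X => U X 0 l)).
  rewrite -Rintegral_mkcond RintegralZl; [by []|exact: mD|].
  by apply: rint_moll; [exact: e0|exact: mD|exact: rint_U].
apply: (@convex_mean R _ mST mu n O w U cO) => [X|X||l|].
- rewrite /w /patch; case: ifP => // _.
  by rewrite mulr_ge0 ?rho_ge0// invr_ge0 ltW.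
- by rewrite /w /patch; case: ifP => [/set_mem DX _|_]; [exact: UO|rewrite ltxx].
- exact: iw.
- exact: iwf.
- rewrite /w -Rintegral_mkcond RintegralZl; [|exact: mD|exact: rint_rho].
  by rewrite rho_mass_deep ?mulVf ?gt_eqF//; exact: deep.
Qed.

Let MW : R := \sum_(l < n) moll_cst e D (fun X => U X 0 l).

Lemma W_bound Y : `|W Y| <= MW.
Proof.
have c0 l : 0 <= moll_cst e D (fun X => U X 0 l) by exact: moll_cst_ge0.
apply/rV_norm_leP; first by apply: sumr_ge0.
move=> l; rewrite WE (le_trans (moll_bound e0 mD Y (rint_U l)))// /MW (bigD1 l)//= lerDl.
by apply: sumr_ge0.
Qed.

Lemma W_lip (X Z : ST) : `|Z - X| <= e ->
  `|W Z - W X| <= (rho_taylor_cst k e * e + drho_bound k e) * MW * `|Z - X|.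
Proof.
move=> XZ.
have c0 l : 0 <= moll_cst e D (fun X => U X 0 l) by exact: moll_cst_ge0.
have K0 : 0 <= rho_taylor_cst k e * e + drho_bound k e.
  apply: addr_ge0; last exact: drho_bound_ge0.
  by apply: mulr_ge0; [exact: rho_taylor_cst_ge0|exact: ltW].
have M0 : 0 <= MW by apply: sumr_ge0.
apply/rV_norm_leP; first by rewrite !mulr_ge0.
move=> l; rewrite mxE [X in _ + X]mxE !WE.
have := moll_lip e0 mD X (rint_U l) XZ.
rewrite [X + _]addrC subrK => h; apply: (le_trans h).
rewrite ler_wpM2r// ler_wpM2l// /MW (bigD1 l)//= lerDl.
by apply: sumr_ge0.
Qed.

Lemma measurable_W : measurable_fun (P : set mST) W.
Proof.
apply: measurable_fun_rVD => [//|l].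
under eq_fun do rewrite WE.
apply: continuous_measurable_spacetime => // X _.
by apply: moll_continuous; [exact: e0|exact: mD|exact: rint_U].
Qed.

Lemma rint_phiB i : rint mu P (fun Y => phi Y * B i (W Y)).
Proof.
have M0 : 0 <= MW by apply: sumr_ge0 => l _; exact: moll_cst_ge0.
apply: (@rint_bounded _ mST R mu _ _ (C1 * (C * (1 + MW)))).
- exact: mP.
- exact: Poo.
- apply: measurable_funM; first exact: measurable_funTS.
  by apply: measurable_B; [exact: mP|exact: measurable_W|exact: W_mem].
move=> X PX; rewrite normrM ler_pM ?phi_bound//.
rewrite (le_trans (es_growB ES i (W_mem PX)))//.
by rewrite ler_wpM2l// lerD2l W_bound.
Qed.

Variables (Dom Kc : set ST).
Hypotheses (cKc : compact Kc) (KcDom : Kc `<=` Dom) (PKc : P `<=` Kc) (DDom : D `<=` Dom)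
  (weak : forall psi : ST -> 'rV[R]_n, C1c Dom psi ->
    Rintegral mu Dom (fun X => \sum_a \sum_i ('D_(evec a) psi X) 0 i * G a i (U X)) = 0).

(** The weak formulation tested with the mollification of phi B(W), after
    moving the mollifier onto the fluxes. *)
Lemma tested_equation :
  \sum_a Rintegral mu P (fun Y => phi Y *
     \sum_i B i (W Y) * dmoll e D (fun X => G a i (U X)) (evec a) Y) = 0.
Proof.
pose f i (Y : ST) := phi Y * B i (W Y).
have i_f i : rint mu P (f i) by exact: rint_phiB.
have fP i (X Y : ST) : f i Y != 0 -> `|X - Y| < e -> P X.
  rewrite /f mulf_eq0 negb_or => /andP[phiY _] XY; apply: phi_supp phiY _.
  by rewrite distrC (lt_trans XY).
have hC1 : C1c Dom (vmoll e P f).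
  by apply: (vmoll_C1c e0 mP i_f cKc KcDom PKc) => i X Y; exact: fP.
have := weak hC1.
have dE X a i : ('D_(evec a) (vmoll e P f) X) 0 i = dmoll e P (f i) (evec a) X.
  by have [_ ->] := vmoll_differentiable e0 mP i_f X; rewrite mxE.
have -> : Rintegral mu Dom (fun X => \sum_a \sum_i
    ('D_(evec a) (vmoll e P f) X) 0 i * G a i (U X)) =
  Rintegral mu D (fun X => \sum_a \sum_i dmoll e P (f i) (evec a) X * G a i (U X)).
  transitivity (Rintegral mu Dom (fun X => \sum_a \sum_i dmoll e P (f i) (evec a) X * G a i (U X))).
    apply: eq_RintegralS => X _; apply: eq_bigr => a _; apply: eq_bigr => i _.
    by rewrite dE.
  apply: Rintegral_supp => X h; suff PX : P X by split => _; [exact: PD|exact/DDom/PD].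
  apply: contrapT => nPX; move/eqP: h; apply; apply: big1 => a _; apply: big1 => i _.
  have [->|/(dmoll_supp e0 mP)[Y fY XY]] := eqVneq (dmoll e P (f i) (evec a) X) 0.
    by rewrite mul0r.
  by case: nPX; exact: fP fY XY.
have i1 a i : rint mu D (fun X => dmoll e P (f i) (evec a) X * G a i (U X)).
  apply: (@rintMb _ mST R mu _ _ _ (drho_bound k e * `|evec a| * moll_cst e P (f i))).
  - exact: mD.
  - apply: measurable_funTS; apply: continuous_measurable_spacetime; first exact: openT.
    by move=> X _; apply: dmoll_continuous; [exact: e0|exact: mP|exact: i_f].
  - by move=> X _; apply: dmoll_bound; [exact: e0|exact: mP|exact: i_f].
  - exact: rint_G.
rewrite Rintegral_sum; [|exact: mD|move=> a; apply: rint_sum; [exact: mD|exact: i1]].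
move=> h; apply/eqP; rewrite -oppr_eq0 -sumrN -[X in _ == X]h; apply/eqP.
apply: eq_bigr => a _.
rewrite Rintegral_sum; [|exact: mD|exact: i1].
have i2 i : rint mu P (fun Y => f i Y * dmoll e D (fun X => G a i (U X)) (evec a) Y).
  apply: (@eq_rint _ mST R mu _ (fun Y => dmoll e D (fun X => G a i (U X)) (evec a) Y * f i Y)).
  - exact: mP.
  - by move=> Y _; rewrite mulrC.
  apply: (@rintMb _ mST R mu _ _ _ (drho_bound k e * `|evec a| * moll_cst e D (fun X => G a i (U X)))).
  - exact: mP.
  - apply: measurable_funTS; apply: continuous_measurable_spacetime; first exact: openT.
    by move=> X _; apply: dmoll_continuous; [exact: e0|exact: mD|exact: rint_G].
  - by move=> X _; apply: dmoll_bound; [exact: e0|exact: mD|exact: rint_G].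
  - exact: i_f.
transitivity (- Rintegral mu P (fun Y => \sum_i f i Y * dmoll e D (fun X => G a i (U X)) (evec a) Y)).
  congr (- _); apply: eq_RintegralS => Y _; rewrite mulr_sumr; apply: eq_bigr => i _.
  by rewrite mulrA.
rewrite Rintegral_sum; [|exact: mP|exact: i2].
rewrite -sumrN; apply: eq_bigr => i _.
by rewrite dmoll_adjoint; [|exact: e0|exact: mD|exact: mP|exact: i_f|exact: rint_G].
Qed.

(** The function corrected is Q(W) + B(W) . defect.  Its derivative contains no
    derivative of G(W), as the chain rule DQ = B DG cancels it: this is why the
    derivatives of B(W) only ever meet the defect, which is quadratically small. *)
Definition defect (a : option 'I_k) (i : 'I_n) (Y : ST) : R :=
  moll e D (fun X => G a i (U X)) Y - G a i (W Y).
Definition corrected (a : option 'I_k) (Y : ST) : R :=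
  \sum_i B i (W Y) * defect a i Y + Q a (W Y).
Definition dBW (a : option 'I_k) (i : 'I_n) (Y : ST) : R := dotp (dW a Y) (DB i (W Y)).
Definition dcorrected (a : option 'I_k) (Y : ST) : R :=
  \sum_i dBW a i Y * defect a i Y +
  \sum_i B i (W Y) * dmoll e D (fun X => G a i (U X)) (evec a) Y.

Let Mpos : 0 <= MW. Proof. by apply: sumr_ge0 => l _; exact: moll_cst_ge0. Qed.
Let LW : R := (rho_taylor_cst k e * e + drho_bound k e) * MW.
Let LW0 : 0 <= LW.
Proof.
apply: mulr_ge0 => //; apply: addr_ge0; last exact: drho_bound_ge0.
by apply: mulr_ge0; [exact: rho_taylor_cst_ge0|exact: ltW].
Qed.

Let phi0 X : ~ P X -> phi X = 0.
Proof.
move=> nPX; apply/eqP/negPn/negP => /phi_supp h; apply: nPX; apply: h.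
by rewrite subrr normr0 (lt_trans e0).
Qed.

Lemma bounded_lip_moll f : rint mu D f -> bounded_lip P e (moll e D f).
Proof.
move=> i_f; apply: (@bounded_lipW _ _ _ _ _ (moll_cst e D f)
   ((rho_taylor_cst k e * e + drho_bound k e) * moll_cst e D f)).
  by move=> X _; apply: moll_bound; [exact: e0|exact: mD|exact: i_f].
move=> X Z _ _ XZ; have := moll_lip e0 mD X i_f XZ.
by rewrite [X + _]addrC subrK.
Qed.

Lemma bounded_lip_corrected a : bounded_lip P e (corrected a).
Proof.
have wb X : P X -> `|W X| <= MW by move=> _; exact: W_bound.
have wl X Z : P X -> P Z -> `|Z - X| <= e -> `|W Z - W X| <= LW * `|Z - X|.
  by move=> _ _; exact: W_lip.
apply: bounded_lipD.
  apply: bounded_lip_sum => i; apply: bounded_lipM.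
    apply: (@bounded_lip_comp _ _ _ _ _ O (B i) W C C MW LW 0 1) => //.
    - by move=> V OV; rewrite expr1; exact: (es_growB ES).
    - by move=> V V' OV OV'; rewrite expr0 mulr1; exact: (es_lipB ES).
    - exact: W_mem.
  apply: bounded_lipD; first by apply: bounded_lip_moll; exact: rint_G.
  apply: bounded_lipN.
  apply: (@bounded_lip_comp _ _ _ _ _ O (G a i) W C C MW LW 1 2) => //.
  - exact: (es_growG ES).
  - exact: (es_lipG ES).
  - exact: W_mem.
apply: (@bounded_lip_comp _ _ _ _ _ O (Q a) W C C MW LW 2 3) => //.
- exact: (es_growQ ES).
- exact: (es_lipQ ES).
- exact: W_mem.
Qed.

Lemma measurable_defect a i : measurable_fun (P : set mST) (defect a i).
Proof.
apply: measurable_funB.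
  apply: continuous_measurable_spacetime => // X _.
  by apply: moll_continuous; [exact: e0|exact: mD|exact: rint_G].
by apply: measurable_G; [exact: mP|exact: measurable_W|exact: W_mem].
Qed.

Lemma measurable_corrected a : measurable_fun (P : set mST) (corrected a).
Proof.
apply: measurable_funD; last first.
  by apply: measurable_Q; [exact: mP|exact: measurable_W|exact: W_mem].
apply: measurable_sum => i; apply: measurable_funM; last exact: measurable_defect.
by apply: measurable_B; [exact: mP|exact: measurable_W|exact: W_mem].
Qed.

Lemma measurable_dBW a i : measurable_fun (P : set mST) (dBW a i).
Proof.
apply: measurable_sum => l; apply: measurable_funM.
  under eq_fun do rewrite dWE.
  apply: continuous_measurable_spacetime => // X _.
  by apply: dmoll_continuous; [exact: e0|exact: mD|exact: rint_U].
by apply: (measurable_comp_rel (es_contDB ES i l) mP measurable_W W_mem).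
Qed.

Lemma measurable_dcorrected a : measurable_fun (P : set mST) (dcorrected a).
Proof.
apply: measurable_funD; apply: measurable_sum => i; apply: measurable_funM.
- exact: measurable_dBW.
- exact: measurable_defect.
- by apply: measurable_B; [exact: mP|exact: measurable_W|exact: W_mem].
apply: continuous_measurable_spacetime => // X _.
by apply: dmoll_continuous; [exact: e0|exact: mD|exact: rint_G].
Qed.

Section along_sequence.
Variables (a : option 'I_k) (t : nat -> R).
Hypotheses (t0 : forall m, 0 < t m) (too : t @ \oo --> +oo) (te : forall m, e^-1 <= t m).

Let step X m : `|X + (t m)^-1 *: evec a - X| <= (t m)^-1.
Proof.
rewrite addrC addKr normrZ ger0_norm ?invr_ge0 ?(ltW (t0 m))//.
by rewrite ler_piMr ?norm_evec// invr_ge0 ltW.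
Qed.

Let step_e X m : `|X + (t m)^-1 *: evec a - X| <= e.
Proof.
rewrite (le_trans (step X m))// -[leRHS]invrK lef_pV2 ?posrE ?invr_gt0//.
Qed.

Lemma seq_deriv_comp X (g : 'rV[R]_n -> R) (v : 'rV[R]_n) : P X ->
  is_gradient O g (W X) v ->
  seq_deriv t (evec a) X (fun Y => g (W Y)) (dotp (dW a X) v).
Proof.
move=> PX hg; apply: (gradient_chain_seq (L := LW) hg t0 too).
- have : (fun m => X + (t m)^-1 *: evec a) @ \oo --> X.
    rewrite -[X in _ --> X]addr0 -(scale0r (evec a)).
    by apply: cvgD; [exact: cvg_cst|apply: cvgZr_tmp; exact: inv_t_cvg0].
  move=> h.
  have hP : \forall m \near \oo, P (X + (t m)^-1 *: evec a).
    exact: h P (open_nbhs_nbhs (conj oP PX)).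
  by near=> m; apply: W_mem; near: m; exact: hP.
- move=> m; rewrite (le_trans (W_lip (step_e X m)))// ler_wpM2l//.
- move=> l; rewrite dWE.
  have := seq_deriv_moll (v := evec a) (X := X) t0 too e0 mD (rint_U l).
  by apply: eq_cvg_seq => m; rewrite !WE.
Unshelve. all: by end_near. Qed.

(** The terms B(W) D(G(W)) and D(Q(W)) cancel. *)
Lemma seq_deriv_corrected X : P X ->
  seq_deriv t (evec a) X (corrected a) (dcorrected a X).
Proof.
move=> PX; have OW := W_mem PX.
have -> : dcorrected a X =
   \sum_i (dBW a i X * defect a i X + B i (W X) *
     (dmoll e D (fun X => G a i (U X)) (evec a) X + - dotp (dW a X) (DG a i (W X)))) +
   dotp (dW a X) (\sum_i B i (W X) *: DG a i (W X)).
  rewrite /dcorrected -big_split /=.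
  have -> : dotp (dW a X) (\sum_i B i (W X) *: DG a i (W X)) =
      \sum_i B i (W X) * dotp (dW a X) (DG a i (W X)).
    elim: (index_enum 'I_n) => [|i r ih]; first by rewrite !big_nil dotp0r.
    by rewrite !big_cons dotpDr dotpZr ih.
  by rewrite -big_split /=; apply: eq_bigr => i _; ring.
apply: seq_derivD; last by apply: seq_deriv_comp => //; exact: (es_gradQ ES).
apply: seq_deriv_sum => i; apply: seq_derivM => //.
  by apply: seq_deriv_comp => //; exact: (es_gradB ES).
apply: seq_derivD; first by apply: seq_deriv_moll => //; exact: rint_G.
by apply: seq_derivN; apply: seq_deriv_comp => //; exact: (es_gradG ES).
Qed.

End along_sequence.

(** Integration by parts against a weight phi that is only Lipschitz, hence the
    derivatives along a sequence. *)
Lemma integrated_by_parts a :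
  Rintegral mu P (fun Y => dphi a Y * corrected a Y + phi Y * dcorrected a Y) = 0.
Proof.
pose t m : R := m%:R + e^-1.
have t0 m : 0 < t m by rewrite ltr_wpDl// invr_gt0.
have te m : e^-1 <= t m by rewrite /t lerDr.
have too : t @ \oo --> +oo.
  apply/cvgryPge => A; near=> m.
  apply: (@le_trans _ _ m%:R); last by rewrite /t lerDl invr_ge0 ltW.
  by near: m; exact: nbhs_infty_ger.
pose h : ST -> R := fun Y => phi Y * corrected a Y.
have hE : h = (fun Y => phi Y * corrected a Y) \_ P.
  apply/funext => X; rewrite /h /patch; case: ifPn => // /negP nPX.
  by rewrite phi0 ?mul0r// => PX; apply: nPX; rewrite inE.
have [M M0 [hM hL]] : bounded_lip P e h.
  apply: bounded_lipM; last exact: bounded_lip_corrected.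
  apply: (@bounded_lipW _ _ _ _ _ C1 C1) => [X _|X Z _ _ _]; first exact: phi_bound.
  by have := phi_lip X (Z - X); rewrite [X + _]addrC subrK.
have step X m : `|X + (t m)^-1 *: evec a - X| <= (t m)^-1.
  rewrite addrC addKr normrZ ger0_norm ?invr_ge0 ?(ltW (t0 m))//.
  by rewrite ler_piMr ?norm_evec// invr_ge0 ltW.
have step_e X m : `|X + (t m)^-1 *: evec a - X| <= e.
  by rewrite (le_trans (step X m))// -[leRHS]invrK lef_pV2 ?posrE ?invr_gt0.
have near0 X Z : `|Z - X| <= e -> ~ P X \/ ~ P Z -> phi X = 0 /\ phi Z = 0.
  move=> XZ nP; split; apply/eqP/negPn/negP => /phi_supp hp.
    have PX : P X by apply: hp; rewrite subrr normr0 (lt_trans e0).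
    have PZ : P Z by apply: hp; rewrite distrC (le_lt_trans XZ).
    by case: nP.
  have PZ : P Z by apply: hp; rewrite subrr normr0 (lt_trans e0).
  have PX : P X by apply: hp; rewrite (le_lt_trans XZ).
  by case: nP.
rewrite Rintegral_mkcond.
apply: (@Rintegral_derivative_eq0 _ _ P (evec a) h _ t M).
- exact: mP.
- exact: Poo.
- rewrite hE; apply: rint_patch; first exact: mP.
  apply: (@rint_bounded _ mST R mu _ _ M); [exact: mP|exact: Poo| |exact: hM].
  apply: measurable_funM; first exact: measurable_funTS.
  exact: measurable_corrected.
- apply: measurable_patch; first exact: mP.
  apply: measurable_funD; apply: measurable_funM.
  + exact: measurable_funTS.
  + exact: measurable_corrected.
  + exact: measurable_funTS.
  + exact: measurable_dcorrected.
- apply: ae_imp dphi_cvg => X /(_ a t t0 too) hX.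
  rewrite /patch; case: ifPn => [/set_mem PX|/negP nPX].
    rewrite (addrC (dphi a X * _)) addrC.
    exact: (seq_derivM t0 too hX (seq_deriv_corrected t0 too te PX)).
  rewrite (_ : (fun m => _) = cst 0); first exact: cvg_cst.
  apply/funext => m; have [|z1 z2] := near0 X _ (step_e X m).
    by left => PX; apply: nPX; rewrite inE.
  by rewrite /h z1 z2 !mul0r subrr mulr0.
move=> m X; rewrite normrM (gtr0_norm (t0 m)).
have [[PX PZ]|nP] := pselect (P X /\ P (X + (t m)^-1 *: evec a)).
  rewrite indicE mem_set// mulr1 mulrC -ler_pdivlMr//.
  by rewrite (le_trans (hL _ _ PX PZ (step_e X m)))// ler_wpM2l.
have [|z1 z2] := near0 X _ (step_e X m).
  by have [PX|] := pselect (P X); [right => PZ; apply: nP|left].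
by rewrite /h z1 z2 !mul0r subrr normr0 mulr0 mulr_ge0.
Unshelve. all: by end_near. Qed.

Section pointwise.
Variable Y : ST.
Hypothesis PY : P Y.
Notation K := (k.+1%:R : R).
Notation N := (rho_mass k e).

Definition near_part : set ST := D `&` [set X | sq (Y - X) < e ^+ 2].
Definition osc (p : nat) : R :=
  @mean_pow _ mST R mu near_part (fun X => `|U X - U Y|) N p.
(** Bounds the ratio of the volume of a ball of radius e to the mass of the kernel,
    uniformly in e. *)
Definition kappa_bound : R := 2 * (2 * K) ^+ k.+1.
Notation kappa0 := kappa_bound.

Let N0 : 0 < N. Proof. exact: rho_mass_gt0. Qed.
Let kappa0_ge0 : 0 <= kappa0. Proof. by rewrite mulr_ge0// exprn_ge0// mulr_ge0. Qed.
Let DY : D Y. Proof. exact: PD. Qed.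
Let OU : O (U Y). Proof. exact: UO. Qed.
Let OW : O (W Y). Proof. exact: W_mem. Qed.

Lemma measurable_near_part : measurable (near_part : set mST).
Proof.
apply: measurableI; first exact: mD.
have mp : measurable_fun setT ((fun X : ST => (Y, X)) : mST -> mST * mST).
  by apply: measurable_fun_pair => //; exact: measurable_cst.
have m1 := measurableT_comp (@measurable_diff_sq R k) mp.
rewrite [X in measurable X](_ : _ = setT `&` (fun X : ST => sq (Y - X)) @^-1` `]-oo, e ^+ 2[).
  by apply: m1; [exact: measurableT|exact: measurable_itv].
by rewrite setTI; apply/seteqP; split => X /=; rewrite in_itv.
Qed.
Let mE := measurable_near_part.
Let ED : near_part `<=` D. Proof. by move=> X []. Qed.

Let E_le : (mu (near_part : set mST) <= ((e *+ 2) ^+ k.+1)%:E)%E.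
Proof.
rewrite -(spacetime_lebesgue_ball Y e0); apply: le_measure; rewrite ?inE//.
  exact: measurable_spacetime_ball0.
by move=> X [_ /= h]; apply/mem_ball_sub; exact: norm_lt_sq.
Qed.

Lemma near_part_finite : (mu (near_part : set mST) < +oo)%E.
Proof. by apply: le_lt_trans E_le _; rewrite ltry. Qed.

Lemma kappa_le : N^-1 * fine (mu (near_part : set mST)) <= kappa0.
Proof.
have h : fine (mu (near_part : set mST)) <= (e *+ 2) ^+ k.+1.
  have := fine_le _ _ E_le; apply => //.
  rewrite ge0_fin_numE; first exact: near_part_finite.
  exact: measure_ge0.
have h2 : 2^-1 * (e / K) ^+ k.+1 <= N by exact: rho_mass_ge.
rewrite mulrC ler_pdivrMr// (le_trans h)//.
apply: (@le_trans _ _ (kappa0 * (2^-1 * (e / K) ^+ k.+1))); last by rewrite ler_wpM2l.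
rewrite /kappa_bound.
have -> : 2 * (2 * K) ^+ k.+1 * (2^-1 * (e / K) ^+ k.+1) = ((2 * K) * (e / K)) ^+ k.+1.
  rewrite [RHS]exprMn; move: ((2 * K) ^+ _) ((e / K) ^+ _) => A' B'.
  by rewrite mulrACA divff ?mul1r.
rewrite (_ : 2 * K * (e / K) = e *+ 2)//.
by rewrite -mulr_natl; field; rewrite gt_eqF.
Qed.

Let mx : measurable_fun (near_part : set mST) (fun X => `|U X - U Y|).
Proof.
apply: (measurable_funS mD ED).
apply: (@measurable_comp_rel _ _ _ _ setT (fun v => `|v - U Y|)) => //.
move=> x _ eps eps0; exists eps => // y _ h.
rewrite (le_lt_trans (ler_dist_dist _ _))//.
by rewrite opprB addrA subrK.
Qed.

Let x0 X : 0 <= `|U X - U Y|. Proof. exact: normr_ge0. Qed.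

Lemma rint_near_cube : rint mu near_part (fun X => `|U X - U Y| ^+ 3).
Proof.
apply: (@rint_le _ mST R mu _ _ (fun X => (1 + `|U Y|) ^+ 3 * (1 + `|U X|) ^+ 3)).
- exact: mE.
- exact: measurable_funX.
- apply: rintZl; first exact: mE.
  by apply: (rintS mD mE ED); exact: rint_cubic_weight.
move=> X _; rewrite ger0_norm ?exprn_ge0// -exprMn lerXn2r ?nnegrE ?mulr_ge0 ?addr_ge0//.
rewrite (le_trans (ler_normB _ _))//.
have := mulr_ge0 (normr_ge0 (U X)) (normr_ge0 (U Y)); lra.
Qed.

(* the averages of powers of the oscillation of U around Y *)
Let osc_ge0 p : 0 <= osc p. Proof. exact: mean_pow_ge0. Qed.
Let kap : R := N^-1 * fine (mu (near_part : set mST)).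
Let kap0 : 0 <= kap. Proof. by rewrite mulr_ge0 ?invr_ge0 ?(ltW N0)// fine_ge0. Qed.

Let osc12 : osc 1 * osc 2 <= 2 * kappa0 * osc 3.
Proof.
apply: (le_trans (mean_mul mE near_part_finite mx x0 rint_near_cube N0)).
by rewrite ler_wpM2r// ler_wpM2l// kappa_le.
Qed.

Let osc1sqr : osc 1 ^+ 2 <= kappa0 * osc 2.
Proof.
apply: (le_trans (mean_sqr mE near_part_finite mx x0 rint_near_cube N0)).
by rewrite ler_wpM2r// kappa_le.
Qed.

(* bounds an average against a kernel by the average over the ball *)
Let average_le (f g K' : ST -> R) (M : R) : rint mu D f ->
  measurable_fun (D : set mST) K' -> rint mu near_part g -> 0 <= M ->
  (forall X, `|K' X| <= M) -> (forall X, K' X != 0 -> sq (Y - X) < e ^+ 2) ->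
  (forall X, near_part X -> `|f X| <= g X) ->
  `|N^-1 * Rintegral mu D (fun X => f X * K' X)| <= M * (N^-1 * Rintegral mu near_part g).
Proof.
move=> i_f mK ig M0 KM Ks fg.
have -> : Rintegral mu D (fun X => f X * K' X) = Rintegral mu near_part (fun X => f X * K' X).
  apply: Rintegral_supp => X; rewrite mulf_eq0 negb_or => /andP[_ /Ks h].
  by split => [DX|[]].
rewrite normrM ger0_norm ?invr_ge0 ?(ltW N0)// mulrCA.
rewrite ler_wpM2l ?invr_ge0 ?(ltW N0)// -RintegralZl; [|exact: mE|exact: ig].
apply: norm_Rintegral_le.
- exact: mE.
- apply: measurable_funM; apply: (measurable_funS mD ED) => //.
  exact: rint_measurable i_f.
- by apply: rintZl; [exact: mE|exact: ig].
move=> X EX; rewrite normrM mulrC; apply: ler_pM => //; exact: fg.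
Qed.

Lemma moll_deep1 : N^-1 * Rintegral mu D (fun X => rho e (Y - X)) = 1.
Proof. by rewrite rho_mass_deep ?mulVf ?gt_eqF//; exact: deep. Qed.

Let mrho : measurable_fun (D : set mST) (fun X => rho e (Y - X)).
Proof. by apply: measurable_funTS; exact: measurable_rho_sub. Qed.

Let mdrho V : measurable_fun (D : set mST) (fun X => drho e (Y - X) V).
Proof. by apply: measurable_funTS; exact: measurable_drho_sub. Qed.

Let i_dU l : rint mu D (fun X => U X 0 l - U Y 0 l).
Proof.
apply: rintB; [exact: mD|exact: rint_U|].
by apply: (@rint_cst _ mST R mu); [exact: mD|exact: Doo].
Qed.

Let dU_le l X : near_part X -> `|U X 0 l - U Y 0 l| <= `|U X - U Y| ^+ 1.
Proof. by move=> _; have := le_rV_norm (U X - U Y) l; rewrite mxE [X in _ + X]mxE. Qed.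

Let i_x1 : rint mu near_part (fun X => `|U X - U Y| ^+ 1).
Proof. exact: (rint_pow mE near_part_finite mx x0 rint_near_cube). Qed.

Let moll_centred f (c : R) : rint mu D f ->
  moll e D f Y - c = N^-1 * Rintegral mu D (fun X => (f X - c) * rho e (Y - X)).
Proof.
move=> i_f.
have ic : rint mu D (fun X => c * rho e (Y - X)).
  by apply: rintZl; [exact: mD|exact: rint_rho].
have i1 : rint mu D (fun X => f X * rho e (Y - X)) by exact: rint_moll.
rewrite (@eq_RintegralS _ mST R mu _ _ (fun X => f X * rho e (Y - X) - c * rho e (Y - X))).
  rewrite RintegralB; [|exact: mD|exact: i1|exact: ic].
  rewrite RintegralZl; [|exact: mD|exact: rint_rho].
  by rewrite mulrBr mulrCA moll_deep1 mulr1 mollE.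
by move=> X _; rewrite mulrBl.
Qed.

Lemma W_near : `|W Y - U Y| <= osc 1.
Proof.
apply/rV_norm_leP => // l; rewrite mxE [X in _ + X]mxE WE (moll_centred _ (rint_U l)).
rewrite -[leRHS]mul1r; apply: average_le; [exact: i_dU|exact: mrho|exact: i_x1|exact: ler01| | |].
- by move=> X; exact: norm_rho_le1.
- by move=> X; exact: rho_supp.
- exact: dU_le.
Qed.

(** The derivative of the kernel has mean zero, so U(Y) can be subtracted. *)
Lemma dW_near a : `|dW a Y| <= drho_bound k e * osc 1.
Proof.
apply/rV_norm_leP => [|l]; first by apply: mulr_ge0 => //; exact: drho_bound_ge0.
rewrite dWE dmollE.
have -> : Rintegral mu D (fun X => U X 0 l * drho e (Y - X) (evec a)) =
          Rintegral mu D (fun X => (U X 0 l - U Y 0 l) * drho e (Y - X) (evec a)).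
  rewrite [RHS](@eq_RintegralS _ mST R mu _ _ (fun X => U X 0 l * drho e (Y - X) (evec a) -
     U Y 0 l * drho e (Y - X) (evec a))); last by move=> X _; rewrite mulrBl.
  have i1 := rint_dmoll e0 mD (evec a) Y (rint_U l).
  have i2 : rint mu D (fun X => drho e (Y - X) (evec a)) by exact: rint_drho.
  rewrite RintegralB; [|exact: mD|exact: i1|by apply: rintZl; [exact: mD|exact: i2]].
  rewrite RintegralZl; [|exact: mD|exact: i2].
  by rewrite drho_deep ?mulr0 ?subr0//; exact: deep.
apply: average_le; [exact: i_dU|exact: mdrho|exact: i_x1|exact: drho_bound_ge0| | |].
- move=> X; apply: (le_trans (drho_le e0 _ _)).
  by rewrite ler_piMr ?norm_evec// drho_bound_ge0.
- by move=> X; exact: drho_supp.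
- exact: dU_le.
Qed.

Definition defect_cst : R := 2 * C * (1 + kappa0 ^+ 2).

(** Commutation of the mollifier with G costs a square of the oscillation:
    the first order term of the expansion at W(Y) averages to zero because
    W(Y) is the mean of U. *)
Lemma defect_near a i : `|defect a i Y| <= defect_cst * osc 2.
Proof.
pose lin X := dotp (U X - W Y) (DG a i (W Y)).
have linE X : lin X = \sum_l DG a i (W Y) 0 l * (U X 0 l - W Y 0 l).
  by apply: eq_bigr => l _; rewrite mxE [X in _ + X]mxE mulrC.
have i_dUW l : rint mu D (fun X => U X 0 l - W Y 0 l).
  apply: rintB; [exact: mD|exact: rint_U|].
  by apply: (@rint_cst _ mST R mu); [exact: mD|exact: Doo].
have i_r l : rint mu D (fun X => DG a i (W Y) 0 l * ((U X 0 l - W Y 0 l) * rho e (Y - X))).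
  by apply: rintZl; [exact: mD|exact: rint_moll].
have lin0 : Rintegral mu D (fun X => lin X * rho e (Y - X)) = 0.
  rewrite (@eq_RintegralS _ mST R mu _ _ (fun X => \sum_l
     DG a i (W Y) 0 l * ((U X 0 l - W Y 0 l) * rho e (Y - X)))); last first.
    by move=> X _; rewrite linE mulr_suml; apply: eq_bigr => l _; rewrite mulrA.
  rewrite Rintegral_sum; [|exact: mD|exact: i_r].
  apply: big1 => l _; rewrite RintegralZl; [|exact: mD|exact: rint_moll].
  have := moll_centred (W Y 0 l) (rint_U l); rewrite -WE subrr => /esym/eqP.
  by rewrite mulf_eq0 invr_eq0 gt_eqF//= => /eqP ->; rewrite mulr0.
have i_lin : rint mu D lin.
  apply: (@eq_rint _ mST R mu _ (fun X => \sum_l DG a i (W Y) 0 l * (U X 0 l - W Y 0 l))).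
  - exact: mD.
  - by move=> X _; rewrite linE.
  apply: rint_sum; first exact: mD.
  by move=> l; apply: rintZl; [exact: mD|exact: i_dUW].
have i_G : rint mu D (fun X => G a i (U X) - G a i (W Y)).
  apply: rintB; [exact: mD|exact: rint_G|].
  by apply: (@rint_cst _ mST R mu); [exact: mD|exact: Doo].
have dE : defect a i Y = N^-1 *
    Rintegral mu D (fun X => (G a i (U X) - G a i (W Y) - lin X) * rho e (Y - X)).
  rewrite /defect (moll_centred _ (rint_G a i)).
  rewrite [in RHS](@eq_RintegralS _ mST R mu _ _ (fun X =>
    (G a i (U X) - G a i (W Y)) * rho e (Y - X) - lin X * rho e (Y - X))); last first.
    by move=> X _; rewrite mulrBl.
  rewrite RintegralB; [|exact: mD|exact: rint_moll|exact: rint_moll].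
  by rewrite lin0 subr0.
have i_x2 : rint mu near_part (fun X => `|U X - U Y| ^+ 2).
  exact: (rint_pow mE near_part_finite mx x0 rint_near_cube).
have i_c : rint mu near_part (fun=> osc 1 ^+ 2).
  by apply: (@rint_cst _ mST R mu); [exact: mE|exact: near_part_finite].
have i_g : rint mu near_part (fun X => 2 * C * (`|U X - U Y| ^+ 2 + osc 1 ^+ 2)).
  apply: rintZl; first exact: mE.
  by apply: rintD; [exact: mE|exact: i_x2|exact: i_c].
rewrite dE.
apply: (@le_trans _ _ (1 * (N^-1 * Rintegral mu near_part
   (fun X => 2 * C * (`|U X - U Y| ^+ 2 + osc 1 ^+ 2))))).
  apply: average_le; [|exact: mrho|exact: i_g|exact: ler01| | |].
  - by apply: rintB; [exact: mD|exact: i_G|exact: i_lin].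
  - by move=> X; exact: norm_rho_le1.
  - by move=> X; exact: rho_supp.
  move=> X [DX _]; apply: (le_trans (es_taylorG ES a i (UO DX) OW)).
  have h : `|U X - W Y| <= `|U X - U Y| + osc 1.
    have -> : U X - W Y = (U X - U Y) - (W Y - U Y) by rewrite opprB addrA subrK.
    by rewrite (le_trans (ler_normB _ _))// lerD2l W_near.
  have h2 : `|U X - W Y| ^+ 2 <= (`|U X - U Y| + osc 1) ^+ 2.
    by rewrite ler_sqr ?nnegrE ?addr_ge0.
  have h3 := sqr_ge0 (`|U X - U Y| - osc 1).
  rewrite [2 * C]mulrC -mulrA ler_wpM2l//; move: h2 h3; nra.
rewrite mul1r RintegralZl; [|exact: mE|by apply: rintD; [exact: mE|exact: i_x2|exact: i_c]].
rewrite RintegralD; [|exact: mE|exact: i_x2|exact: i_c].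
rewrite Rintegral_cst; last exact: mE.
have -> : N^-1 * (2 * C * (Rintegral mu near_part (fun X => `|U X - U Y| ^+ 2) +
    osc 1 ^+ 2 * fine (mu (near_part : set mST)))) = 2 * C * (osc 2 + osc 1 ^+ 2 * kap).
  by rewrite /osc /kap /mean_pow; ring.
rewrite /defect_cst -[leRHS]mulrA ler_wpM2l ?mulr_ge0//.
rewrite [leRHS]mulrDl mul1r lerD2l.
have k1 : kap <= kappa0 by exact: kappa_le.
apply: (@le_trans _ _ (kappa0 * osc 2 * kappa0)).
  by apply: ler_pM; [exact: sqr_ge0|exact: kap0|exact: osc1sqr|exact: k1].
by rewrite mulrAC expr2.
Qed.

Variable l : R.
Hypotheses (l0 : 0 < l) (l1 : l <= 1) (el : e = l ^+ 2).

Let osc_young1 y : 0 <= y -> y * osc 2 <= l ^+ 2 * y ^+ 3 * kap + osc 3 / l.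
Proof. by move=> y0; exact: (mean_young1 mE near_part_finite mx x0 rint_near_cube N0 y0 l0). Qed.

Let osc_young2 y : 0 <= y -> y ^+ 2 * osc 1 <= l * y ^+ 3 * kap + osc 3 / l ^+ 2.
Proof. by move=> y0; exact: (mean_young2 mE near_part_finite mx x0 rint_near_cube N0 y0 l0). Qed.

Lemma oscE p : osc p =
  N^-1 * Rintegral mu near_part (fun X => `|U X - U Y| ^+ p).
Proof. by []. Qed.

Definition error_cst : R :=
  C1 * (C * (8 * (kappa0 + 1) + 4 * kappa0 ^+ 2)) +
  C1 * (n%:R * C * defect_cst * (kappa0 + 1 + 2 * kappa0)) +
  C1 * (n%:R * (n%:R * C * (4 * K)) * defect_cst * (2 * kappa0)).

(** Every term of the local error is a product, of total degree three, of
    1 + |U(Y)| and averages of the oscillation, and the factor 1 / e of a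
    derivative of the kernel only comes with pure oscillation.  With e = l ^+ 2,
    Young's inequality turns all of them into l (1 + |U(Y)|)^3 and the cubic
    oscillation divided by e. *)
Lemma error_near a :
  `|dphi a Y * (Q a (U Y) - corrected a Y) -
    phi Y * \sum_i dBW a i Y * defect a i Y| <=
  error_cst * (l * (1 + `|U Y|) ^+ 3 + osc 3 / e).
Proof.
set y := 1 + `|U Y|.
have y0 : 0 <= y by rewrite addr_ge0.
have := osc_young2 y0; have := osc_young1 y0; have := osc1sqr; have := osc12.
have := defect_near a; have := dW_near a; have := W_near.
have := osc_ge0 3; have := osc_ge0 2; have := osc_ge0 1.
(* the averages only matter through these inequalities *)
move: (osc 1) (osc 2) (osc 3) => o1 o2 o3 a0 b0 c0 Wn dWn defn o12 o1sqr young1 young2.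
set s := l * y ^+ 3 + o3 / e.
have ly0 : 0 <= l * y ^+ 3 by rewrite mulr_ge0 ?exprn_ge0// ltW.
have ce0 : 0 <= o3 / e by rewrite divr_ge0// ltW.
have s0 : 0 <= s by rewrite addr_ge0.
have dc0 : 0 <= defect_cst by rewrite !mulr_ge0// addr_ge0// sqr_ge0.
have k1 : kap <= kappa0 by exact: kappa_le.
have cs : o3 / e <= s by rewrite lerDr.
have e1 : e <= 1 by rewrite el exprn_ile1// ltW.
have c1 : o3 <= s by rewrite (le_trans _ cs)// ler_pdivlMr// ler_piMr.
have ks : l * y ^+ 3 * kap <= kappa0 * s.
  rewrite mulrC; apply: ler_pM => //; first by rewrite lerDl.
have yb : y * o2 <= (kappa0 + 1) * s.
  apply: (le_trans young1).
  rewrite mulrDl mul1r lerD//.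
    apply: le_trans ks; rewrite ler_wpM2r// ler_wpM2r ?exprn_ge0//.
    by rewrite expr2 ler_piMr// ltW.
  apply: le_trans cs; rewrite ler_wpM2l// lef_pV2 ?posrE//.
  by rewrite el expr2 ler_piMr// ltW.
have yya : y ^+ 2 * o1 <= (kappa0 + 1) * s.
  apply: (le_trans young2).
  by rewrite mulrDl mul1r lerD// -el.
have ab : o1 * o2 <= 2 * kappa0 * s.
  by apply: (le_trans o12); rewrite ler_wpM2l ?mulr_ge0.
have abe : o1 * o2 / e <= 2 * kappa0 * s.
  apply: (@le_trans _ _ (2 * kappa0 * o3 / e)).
    by rewrite ler_wpM2r ?invr_ge0 ?(ltW e0).
  by rewrite -mulrA ler_wpM2l ?mulr_ge0.
have aaa : o1 ^+ 3 <= 2 * kappa0 ^+ 2 * s.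
  rewrite exprS; apply: (@le_trans _ _ (o1 * (kappa0 * o2))); first by rewrite ler_wpM2l.
  rewrite mulrCA; apply: (@le_trans _ _ (kappa0 * (2 * kappa0 * s))); first by rewrite ler_wpM2l.
  by rewrite le_eqVlt; apply/orP; left; apply/eqP; ring.
have Wy : `|W Y| <= `|U Y| + o1.
  rewrite -{1}(subrK (U Y) (W Y)) (le_trans (ler_normD _ _))// addrC lerD2l.
  exact: Wn.
(* entropy flux *)
have t1 : `|Q a (U Y) - Q a (W Y)| <= C * (8 * (kappa0 + 1) + 4 * kappa0 ^+ 2) * s.
  apply: (le_trans (es_lipQ ES a OU OW)).
  have h1 : (1 + `|U Y| + `|W Y|) ^+ 2 <= (2 * y + o1) ^+ 2.
    rewrite ler_sqr ?nnegrE ?addr_ge0 ?mulr_ge0//.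
    by have := normr_ge0 (U Y); rewrite /y; lra.
  have h2 : `|U Y - W Y| <= o1 by rewrite distrC Wn.
  rewrite -[leLHS]mulrA -[leRHS]mulrA ler_wpM2l//.
  apply: (@le_trans _ _ ((2 * y + o1) ^+ 2 * o1)).
    by apply: ler_pM => //; exact: exprn_ge0.
  have h3 : (2 * y + o1) ^+ 2 <= 8 * y ^+ 2 + 2 * o1 ^+ 2.
    by have := sqr_ge0 (2 * y - o1); nra.
  apply: (le_trans (ler_wpM2r a0 h3)).
  have -> : (8 * y ^+ 2 + 2 * o1 ^+ 2) * o1 = 8 * (y ^+ 2 * o1) + 2 * o1 ^+ 3 by ring.
  lra.
(* corrector *)
have t2 : `|\sum_i B i (W Y) * defect a i Y| <=
    n%:R * C * defect_cst * (kappa0 + 1 + 2 * kappa0) * s.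
  apply: (le_trans (ler_norm_sum _ _ _)).
  apply: (@le_trans _ _ (\sum_(i < n) (C * (y + o1)) * (defect_cst * o2))).
    apply: ler_sum => i _; rewrite normrM; apply: ler_pM => //.
    apply: (le_trans (es_growB ES i OW)); rewrite ler_wpM2l//.
    by rewrite /y; lra.
  rewrite sumr_const card_ord -[leLHS]mulr_natl.
  have -> : n%:R * (C * (y + o1) * (defect_cst * o2)) =
    n%:R * C * defect_cst * (y * o2 + o1 * o2) by ring.
  have nC : 0 <= n%:R * C * defect_cst by apply: mulr_ge0 => //; exact: mulr_ge0.
  by rewrite -[leRHS]mulrA ler_wpM2l// [leRHS]mulrDl lerD.
(* variation of B(W) *)
have t3 : `|\sum_i dBW a i Y * defect a i Y| <=
    n%:R * (n%:R * C * (4 * K)) * defect_cst * (2 * kappa0) * s.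
  apply: (le_trans (ler_norm_sum _ _ _)).
  apply: (@le_trans _ _ (\sum_(i < n) (n%:R * C * (drho_bound k e * o1)) * (defect_cst * o2))).
    apply: ler_sum => i _; rewrite normrM; apply: ler_pM => //.
    apply: (@le_trans _ _ (n%:R * C * `|dW a Y|)).
      by apply: dotp_le_coord => j; exact: (es_boundDB ES).
    by rewrite ler_wpM2l ?mulr_ge0// dWn.
  rewrite sumr_const card_ord -[leLHS]mulr_natl drho_boundE.
  have -> : n%:R * (n%:R * C * (4 * K / e * o1) * (defect_cst * o2)) =
    n%:R * (n%:R * C * (4 * K)) * defect_cst * (o1 * o2 / e) by ring.
  have nC : 0 <= n%:R * (n%:R * C * (4 * K)) * defect_cst.
    by apply: mulr_ge0 => //; apply: mulr_ge0 => //; rewrite !mulr_ge0.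
  by rewrite -[leRHS]mulrA ler_wpM2l.
have -> : dphi a Y * (Q a (U Y) - corrected a Y) - phi Y * \sum_i dBW a i Y * defect a i Y =
  dphi a Y * (Q a (U Y) - Q a (W Y)) + - (dphi a Y * \sum_i B i (W Y) * defect a i Y) +
  - (phi Y * \sum_i dBW a i Y * defect a i Y).
  by rewrite /corrected; ring.
have -> : error_cst * s =
  C1 * (C * (8 * (kappa0 + 1) + 4 * kappa0 ^+ 2) * s) +
  C1 * (n%:R * C * defect_cst * (kappa0 + 1 + 2 * kappa0) * s) +
  C1 * (n%:R * (n%:R * C * (4 * K)) * defect_cst * (2 * kappa0) * s).
  by rewrite /error_cst; ring.
rewrite (le_trans (ler_normD _ _))// lerD//.
  rewrite (le_trans (ler_normD _ _))// lerD// ?normrN normrM.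
    by apply: ler_pM => //; exact: dphi_bound.
  by apply: ler_pM => //; exact: dphi_bound.
by rewrite normrN normrM; apply: ler_pM => //; exact: phi_bound.
Qed.

End pointwise.

Definition oscillation (Y : ST) : R := osc Y 3.

Let N0 : 0 < rho_mass k e. Proof. exact: rho_mass_gt0. Qed.

Lemma measurable_near_integral :
  measurable_fun (P : set mST) (fun Y =>
    Rintegral mu (near_part Y) (fun X => `|U X - U Y| ^+ 3)).
Proof.
pose U' : mST -> 'rV[R]_n := U \_ D.
have mU' : measurable_fun setT U' by apply/(measurable_restrictT U mD).
pose A : set (mST * mST) := [set p | sq ((p.1 : ST) - p.2) < e ^+ 2].
have mA : measurable A.
  rewrite [A](_ : _ = setT `&` (fun p : mST * mST => sq ((p.1 : ST) - p.2)) @^-1` `]-oo, e ^+ 2[).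
    by apply: measurable_diff_sq; [exact: measurableT|exact: measurable_itv].
  by rewrite setTI; apply/seteqP; split => p /=; rewrite in_itv.
pose F (p : mST * mST) : R := \1_A p * (\1_D p.2 * `|U' p.2 - U' p.1| ^+ 3).
have m1 : measurable_fun setT ((\1_D : mST -> R)) by exact: measurable_indic.
have mF : measurable_fun setT F.
  apply: measurable_funM; first exact: measurable_indic.
  apply: measurable_funM.
    exact: (measurableT_comp m1 measurable_snd).
  apply: measurable_funX; apply: measurable_norm_comp; first exact: measurableT.
  apply: measurable_fun_rV => l; under eq_fun do rewrite mxE [X in _ + X]mxE.
  apply: measurable_funB; apply: (measurableT_comp (measurable_coord l)).
    exact: (measurableT_comp mU' measurable_snd).
  exact: (measurableT_comp mU' measurable_fst).
have mI : measurable_fun setT (fun Y : mST => fine (\int[mu]_X (EFin (F (Y, X))))%E).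
  apply: (measurableT_comp (f := fine)); first exact: fine_measurable.
  apply: (measurable_fun_fubini_tonelli_F (m2 := mu) (EFin \o F)).
    exact/measurable_EFinP.
  by move=> p; rewrite lee_fin /F mulr_ge0// ?mulr_ge0// ?exprn_ge0// indicE.
apply: eq_measurable_fun (measurable_funTS mI) => Y /set_mem PY.
have DY := PD PY.
rewrite -/(Rintegral mu setT (fun X => F (Y, X))) [RHS]Rintegral_mkcond.
apply: eq_RintegralS => X _; rewrite /F /patch /= !indicE.
have -> : (X \in near_part Y) = ((Y, X) \in A) && (X \in D).
  apply/idP/andP; rewrite !inE => -[? ?]; split => //; rewrite inE//.
rewrite /U' /patch (mem_set DY).
by case: (_ \in A); case: (X \in D); rewrite ?mul0r ?mul1r.
Qed.

Lemma oscillation_le Y : P Y -> oscillation Y <=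
  (rho_mass k e)^-1 * Rintegral mu D (fun X => (1 + `|U X|) ^+ 3) * (1 + `|U Y|) ^+ 3.
Proof.
move=> PY; rewrite /oscillation oscE -mulrA ler_wpM2l ?invr_ge0 ?(ltW N0)//.
rewrite mulrC -RintegralZl; [|exact: mD|exact: rint_cubic_weight].
have i1 : rint mu D (fun X => (1 + `|U Y|) ^+ 3 * (1 + `|U X|) ^+ 3).
  by apply: rintZl; [exact: mD|exact: rint_cubic_weight].
have mE := measurable_near_part Y.
have ED : near_part Y `<=` D by move=> X [].
apply: (@le_trans _ _ (Rintegral mu (near_part Y) (fun X => (1 + `|U Y|) ^+ 3 * (1 + `|U X|) ^+ 3))).
  have le X : `|U X - U Y| ^+ 3 <= (1 + `|U Y|) ^+ 3 * (1 + `|U X|) ^+ 3.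
    rewrite -exprMn lerXn2r ?nnegrE ?mulr_ge0 ?addr_ge0//.
    rewrite (le_trans (ler_normB _ _))//.
    have := mulr_ge0 (normr_ge0 (U X)) (normr_ge0 (U Y)); lra.
  rewrite -[leLHS]ger0_norm; last by apply: Rintegral_ge0 => X _; rewrite exprn_ge0.
  apply: norm_Rintegral_le; [exact: mE| |exact: (rintS mD mE ED i1)|].
    apply: (measurable_funS mD ED); apply: measurable_funX.
    apply: (@measurable_comp_rel _ _ _ _ setT (fun v => `|v - U Y|)) => //.
    move=> x _ eps eps0; exists eps => // y _ h.
    by rewrite (le_lt_trans (ler_dist_dist _ _))// opprB addrA subrK.
  by move=> X _; rewrite ger0_norm ?exprn_ge0.
rewrite Rintegral_mkcond [leRHS]Rintegral_mkcond.
apply: le_Rintegral => //.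
- by apply: rint_patch; [exact: mE|exact: (rintS mD mE ED i1)].
- by apply: rint_patch; [exact: mD|exact: i1].
move=> X _; rewrite /patch; case: ifPn => [/set_mem/ED/mem_set ->//|_].
by case: ifP => // _; rewrite mulr_ge0// exprn_ge0// addr_ge0.
Qed.

Lemma rint_oscillation : rint mu P oscillation.
Proof.
apply: (@rint_le _ mST R mu _ _ (fun Y => (rho_mass k e)^-1 *
   Rintegral mu D (fun X => (1 + `|U X|) ^+ 3) * (1 + `|U Y|) ^+ 3)).
- exact: mP.
- rewrite (_ : oscillation = fun Y => (rho_mass k e)^-1 *
    Rintegral mu (near_part Y) (fun X => `|U X - U Y| ^+ 3)).
    by apply: measurable_funM; [exact: measurable_cst|exact: measurable_near_integral].
  by apply/funext => Y; rewrite /oscillation oscE.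
- apply: rintZl; first exact: mP.
  by apply: (rintS mD mP PD); exact: rint_cubic_weight.
move=> Y PY; rewrite ger0_norm; first exact: oscillation_le.
by rewrite /oscillation oscE mulr_ge0 ?invr_ge0 ?(ltW N0)// Rintegral_ge0// => X _; rewrite exprn_ge0.
Qed.

Let i_dphiQ a : rint mu P (fun Y => dphi a Y * Q a (U Y)).
Proof.
apply: (@rintMb _ mST R mu _ _ _ C1).
- exact: mP.
- exact: measurable_funTS.
- by move=> X _; exact: dphi_bound.
- by apply: (rintS mD mP PD); exact: rint_Q.
Qed.

Let i_dphiH a : rint mu P (fun Y => dphi a Y * corrected a Y).
Proof.
have [M M0 [hM _]] := bounded_lip_corrected a.
apply: (@rintMb _ mST R mu _ _ _ C1).
- exact: mP.
- exact: measurable_funTS.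
- by move=> X _; exact: dphi_bound.
- by apply: (@rint_bounded _ mST R mu _ _ M); [exact: mP|exact: Poo|exact: measurable_corrected|exact: hM].
Qed.

Let i_dB a : rint mu P (fun Y => phi Y * \sum_i dBW a i Y * defect a i Y).
Proof.
apply: (@rintMb _ mST R mu _ _ _ C1).
- exact: mP.
- exact: measurable_funTS.
- by move=> X _; exact: phi_bound.
apply: rint_sum; first exact: mP.
move=> i.
have [M M0 [hM _]] : bounded_lip P e (defect a i).
  apply: bounded_lipD; first by apply: bounded_lip_moll; exact: rint_G.
  apply: bounded_lipN.
  apply: (@bounded_lip_comp _ _ _ _ _ O (G a i) W C C MW LW 1 2) => //.
  - exact: (es_growG ES).
  - exact: (es_lipG ES).
  - exact: W_mem.
  - by move=> X _; exact: W_bound.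
  - by move=> X Z _ _; exact: W_lip.
apply: (@rintMb _ mST R mu _ _ _
   (n%:R * C * (\sum_(l < n) drho_bound k e * `|evec a| * moll_cst e D (fun X => U X 0 l)))).
- exact: mP.
- exact: measurable_dBW.
- move=> Y PY; apply: (@le_trans _ _ (n%:R * C * `|dW a Y|)).
    by apply: dotp_le_coord => l; apply: (es_boundDB ES); exact: W_mem.
  have c0 l : 0 <= drho_bound k e * `|evec a| * moll_cst e D (fun X => U X 0 l).
    apply: mulr_ge0; last exact: moll_cst_ge0.
    by apply: mulr_ge0 => //; exact: drho_bound_ge0.
  rewrite ler_wpM2l ?mulr_ge0//; apply/rV_norm_leP; first by apply: sumr_ge0.
  move=> l; rewrite dWE (le_trans (dmoll_bound e0 mD _ _ (rint_U l)))//.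
  by rewrite (bigD1 l)//= lerDl; apply: sumr_ge0.
- by apply: (@rint_bounded _ mST R mu _ _ M); [exact: mP|exact: Poo|exact: measurable_defect|exact: hM].
Qed.

Let i_Bd a : rint mu P (fun Y => phi Y *
     \sum_i B i (W Y) * dmoll e D (fun X => G a i (U X)) (evec a) Y).
Proof.
apply: (@eq_rint _ mST R mu _ (fun Y => \sum_i
   dmoll e D (fun X => G a i (U X)) (evec a) Y * (phi Y * B i (W Y)))).
- exact: mP.
- by move=> Y _; rewrite mulr_sumr; apply: eq_bigr => i _; ring.
apply: rint_sum; first exact: mP.
move=> i; apply: (@rintMb _ mST R mu _ _ _ (drho_bound k e * `|evec a| * moll_cst e D (fun X => G a i (U X)))).
- exact: mP.
- apply: measurable_funTS; apply: continuous_measurable_spacetime; first exact: openT.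
  by move=> X _; apply: dmoll_continuous; [exact: e0|exact: mD|exact: rint_G].
- by move=> X _; apply: dmoll_bound; [exact: e0|exact: mD|exact: rint_G].
- exact: rint_phiB.
Qed.

(** Sum of the tested weak formulation and of the integration by parts of the
    corrected fluxes; what is left is bounded pointwise by error_near. *)
Lemma entropy_defect_le (l : R) : 0 < l -> l <= 1 -> e = l ^+ 2 ->
  `|\sum_a Rintegral mu P (fun Y => dphi a Y * Q a (U Y))| <=
  #|{: option 'I_k}|%:R * (error_cst *
    (l * Rintegral mu D (fun X => (1 + `|U X|) ^+ 3) + e^-1 * Rintegral mu P oscillation)).
Proof.
move=> l0 l1 el.
have i_err a : rint mu P (fun Y => dphi a Y * (Q a (U Y) - corrected a Y) -
    phi Y * \sum_i dBW a i Y * defect a i Y).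
  apply: (@eq_rint _ mST R mu _ (fun Y => (dphi a Y * Q a (U Y) - dphi a Y * corrected a Y) -
    phi Y * \sum_i dBW a i Y * defect a i Y)).
  - exact: mP.
  - by move=> Y _; rewrite mulrBr.
  by apply: rintB; [exact: mP|apply: rintB; [exact: mP|exact: i_dphiQ|exact: i_dphiH]|exact: i_dB].
have -> : \sum_a Rintegral mu P (fun Y => dphi a Y * Q a (U Y)) =
  \sum_a Rintegral mu P (fun Y => dphi a Y * (Q a (U Y) - corrected a Y) -
    phi Y * \sum_i dBW a i Y * defect a i Y).
  rewrite -[LHS]addr0 -[X in _ + X = _]tested_equation -big_split /=.
  apply: eq_bigr => a _.
  have i3 : rint mu P (fun Y => phi Y * dcorrected a Y).
    apply: (@eq_rint _ mST R mu _ (fun Y => phi Y * (\sum_i dBW a i Y * defect a i Y) +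
      phi Y * \sum_i B i (W Y) * dmoll e D (fun X => G a i (U X)) (evec a) Y)).
    - exact: mP.
    - by move=> Y _; rewrite -mulrDr.
    by apply: rintD; [exact: mP|exact: i_dB|exact: i_Bd].
  have h := integrated_by_parts a.
  rewrite RintegralD in h; [|exact: mP|exact: i_dphiH|exact: i3].
  have h3 : Rintegral mu P (fun Y => phi Y * dcorrected a Y) =
     Rintegral mu P (fun Y => phi Y * (\sum_i dBW a i Y * defect a i Y)) +
     Rintegral mu P (fun Y => phi Y * \sum_i B i (W Y) * dmoll e D (fun X => G a i (U X)) (evec a) Y).
    rewrite -RintegralD; [|exact: mP|exact: i_dB|exact: i_Bd].
    by apply: eq_RintegralS => Y _; rewrite -mulrDr.
  rewrite h3 in h.
  rewrite (@eq_RintegralS _ mST R mu _ (fun Y => dphi a Y * (Q a (U Y) - corrected a Y) -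
      phi Y * \sum_i dBW a i Y * defect a i Y)
    (fun Y => (dphi a Y * Q a (U Y) - dphi a Y * corrected a Y) -
      phi Y * \sum_i dBW a i Y * defect a i Y)); last by move=> Y _; rewrite mulrBr.
  rewrite RintegralB; [|exact: mP|by apply: rintB; [exact: mP|exact: i_dphiQ|exact: i_dphiH]|exact: i_dB].
  rewrite RintegralB; [|exact: mP|exact: i_dphiQ|exact: i_dphiH].
  move: h; move: (Rintegral mu P (fun Y => dphi a Y * corrected a Y)) => z1.
  move: (Rintegral mu P (fun Y => phi Y * (\sum_i dBW a i Y * defect a i Y))) => z2.
  move: (Rintegral mu P _) => z3; move: (Rintegral mu P _) => z4; lra.
have i_y3 : rint mu P (fun Y => (1 + `|U Y|) ^+ 3).
  by apply: (rintS mD mP PD); exact: rint_cubic_weight.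
have i_bd : rint mu P (fun Y => error_cst * (l * (1 + `|U Y|) ^+ 3 + e^-1 * oscillation Y)).
  apply: rintZl; first exact: mP.
  by apply: rintD; [exact: mP|apply: rintZl; [exact: mP|exact: i_y3]
    |apply: rintZl; [exact: mP|exact: rint_oscillation]].
have ec0 : 0 <= error_cst.
  have k0 : 0 <= kappa_bound by rewrite mulr_ge0// exprn_ge0// mulr_ge0.
  have d0 : 0 <= defect_cst by apply: mulr_ge0; [exact: mulr_ge0|rewrite addr_ge0// sqr_ge0].
  apply: addr_ge0; [apply: addr_ge0|]; apply: mulr_ge0 => //.
  - by apply: mulr_ge0 => //; rewrite addr_ge0// mulr_ge0// ?addr_ge0// sqr_ge0.
  - apply: mulr_ge0; last by rewrite !addr_ge0// mulr_ge0.
    by apply: mulr_ge0 => //; apply: mulr_ge0.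
  - apply: mulr_ge0; last by rewrite mulr_ge0.
    by apply: mulr_ge0 => //; rewrite !mulr_ge0.
rewrite (le_trans (ler_norm_sum _ _ _))//.
apply: (@le_trans _ _ (\sum_(a : option 'I_k) Rintegral mu P
   (fun Y => error_cst * (l * (1 + `|U Y|) ^+ 3 + e^-1 * oscillation Y)))).
  apply: ler_sum => a _; apply: norm_Rintegral_le.
  - exact: mP.
  - exact: rint_measurable (i_err a).
  - exact: i_bd.
  move=> Y PY; have := error_near PY l0 l1 el a.
  by rewrite [osc Y 3 / e]mulrC.
rewrite sumr_const -[leLHS]mulr_natl ler_wpM2l//.
rewrite RintegralZl; [|exact: mP|]; last first.
  by apply: rintD; [exact: mP|apply: rintZl; [exact: mP|exact: i_y3]
    |apply: rintZl; [exact: mP|exact: rint_oscillation]].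
rewrite ler_wpM2l//.
rewrite RintegralD; [|exact: mP|apply: rintZl; [exact: mP|exact: i_y3]
    |apply: rintZl; [exact: mP|exact: rint_oscillation]].
rewrite RintegralZl; [|exact: mP|exact: i_y3].
rewrite RintegralZl; [|exact: mP|exact: rint_oscillation].
rewrite lerD2r ler_wpM2l ?(ltW l0)//.
rewrite Rintegral_mkcond [leRHS]Rintegral_mkcond.
apply: le_Rintegral => //.
- by apply: rint_patch; [exact: mP|exact: i_y3].
- by apply: rint_patch; [exact: mD|exact: rint_cubic_weight].
move=> X _; rewrite /patch; case: ifPn => [/set_mem/PD/mem_set ->//|_].
by case: ifP => // _; rewrite exprn_ge0// addr_ge0.
Qed.

End core.

(** * The local entropy balance *)

Section nonmeasurable.
Context d (T : measurableType d) (R : realType) (mu : {measure set T -> \bar R}).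

(** The integral of a nonnegative function is a supremum over the simple
    functions below it, so that it is monotone even when the larger function is
    not known to be measurable. *)
Lemma le_integral_sub (D1 D2 : set T) (f g : T -> \bar R) :
  (forall x, D1 x -> 0 <= f x)%E -> (forall x, D2 x -> 0 <= g x)%E ->
  (forall x, D1 x -> f x != 0 -> D2 x /\ f x <= g x)%E ->
  (\int[mu]_(x in D1) f x <= \int[mu]_(x in D2) g x)%E.
Proof.
move=> f0 g0 fg; rewrite !ge0_integralE//.
apply: le_ereal_sup => _ [h /= hf <-]; exists h => //= x.
apply: (le_trans (hf x)); rewrite /patch.
have p0 : (0 <= if x \in D2 then g x else 0)%E by case: ifPn => // /set_mem; exact: g0.
case: ifPn => // /set_mem D1x.
have [->|/(fg x D1x)[D2x fgx]] := eqVneq (f x) 0%E; first exact: p0.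
by rewrite (mem_set D2x).
Qed.

(** A vanishing lower limit provides arbitrarily good scales. *)
Lemma limf_einf0_lt (f : R -> \bar R) (c d' : R) :
  (limf_einf f 0^'+ = 0)%E -> 0 < c -> 0 < d' ->
  exists e, [/\ 0 < e, e < d' & (f e < c%:E)%E].
Proof.
move=> f0 c0 d0.
have A0 : 0^'+ [set e : R | 0 < e < d'].
  by near=> e => /=; apply/andP; split.
have : (ereal_inf (f @` [set e : R | (0 < e < d')%R]) < c%:E)%E.
  apply: (@le_lt_trans _ _ 0%E); last by rewrite lte_fin.
  by rewrite -f0 limf_einfE; apply: ereal_sup_ubound; exists [set e : R | 0 < e < d'].
move=> /ereal_inf_lt[_ [e /= /andP[e0 ed] <-] fe].
by exists e.
Unshelve. all: by end_near. Qed.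
End nonmeasurable.

Section cubic.
Context {R : realType} {k n : nat}.
Notation ST := ('rV[R]_k * R)%type.
Notation mST := ('rV[R]_k * measurableTypeR R)%type.
Notation mu := (@spacetime_lebesgue R k).
Variables (U : ST -> 'rV[R]_n) (D P : set ST) (e : R).
Hypotheses (mD : measurable (D : set mST)) (PD : P `<=` D) (mP : measurable (P : set mST))
  (e0 : 0 < e)
  (iU : forall Y, P Y -> rint mu (near_part D e Y) (fun X => `|U X - U Y| ^+ 3))
  (iosc : rint mu P (oscillation U D e)).

(** The kernel average is dominated by the plain average over the ball, the two
    normalisations being comparable.  Should the ball meet D in a null set, both
    averages vanish, whatever the junk value of the inverse of 0. *)
Lemma oscillation_le_average Y : P Y ->
  (((kappa_bound (k := k))^-1 * oscillation U D e Y)%:E <=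
    (fine (mu (spacetime_ball Y e `&` D)))^-1%:E *
     \int[mu]_(X in spacetime_ball Y e `&` D) (enorm (U Y - U X) ^+ 3)%:E)%E.
Proof.
move=> PY.
have -> : spacetime_ball Y e `&` D = near_part D e Y.
  rewrite /near_part setIC; congr (_ `&` _).
  by apply/seteqP; split => X /=; rewrite spacetime_ballP.
have mE := measurable_near_part mD e Y.
have J_le : ((Rintegral mu (near_part D e Y) (fun X => `|U X - U Y| ^+ 3))%:E <=
    \int[mu]_(X in near_part D e Y) (enorm (U Y - U X) ^+ 3)%:E)%E.
  rewrite -EFin_Rintegral; [|exact: mE|exact: iU].
  apply: le_integral_sub => [X _|X _|X EX _]; rewrite ?lee_fin ?exprn_ge0 ?enorm_ge0//.
  by split=> //; rewrite distrC lerXn2r ?nnegrE ?enorm_ge0// norm_le_enorm.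
have J0 : 0 <= Rintegral mu (near_part D e Y) (fun X => `|U X - U Y| ^+ 3).
  by apply: Rintegral_ge0 => X _; rewrite exprn_ge0.
have kap := kappa_le mD e0 Y.
have k0 : 0 < kappa_bound (R := R) (k := k) by rewrite mulr_gt0// exprn_gt0// mulr_gt0.
rewrite /oscillation oscE.
have [m0|m0] := eqVneq (fine (mu (near_part D e Y))) 0.
  rewrite m0 invr0 mul0e.
  suff -> : Rintegral mu (near_part D e Y) (fun X => `|U X - U Y| ^+ 3) = 0 by rewrite !mulr0.
  have mu0 : mu (near_part D e Y : set mST) = 0%E.
    have mfin : mu (near_part D e Y : set mST) \is a fin_num.
      rewrite ge0_fin_numE//.
      exact: (near_part_finite mD e0 Y).
    by rewrite -(fineK mfin) m0.
  rewrite /Rintegral (null_set_integral mE _ mu0)//.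
  by apply/measurable_EFinP; exact: rint_measurable (iU PY).
apply: (@le_trans _ _ ((fine (mu (near_part D e Y)))^-1%:E *
   (Rintegral mu (near_part D e Y) (fun X => `|U X - U Y| ^+ 3))%:E)%E); last first.
  by apply: lee_wpmul2l => //; rewrite lee_fin invr_ge0 fine_ge0.
rewrite -EFinM lee_fin mulrA ler_wpM2r//.
have m1 : 0 < fine (mu (near_part D e Y)) by rewrite lt_neqAle eq_sym m0 fine_ge0.
by rewrite ler_pdivrMl// -ler_pdivrMr ?invr_gt0// invrK.
Qed.

Lemma oscillation_le_modulus :
  ((e^-1 * ((kappa_bound (k := k))^-1 * Rintegral mu P (oscillation U D e)))%:E <=
   cubic_modulus D U e)%E.
Proof.
have k0 : 0 < kappa_bound (R := R) (k := k) by rewrite mulr_gt0// exprn_gt0// mulr_gt0.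
rewrite /cubic_modulus EFinM; apply: lee_wpmul2l; first by rewrite lee_fin invr_ge0 ltW.
rewrite -RintegralZl; [|exact: mP|exact: iosc].
rewrite -EFin_Rintegral; [|exact: mP|by apply: rintZl; [exact: mP|exact: iosc]].
apply: le_integral_sub => // Y hY.
- rewrite lee_fin mulr_ge0 ?invr_ge0 ?(ltW k0)// /oscillation oscE mulr_ge0//.
    by rewrite invr_ge0 ltW// rho_mass_gt0.
  by apply: Rintegral_ge0 => X _; rewrite exprn_ge0.
- apply: mule_ge0; first by rewrite lee_fin invr_ge0 fine_ge0.
  by apply: integral_ge0 => X _; rewrite lee_fin exprn_ge0 ?enorm_ge0.
- by move=> _; split; [exact: PD|exact: oscillation_le_average].
Qed.
End cubic.

Section balance.
Context {R : realType} {k n : nat}.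
Notation ST := ('rV[R]_k * R)%type.
Notation mST := ('rV[R]_k * measurableTypeR R)%type.
Notation mu := (@spacetime_lebesgue R k).
Variables (O : set 'rV[R]_n) (G : option 'I_k -> 'I_n -> 'rV[R]_n -> R)
  (DG : option 'I_k -> 'I_n -> 'rV[R]_n -> 'rV[R]_n)
  (Q : option 'I_k -> 'rV[R]_n -> R) (B : 'I_n -> 'rV[R]_n -> R)
  (DB : 'I_n -> 'rV[R]_n -> 'rV[R]_n) (C : R).
Hypotheses (cO : convex_set O) (ES : entropy_system O G DG Q B DB C).
Variables (U : ST -> 'rV[R]_n) (D : set ST).
Hypotheses (mD : measurable (D : set mST)) (Doo : (mu (D : set mST) < +oo)%E)
  (mU : measurable_fun (D : set mST) U) (UO : forall X, D X -> O (U X))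
  (U3 : rint mu D (fun X => `|U X| ^+ 3)).
Variables (P : set ST) (r0 : R) (phi : ST -> R) (dphi : option 'I_k -> ST -> R) (C1 : R).
Hypotheses (r00 : 0 < r0) (oP : open P) (PD : P `<=` D)
  (Pdeep : forall Y X, P Y -> `|Y - X| < r0 -> D X)
  (phi_supp : forall X Y, phi X != 0 -> `|X - Y| < r0 -> P Y)
  (phi_bound : forall X, `|phi X| <= C1)
  (phi_lip : forall X H, `|phi (X + H) - phi X| <= C1 * `|H|)
  (dphi_meas : forall a, measurable_fun setT (dphi a : mST -> R))
  (dphi_bound : forall a X, `|dphi a X| <= C1)
  (dphi_cvg : {ae mu, forall X, forall a (t : nat -> R), (forall m, 0 < t m) ->
     t @ \oo --> +oo -> seq_deriv t (evec a) X phi (dphi a X)}).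
Variables (Dom Kc : set ST).
Hypotheses (cKc : compact Kc) (KcDom : Kc `<=` Dom) (PKc : P `<=` Kc) (DDom : D `<=` Dom)
  (weak : forall psi : ST -> 'rV[R]_n, C1c Dom psi ->
    Rintegral mu Dom (fun X => \sum_a \sum_i ('D_(evec a) psi X) 0 i * G a i (U X)) = 0)
  (modulus0 : limf_einf (cubic_modulus D U) 0^'+ = 0%E).

(** The defect at scale e is controlled by the square root of e plus the cubic
    modulus at scale e, and both are small along suitable scales. *)
Lemma local_entropy_balance :
  \sum_a Rintegral mu P (fun Y => dphi a Y * Q a (U Y)) = 0.
Proof.
apply/normr0_eq0/le_anti; rewrite normr_ge0 andbT.
have mP : measurable (P : set mST) by exact: measurable_spacetime_open.
set S := `|_|.
pose c := `|#|{: option 'I_k}|%:R * (error_cst (k := k) (n := n) C C1)|.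
pose I3 := Rintegral mu D (fun X => (1 + `|U X|) ^+ 3).
pose kap : R := kappa_bound (k := k).
have I0 : 0 <= I3 by apply: Rintegral_ge0 => X _; rewrite exprn_ge0// addr_ge0.
have k0 : 0 < kap by rewrite /kap mulr_gt0// exprn_gt0// mulr_gt0.
have main l m : 0 < l -> l <= 1 -> l ^+ 2 < r0 -> (cubic_modulus D U (l ^+ 2) < m%:E)%E ->
    S <= c * (l * I3 + kap * m).
  move=> l0 l1 lr hm; have e0 : 0 < l ^+ 2 by rewrite exprn_gt0.
  apply: (le_trans (entropy_defect_le cO ES mD Doo mU UO U3 oP PD Pdeep phi_supp
    phi_bound phi_lip dphi_meas dphi_bound dphi_cvg e0 lr cKc KcDom PKc DDom weak l0 l1 erefl)).
  have iosc : rint mu P (oscillation U D (l ^+ 2)).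
    by apply: rint_oscillation; [exact: mD|exact: Doo|exact: mU|exact: U3|exact: oP|exact: PD|exact: e0].
  have ih Y : P Y -> rint mu (near_part D (l ^+ 2) Y) (fun X => `|U X - U Y| ^+ 3).
    by move=> PY; apply: rint_near_cube.
  have := le_lt_trans (oscillation_le_modulus mD PD mP e0 ih iosc) hm.
  rewrite lte_fin -/kap => h.
  have o0 : 0 <= Rintegral mu P (oscillation U D (l ^+ 2)).
    apply: Rintegral_ge0 => Y _; rewrite /oscillation oscE mulr_ge0//.
      by rewrite invr_ge0 ltW// rho_mass_gt0.
    by apply: Rintegral_ge0 => X _; rewrite exprn_ge0.
  move: h o0; rewrite -/I3; move: (Rintegral mu P _) => o h o0.
  have h2 : (l ^+ 2)^-1 * o <= kap * m.
    rewrite -ler_pdivrMl// ltW//; apply: le_lt_trans h; by rewrite mulrCA.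
  rewrite mulrA; apply: (@le_trans _ _ (c * (l * I3 + (l ^+ 2)^-1 * o))).
    rewrite ler_wpM2r ?ler_norm// addr_ge0// mulr_ge0//; first exact: ltW.
    by rewrite invr_ge0 ltW.
  by rewrite ler_wpM2l ?normr_ge0// lerD2l.
apply/ler_addgt0Pr => d d0; rewrite add0r.
have c0 : 0 <= c by exact: normr_ge0.
pose z := d / (c * (I3 + kap) + 1).
have w0 : 0 < c * (I3 + kap) + 1.
  by rewrite ltr_wpDl// mulr_ge0// addr_ge0// ltW.
have z0 : 0 < z by rewrite divr_gt0.
pose z1 := Num.min 1 (Num.min z r0).
have z10 : 0 < z1 by rewrite !lt_min ltr01 z0 r00.
have [e [e0 ez he]] := limf_einf0_lt modulus0 z0 (mulr_gt0 z10 z10).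
have s0 : 0 < Num.sqrt e by rewrite sqrtr_gt0.
have se : Num.sqrt e ^+ 2 = e by rewrite sqr_sqrtr// ltW.
have sz : Num.sqrt e < z1.
  rewrite ltNge; apply/negP => h; move: ez; rewrite -se expr2 ltNge => /negP; apply.
  by apply: ler_pM => //; exact: ltW.
have [z1a z1b z1c] : [/\ z1 <= 1, z1 <= z & z1 <= r0].
  by rewrite /z1; split; rewrite ?ge_min ?lexx ?orbT.
apply: (le_trans (main (Num.sqrt e) z s0 _ _ _)).
- exact: le_trans (ltW sz) z1a.
- rewrite se (lt_le_trans ez)// (le_trans _ z1c)// ler_piMl//; exact: ltW.
- by rewrite se.
apply: (@le_trans _ _ (c * (z * I3 + kap * z))).
  by rewrite ler_wpM2l// lerD2r ler_wpM2r// (le_trans (ltW sz)).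
have -> : c * (z * I3 + kap * z) = z * (c * (I3 + kap)) by ring.
rewrite /z -mulrA ler_piMr ?(ltW d0)// ler_pdivrMl// mulr1 lerDl ler01//.
Qed.
End balance.

(** * Bounds on the nonlinearities *)

Lemma common_bound {R : realType} (I : finType) (Pr : I -> R -> Prop) :
  (forall i c c', c <= c' -> Pr i c -> Pr i c') -> (forall i, exists c, Pr i c) ->
  exists2 c, 0 <= c & forall i, Pr i c.
Proof.
move=> mono /choice[f hf]; exists (\sum_i `|f i|) => [|i]; first exact: sumr_ge0.
apply: mono (hf i); rewrite (le_trans (ler_norm _))// (bigD1 i)//= lerDl.
exact: sumr_ge0.
Qed.

Section smooth_bounds.
Context {R : realType} {n : nat}.
Variables (O : set 'rV[R]_n) (V0 : 'rV[R]_n).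
Hypotheses (cO : convex_set O) (OV0 : O V0).
Let OcO : O `<=` closure O. Proof. exact: subset_closure. Qed.

Definition quadratic_bounds (g : 'rV[R]_n -> R) (dg : 'rV[R]_n -> 'rV[R]_n) (C : R) : Prop :=
  [/\ forall V, O V -> `|g V| <= C * (1 + `|V|) ^+ 2,
      forall V l, O V -> `|dg V 0 l| <= C * (1 + `|V|),
      forall V W, O V -> O W -> `|g V - g W| <= C * (1 + `|V| + `|W|) * `|V - W| &
      forall V W, O V -> O W ->
        `|g V - g W - dotp (V - W) (dg W)| <= C * `|V - W| ^+ 2].

Lemma quadratic_bounds_le g dg c c' : c <= c' ->
  quadratic_bounds g dg c -> quadratic_bounds g dg c'.
Proof.
move=> cc' [h1 h2 h3 h4]; split=> [V OV|V l OV|V W OV OW|V W OV OW].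
- by rewrite (le_trans (h1 V OV))// ler_wpM2r// exprn_ge0// addr_ge0.
- by rewrite (le_trans (h2 V l OV))// ler_wpM2r// addr_ge0.
- by rewrite (le_trans (h3 V W OV OW))// !ler_wpM2r// !addr_ge0.
- by rewrite (le_trans (h4 V W OV OW))// ler_wpM2r// exprn_ge0.
Qed.

(** Bounded second derivatives give linear growth of the gradient and quadratic
    growth of the function on a convex set. *)
Lemma C2_quadratic_bounds g (M : R) : C2_on (closure O) g ->
  (forall V, O V -> forall i j, `|partial (closure O) i (partial (closure O) j g) V| <= M) ->
  exists C, quadratic_bounds g (gradient (closure O) g) C.
Proof.
move=> [[hg _] hpg] hM.
pose dg := gradient (closure O) g.
have gradO V : O V -> is_gradient O g V (dg V).
  by move=> /OcO /hg; exact: is_gradient_sub OcO.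
pose L := n%:R * `|M|.
have L0 : 0 <= L by rewrite mulr_ge0.
have dgL x y l : O x -> O y -> `|dg y 0 l - dg x 0 l| <= L * `|y - x|.
  move=> Ox Oy.
  apply: (@convex_lip _ _ O (partial (closure O) l g)
     (gradient (closure O) (partial (closure O) l g)) `|M|) => //.
    move=> z /OcO Oz; apply: is_gradient_sub OcO _; exact: (hpg l).1.
  by move=> z i Oz; rewrite (le_trans (hM z Oz i l))// ler_norm.
have taylor x y : O x -> O y -> `|g y - g x - dotp (y - x) (dg x)| <= n%:R * L * `|y - x| ^+ 2.
  by apply: convex_taylor => //; exact: dgL.
pose c0 := \sum_l `|dg V0 0 l| + L * (1 + `|V0|).
have c00 : 0 <= c0 by rewrite addr_ge0 ?sumr_ge0// mulr_ge0// addr_ge0.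
have Lc0 : L <= c0.
  apply: (@le_trans _ _ (L * (1 + `|V0|))); first by rewrite ler_peMr// lerDl.
  by rewrite lerDr sumr_ge0.
have dgc V l : O V -> `|dg V 0 l| <= c0 * (1 + `|V|).
  move=> OV; have h1 := dgL V0 V l OV0 OV.
  have h2 : `|dg V 0 l| <= `|dg V0 0 l| + L * (`|V| + `|V0|).
    rewrite -{1}(subrK (dg V0 0 l) (dg V 0 l)) (le_trans (ler_normD _ _))// addrC lerD2l.
    by rewrite (le_trans h1)// ler_wpM2l// ler_normB.
  apply: (le_trans h2).
  have h3 : `|dg V0 0 l| <= \sum_l `|dg V0 0 l| by rewrite (bigD1 l)//= lerDl sumr_ge0.
  move: h3 Lc0 c00 (normr_ge0 (dg V0 0 l)); rewrite /c0; move: (\sum_l _) `|dg V0 0 l| (normr_ge0 V) (normr_ge0 V0).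
  move: `|V| `|V0| L0; clear => v v0 L0 s z v_ge0 v0_ge0 h3 _ _ z_ge0.
  have := mulr_ge0 L0 (mulr_ge0 v_ge0 v0_ge0); have := mulr_ge0 L0 v_ge0.
  have := mulr_ge0 L0 v0_ge0.
  have : 0 <= s by apply: le_trans h3; exact: z_ge0.
  by move=> s0; have := mulr_ge0 s0 v_ge0; nra.
have lip V W : O V -> O W -> `|g V - g W| <= 2 * n%:R * c0 * (1 + `|V| + `|W|) * `|V - W|.
  move=> OV OW; have h1 := taylor W V OW OV.
  have h2 : `|dotp (V - W) (dg W)| <= n%:R * (c0 * (1 + `|W|)) * `|V - W|.
    by apply: dotp_le_coord => l; exact: dgc.
  have h3 : `|g V - g W| <= n%:R * L * `|V - W| ^+ 2 + n%:R * (c0 * (1 + `|W|)) * `|V - W|.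
    rewrite -(subrK (dotp (V - W) (dg W)) (g V - g W)) (le_trans (ler_normD _ _))//.
    by rewrite lerD.
  apply: (le_trans h3); rewrite expr2 mulrA -mulrDl ler_wpM2r//.
  have h4 := ler_normB V W.
  apply: (@le_trans _ _ (n%:R * c0 * (`|V| + `|W|) + n%:R * (c0 * (1 + `|W|)))).
    by rewrite lerD2r ler_pM// ?mulr_ge0// ler_wpM2l.
  have n0 : 0 <= n%:R * c0 by rewrite mulr_ge0.
  have -> : n%:R * c0 * (`|V| + `|W|) + n%:R * (c0 * (1 + `|W|)) =
     (n%:R * c0) * (1 + `|V| + 2 * `|W|) by ring.
  have -> : 2 * n%:R * c0 * (1 + `|V| + `|W|) = (n%:R * c0) * (2 + 2 * `|V| + 2 * `|W|) by ring.
  by rewrite ler_wpM2l//; have := normr_ge0 V; lra.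
pose v0 := `|V0|; have v00 : 0 <= v0 by exact: normr_ge0.
pose S := c0 + 2 * n%:R * c0 + n%:R * L.
have n2 : 0 <= 2 * n%:R * c0 by rewrite !mulr_ge0.
have nL : 0 <= n%:R * L by rewrite mulr_ge0.
have S0 : 0 <= S by apply: addr_ge0 => //; exact: addr_ge0.
have S1 : 2 * n%:R * c0 <= S by rewrite /S -addrA [leRHS]addrCA lerDl addr_ge0.
have S2 : n%:R * L <= S by rewrite /S lerDr addr_ge0.
have S3 : c0 <= S by rewrite /S -addrA lerDl addr_ge0.
have v1 : 1 <= (1 + v0) ^+ 2 by rewrite exprn_ege1 ?lerDl.
have SC : S <= `|g V0| + S * (1 + v0) ^+ 2.
  by rewrite ler_wpDl// ler_peMr.
exists (`|g V0| + S * (1 + v0) ^+ 2).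
split=> [V OV|V l OV|V W OV OW|V W OV OW].
- have h1 := lip V V0 OV OV0.
  have h2 : `|g V| <= `|g V - g V0| + `|g V0| by rewrite -{1}(subrK (g V0) (g V)) ler_normD.
  apply: (le_trans h2); rewrite addrC mulrDl lerD//.
    by rewrite ler_peMr// exprn_ege1 ?lerDl.
  apply: (le_trans h1); rewrite -[leLHS]mulrA -[leRHS]mulrA ler_pM//.
  rewrite -exprMn expr2 ler_pM ?addr_ge0//.
    by rewrite -/v0; have := mulr_ge0 v00 (normr_ge0 V); lra.
  rewrite (le_trans (ler_normB _ _))// -/v0.
  by have := mulr_ge0 v00 (normr_ge0 V); lra.
- by rewrite (le_trans (dgc V l OV))// ler_wpM2r ?addr_ge0// (le_trans S3).
- by rewrite (le_trans (lip V W OV OW))// !ler_wpM2r ?addr_ge0// (le_trans S1).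
- by rewrite (le_trans (taylor W V OW OV))// ler_wpM2r ?exprn_ge0// (le_trans S2).
Qed.
End smooth_bounds.

Section entropy_system_exists.
Context {R : realType} {k n : nat}.
Variables (O : set 'rV[R]_n) (G : option 'I_k -> 'I_n -> 'rV[R]_n -> R)
  (Q : option 'I_k -> 'rV[R]_n -> R) (B : 'I_n -> 'rV[R]_n -> R) (M : R).
Hypotheses (cO : convex_set O)
  (G_C2 : forall a i, C2_on (closure O) (G a i))
  (D2G : forall a i V, O V -> forall l m,
    `|partial (closure O) l (partial (closure O) m (G a i)) V| <= M)
  (Q_C1 : forall a, C1_on O (Q a))
  (B_C1 : forall i, C1_on O (B i))
  (DB_bounded : forall i V, O V -> forall l, `|partial O l (B i) V| <= M)
  (growB : forall i V, O V -> `|B i V| <= M * (1 + `|V|))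
  (growQ : forall a V, O V -> `|Q a V| <= M * (1 + `|V|) ^+ 3)
  (DQ : forall a V, O V -> forall l, partial O l (Q a) V =
    \sum_i B i V * partial (closure O) l (G a i) V).
Let DG a i := gradient (closure O) (G a i).
Let DB i := gradient O (B i).

Let gradQE a V : O V -> gradient O (Q a) V = \sum_i B i V *: DG a i V.
Proof.
move=> OV; apply/rowP => l; rewrite summxE.
transitivity (\sum_i B i V * partial (closure O) l (G a i) V); first exact: (DQ a OV l).
by apply: eq_bigr => i _; rewrite mxE.
Qed.

Let gradQ a V : O V -> is_gradient O (Q a) V (\sum_i B i V *: DG a i V).
Proof. by move=> OV; rewrite -gradQE//; exact: (Q_C1 a).1. Qed.

(** All constants come from C2_quadratic_bounds and the mean value theorem; in
    particular the gradient of Q, being B DG, has quadratic growth. *)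
Lemma entropy_system_exists : exists C, entropy_system O G DG Q B DB C.
Proof.
have [[V0 OV0]|O0] := pselect (exists V, O V); last first.
  have nO V : O V -> False by move=> OV; apply: O0; exists V.
  by exists 0; split=> [|i V /nO|i V W /nO|i V l /nO|i l x /nO|i V /nO|a i V /nO|a i V W /nO
    |a i V W /nO|a i V /nO|a V /nO|a V W /nO|a V /nO].
have [c c0 hc] : exists2 c, 0 <= c & forall p : option 'I_k * 'I_n,
    quadratic_bounds O (G p.1 p.2) (DG p.1 p.2) c.
  apply: common_bound => [p c c'|p]; first exact: quadratic_bounds_le.
  exact: (C2_quadratic_bounds cO OV0 (G_C2 _ _) (D2G _ _)).
pose m := `|M|; have m0 : 0 <= m by exact: normr_ge0.
have Mm : M <= m by exact: ler_norm.
pose C := c + m + n%:R * m + n%:R * (n%:R * (m * c)) * 4.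
have nm : 0 <= n%:R * m by rewrite mulr_ge0.
have nn : 0 <= n%:R * (n%:R * (m * c)) * 4 by rewrite !mulr_ge0.
have C0 : 0 <= C by rewrite /C !addr_ge0.
have [cC mC nC nnC] : [/\ c <= C, m <= C, n%:R * m <= C & n%:R * (n%:R * (m * c)) * 4 <= C].
  by rewrite /C; split; lra.
exists C; split=> //.
- move=> i V OV; rewrite (le_trans (growB i OV))// ler_wpM2r ?addr_ge0//.
  exact: le_trans mC.
- move=> i V W OV OW.
  apply: (@le_trans _ _ (n%:R * m * `|V - W|)); last by rewrite ler_wpM2r.
  apply: (@convex_lip _ _ O (B i) (DB i)) => //; first exact: (B_C1 i).1.
  by move=> z l Oz; rewrite (le_trans (DB_bounded i Oz l)).
- by move=> i V l OV; rewrite (le_trans (DB_bounded i OV l))// (le_trans Mm).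
- move=> i l x Ox eps eps0.
  have /subspace_continuousP/(_ x Ox) := (B_C1 i).2.
  move=> /cvgrPdist_lt/(_ _ eps0)/nbhs_ballP[r /= r0 hr]; exists r => // y Oy yx.
  have := hr y; rewrite -ball_normE /= distrC => /(_ yx Oy) h.
  rewrite (le_lt_trans _ h)// distrC.
  by have := le_rV_norm (DB i x - DB i y) l; rewrite mxE [X in _ + X]mxE.
- by move=> i V OV; exact: (B_C1 i).1.
- move=> a i V OV; have [h _ _ _] := hc (a, i).
  by rewrite (le_trans (h V OV))// ler_wpM2r// exprn_ge0// addr_ge0.
- move=> a i V W OV OW; have [_ _ h _] := hc (a, i); rewrite (le_trans (h V W OV OW))//.
  by rewrite expr1 !ler_wpM2r ?addr_ge0.
- move=> a i V W OV OW; have [_ _ _ h] := hc (a, i); rewrite (le_trans (h V W OV OW))//.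
  by rewrite ler_wpM2r// exprn_ge0.
- move=> a i V OV; apply: is_gradient_sub (@subset_closure _ O) _.
  by apply: (G_C2 a i).1.1; exact: subset_closure.
- move=> a V OV; rewrite (le_trans (growQ a OV))// ler_wpM2r ?exprn_ge0 ?addr_ge0//.
  exact: le_trans mC.
- move=> a V W OV OW.
  have [z [Oz zW ->]] := convex_mvt cO (gradQ a) OW OV.
  pose K := (1 + `|V| + `|W|); have K1 : 0 <= K by rewrite !addr_ge0.
  have zK : 1 + `|z| <= 2 * K.
    have : `|z| <= `|z - W| + `|W| by rewrite -{1}(subrK W z) ler_normD.
    have := ler_normB V W; have := normr_ge0 V; rewrite /K; lra.
  have b l : `|(\sum_i B i z *: DG a i z) 0 l| <= n%:R * (m * c * (2 * K) ^+ 2).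
    rewrite summxE (le_trans (ler_norm_sum _ _ _))//.
    apply: (@le_trans _ _ (\sum_(i < n) m * c * (2 * K) ^+ 2)); last first.
      by rewrite sumr_const card_ord -[leLHS]mulr_natl.
    apply: ler_sum => i _; rewrite mxE normrM expr2 mulrACA.
    have [_ h _ _] := hc (a, i).
    have z1 : 0 <= 1 + `|z| by rewrite addr_ge0.
    apply: ler_pM => //.
      apply: (le_trans (growB i Oz)); apply: (@le_trans _ _ (m * (1 + `|z|))).
        by rewrite ler_wpM2r.
      by rewrite ler_wpM2l.
    by rewrite (le_trans (h z l Oz))// ler_wpM2l.
  rewrite (le_trans (dotp_le_coord _ b))// ler_wpM2r//.
  rewrite exprMn -/K; have -> : n%:R * (n%:R * (m * c * (2 ^+ 2 * K ^+ 2))) =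
    (n%:R * (n%:R * (m * c)) * 4) * K ^+ 2 by ring.
  by rewrite ler_wpM2r// exprn_ge0.
Qed.
End entropy_system_exists.

(** * The distance to the complement *)

Section euclidean_norm.
Context {R : realType} {n : nat}.
Implicit Types u v w : 'rV[R]_n.

Lemma sqr_enorm u : enorm u ^+ 2 = dotp u u.
Proof. by rewrite sqr_sqrtr// dotp_ge0. Qed.

Lemma cauchy_schwarz u v : `|dotp u v| <= enorm u * enorm v.
Proof.
have [u0|u0] := eqVneq (enorm u) 0.
  have /normr0_eq0 -> : `|u| = 0.
    by apply/le_anti; rewrite normr_ge0 andbT -u0 norm_le_enorm.
  by rewrite dotpC dotp0r normr0 mulr_ge0 ?enorm_ge0.
have [v0|v0] := eqVneq (enorm v) 0.
  have /normr0_eq0 -> : `|v| = 0.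
    by apply/le_anti; rewrite normr_ge0 andbT -v0 norm_le_enorm.
  by rewrite dotp0r normr0 mulr_ge0 ?enorm_ge0.
have up : 0 < enorm u by rewrite lt_neqAle eq_sym u0 enorm_ge0.
have vp : 0 < enorm v by rewrite lt_neqAle eq_sym v0 enorm_ge0.
have uv : 0 < enorm u * enorm v by rewrite mulr_gt0.
have key (s : R) : s ^+ 2 = 1 -> 0 <= 2 * (enorm u * enorm v) * (enorm u * enorm v + s * dotp u v).
  move=> s1; have := dotp_ge0 (enorm v *: u + (s * enorm u) *: v).
  rewrite dotpDl !dotpDr !dotpZl !dotpZr -!sqr_enorm (dotpC v u).
  move: s1 (enorm u) (enorm v) (dotp u v) => + x y z => s1.
  rewrite [X in 0 <= X -> _](_ : _ = 2 * (x * y) * (x * y + s * z) + (s ^+ 2 - 1) * (x ^+ 2 * y ^+ 2)); last by ring.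
  by rewrite s1 subrr mul0r addr0.
have c0 : 0 < 2 * (enorm u * enorm v) by rewrite mulr_gt0.
have h1 := key 1 (expr1n _ _); have h2 := key (-1) (sqrr_sign R 1).
move: h1 h2; rewrite !pmulr_rge0//; clear; move=> h1 h2.
by rewrite ler_norml; apply/andP; split; lra.
Qed.

Lemma enormD u v : enorm (u + v) <= enorm u + enorm v.
Proof.
have n0 : 0 <= enorm u + enorm v by rewrite addr_ge0 ?enorm_ge0.
rewrite -(ler_pXn2r (n := 2)) ?nnegrE ?enorm_ge0//.
rewrite sqr_enorm dotpDl !dotpDr (dotpC v u) -!sqr_enorm.
have := cauchy_schwarz u v; rewrite ler_norml => /andP[_].
by move: (dotp u v) (enorm u) (enorm v); clear => z x y h; nra.
Qed.

Lemma enormZ a u : enorm (a *: u) = `|a| * enorm u.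
Proof.
by rewrite /enorm dotpZl dotpZr mulrA -expr2 sqrtrM ?sqr_ge0// sqrtr_sqr.
Qed.

Lemma enormN u : enorm (- u) = enorm u.
Proof. by rewrite -scaleN1r enormZ normrN1 mul1r. Qed.

Lemma enormB u v : enorm (u - v) = enorm (v - u).
Proof. by rewrite -enormN opprB. Qed.

Lemma enorm0 : enorm (0 : 'rV[R]_n) = 0.
Proof. by rewrite /enorm dotp0r sqrtr0. Qed.

Lemma enorm_lip u v : `|enorm u - enorm v| <= enorm (u - v).
Proof.
have h1 := enormD (u - v) v; have h2 := enormD (v - u) u.
rewrite subrK in h1; rewrite subrK enormB in h2.
by rewrite ler_norml; apply/andP; split; lra.
Qed.

Lemma enorm_lt u (r : R) : `|u| < r -> enorm u < n.+1%:R * r.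
Proof. by move=> ur; rewrite (le_lt_trans (enorm_le u))// ltr_pM2l. Qed.
End euclidean_norm.

Section depth.
Context {R : realType} {k : nat}.
Variable Omega : set 'rV[R]_k.
Notation V := 'rV[R]_k.
Implicit Types x y z : V.
Notation K := (k.+1%:R : R).

(** Distance to the complement of Omega, truncated at 1: unlike the distance to
    the boundary it is real valued, Lipschitz on the whole space and zero
    outside Omega. *)
Definition depth x : R := inf ([set enorm (x - y) | y in ~` Omega] `|` [set 1]).

Let depth_lb x : lbound ([set enorm (x - y) | y in ~` Omega] `|` [set 1]) 0.
Proof. by move=> _ [[y _ <-]|->]; rewrite ?enorm_ge0. Qed.

Let has_lb x : has_lbound ([set enorm (x - y) | y in ~` Omega] `|` [set 1]).
Proof. by exists 0; exact: depth_lb. Qed.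

Let nonempty x : ([set enorm (x - y) | y in ~` Omega] `|` [set 1]) !=set0.
Proof. by exists 1; right. Qed.

Lemma depth_ge0 x : 0 <= depth x.
Proof. by apply: lb_le_inf; [exact: nonempty|exact: depth_lb]. Qed.

Lemma depth_le1 x : depth x <= 1.
Proof. by apply: ge_inf; [exact: has_lb|right]. Qed.

Lemma depth_le x y : ~ Omega y -> depth x <= enorm (x - y).
Proof. by move=> Oy; apply: ge_inf; [exact: has_lb|left; exists y]. Qed.

Lemma depth_out x : ~ Omega x -> depth x = 0.
Proof.
by move=> /depth_le-/(_ x); rewrite subrr enorm0 => h; apply/le_anti; rewrite h depth_ge0.
Qed.

Lemma depth_gt0 x : 0 < depth x -> Omega x.
Proof. by move=> d0; apply: contrapT => /depth_out h; rewrite h ltxx in d0. Qed.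

Lemma depth_le_add x y : depth x <= depth y + enorm (x - y).
Proof.
rewrite -lerBlDr; apply: lb_le_inf; first exact: nonempty.
move=> _ [[z Oz <-]|->]; last first.
  by rewrite lerBlDr (le_trans (depth_le1 x))// lerDl enorm_ge0.
have h1 := depth_le x Oz; have := enormD (x - y) (y - z).
by rewrite addrA subrK => h2; rewrite lerBlDr (le_trans h1)// [leRHS]addrC.
Qed.

Lemma depth_lip x y : `|depth x - depth y| <= enorm (x - y).
Proof.
have h1 := depth_le_add x y; have h2 := depth_le_add y x.
by rewrite enormB in h2; rewrite ler_norml; apply/andP; split; lra.
Qed.

Lemma depth_lip_sup x y : `|depth x - depth y| <= K * `|x - y|.
Proof. exact: le_trans (depth_lip x y) (enorm_le _). Qed.

Hypothesis oO : open Omega.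

(** A segment leaving an open set meets its boundary. *)
Lemma segment_boundary x y : Omega x -> ~ Omega y ->
  exists2 z, bdry Omega z & enorm (x - z) <= enorm (x - y).
Proof.
move=> Ox Oy; pose p (s : R) := x + s *: (y - x).
pose S := [set s : R | 0 <= s <= 1 /\ ~ Omega (p s)].
have S1 : S 1 by split; rewrite ?ler01 ?lexx// /p scale1r addrC subrK.
have Slb : lbound S 0 by move=> s [/andP[]].
have hS : has_lbound S by exists 0.
pose s0 := inf S.
have s00 : 0 <= s0 by apply: lb_le_inf Slb; exists 1.
have s01 : s0 <= 1 by apply: ge_inf.
have pB s t : p s - p t = (s - t) *: (y - x).
  by rewrite /p opprD addrACA subrr add0r scalerBl.
have pnear (r : R) : 0 < r -> exists2 d : R, 0 < d & forall s t, `|s - t| < d -> `|p s - p t| < r.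
  move=> r0; exists (r / (1 + `|y - x|)); first by rewrite divr_gt0// ltr_wpDr.
  move=> s t; rewrite ltr_pdivlMr ?ltr_wpDr// pB normrZ => h; apply: le_lt_trans h.
  by rewrite ler_wpM2l// lerDr.
have Oz : ~ Omega (p s0).
  move=> Oz.
  have /nbhs_ballP[r /= r0 hr] := open_nbhs_nbhs (conj oO Oz).
  have [d d0 hd] := pnear r r0.
  have [s [/andP[s0' s1'] Os] ss] := inf_adherent d0 (conj (ex_intro _ 1 S1) hS).
  apply: (Os); apply: hr; rewrite -ball_normE /=; apply: hd.
  have s0s : s0 <= s by apply: ge_inf => //; split => //; apply/andP.
  by rewrite distrC ger0_norm ?subr_ge0// ltrBlDl.
exists (p s0).
  split; last by move=> /interior_subset.
  move=> A /nbhs_ballP[r /= r0 hr].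
  have [d d0 hd] := pnear r r0.
  have s0p : 0 < s0.
    rewrite lt_neqAle s00 andbT; apply/eqP => s0E; apply: Oz.
    by rewrite -s0E /p scale0r addr0.
  pose s := Num.max 0 (s0 - d / 2).
  have ss : s < s0 by rewrite /s gt_max s0p/= ltrBlDr ltrDl divr_gt0.
  have s0' : 0 <= s by rewrite /s le_max lexx.
  exists (p s); split.
    apply: contrapT => Os; have : s0 <= s.
      by apply: ge_inf => //; split => //; rewrite s0' (le_trans (ltW ss)).
    by rewrite leNgt ss.
  apply: hr; rewrite -ball_normE /=; apply: hd.
  rewrite gtr0_norm ?subr_gt0// ltrBlDr -ltrBlDl.
  by rewrite /s lt_max; apply/orP; right; have := d0; lra.
rewrite /p opprD addrA subrr sub0r enormN enormZ ger0_norm// [leRHS]enormB.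
by rewrite ler_piMl ?enorm_ge0.
Qed.

(** The nearest boundary point is as near as the nearest point of the complement,
    by segment_boundary. *)
Lemma bdry_dist_depth x : Omega x -> depth x < 1 -> bdry_dist Omega x = (depth x)%:E.
Proof.
move=> Ox d1; apply/le_anti/andP; split; last first.
  apply: le_ereal_inf_tmp => _ [y [_ By] <-]; rewrite lee_fin.
  by apply: depth_le => Oy; apply: By; exact: (open_nbhs_nbhs (conj oO Oy)).
apply/lee_addgt0Pr => e e0.
pose c := Num.min (depth x + e) 1.
have dc : depth x < c by rewrite lt_min ltrDl e0.
have [_ [[y Oy <-]|->] yc] := inf_lt (nonempty x) dc; last first.
  by move: yc; rewrite lt_min ltxx andbF.
have [z Bz xz] := segment_boundary Ox Oy.
apply: (@le_trans _ _ (enorm (x - z))%:E); first by apply: ereal_inf_lbound; exists z.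
rewrite -EFinD lee_fin (le_trans xz)// ltW// (lt_le_trans yc)//.
by rewrite /c ge_min lexx.
Qed.

Lemma continuous_depth : continuous depth.
Proof.
move=> x; apply: (iffRL (@cvgrPdist_lt _ R^o _ (nbhs x) _ depth (depth x))) => e e0.
apply/nbhs_ballP.
exists (e / K) => [|y]; first by rewrite /= divr_gt0.
rewrite -ball_normE /= ltr_pdivlMr// mulrC => h.
exact: le_lt_trans (depth_lip_sup x y) h.
Qed.

Lemma open_depth_gt (c : R) : open [set x | c < depth x].
Proof.
rewrite (_ : mkset _ = depth @^-1` [set s | c < s])//.
by apply: open_comp; [move=> x _; exact: continuous_depth|exact: open_gt].
Qed.

Lemma closed_depth_ge (c : R) : closed [set x | c <= depth x].
Proof.
rewrite (_ : mkset _ = depth @^-1` [set s | c <= s])//.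
by apply: closed_comp; [move=> x _; exact: continuous_depth|exact: closed_ge].
Qed.

(** Where the truncation is inactive, the gradient of the distance to the
    boundary is that of the depth. *)
Lemma is_gradient_depth x v : Omega x -> depth x < 1 ->
  is_gradient [set: V] (fun z => fine (bdry_dist Omega z)) x v ->
  is_gradient [set: V] depth x v.
Proof.
move=> Ox d1 hg e /hg.
have h1 : \forall y \near x, Omega y by exact: (open_nbhs_nbhs (conj oO Ox)).
have h2 : \forall y \near x, depth y < 1.
  apply: (open_nbhs_nbhs (conj (_ : open [set y | depth y < 1]) d1)).
  rewrite (_ : mkset _ = depth @^-1` [set s | s < 1])//.
  by apply: open_comp; [move=> y _; exact: continuous_depth|exact: open_lt].
apply: filterS2 (filterI h1 h2) => y [Oy y1] h _.
by have := h I; rewrite !bdry_dist_depth.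
Qed.
End depth.

(** * A cutoff profile, derivatives of Lipschitz functions *)

Section smoothstep.
Context {R : realType}.
Implicit Types a b v : R.

(** A transition from 0 on ]-oo, 0] to 1 on [1, +oo[, with Lipschitz
    derivative dstep: the second primitive of 4 on [0, 1/2] and -4 on [1/2, 1]. *)
Definition step v : R :=
  2 * Num.max 0 v ^+ 2 - 4 * Num.max 0 (v - 2^-1) ^+ 2 + 2 * Num.max 0 (v - 1) ^+ 2.
Definition dstep v : R :=
  4 * Num.max 0 v - 8 * Num.max 0 (v - 2^-1) + 4 * Num.max 0 (v - 1).

Let square_taylor a b :
  `|Num.max 0 b ^+ 2 - Num.max 0 a ^+ 2 - 2 * Num.max 0 a * (b - a)| <= (b - a) ^+ 2.
Proof.
have s1 := sqr_ge0 a; have s2 := sqr_ge0 b; have s3 := sqr_ge0 (b - a).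
have e3 : (b - a) ^+ 2 = b ^+ 2 - 2 * (a * b) + a ^+ 2 by ring.
rewrite e3 in s3 *; rewrite ler_norml.
case: (leP 0 a) => a0; case: (leP 0 b) => b0.
- rewrite (_ : b ^+ 2 - a ^+ 2 - 2 * a * (b - a) = b ^+ 2 - 2 * (a * b) + a ^+ 2); last by ring.
  by apply/andP; split; lra.
- have ab : a * b <= 0 by rewrite mulr_ge0_le0// ltW.
  rewrite (_ : 0 ^+ 2 - a ^+ 2 - 2 * a * (b - a) = a ^+ 2 - 2 * (a * b)); last by ring.
  by apply/andP; split; lra.
- have ab : a * b <= 0 by rewrite mulr_le0_ge0// ltW.
  rewrite (_ : b ^+ 2 - 0 ^+ 2 - 2 * 0 * (b - a) = b ^+ 2); last by ring.
  by apply/andP; split; lra.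
- rewrite (_ : 0 ^+ 2 - 0 ^+ 2 - 2 * 0 * (b - a) = 0); last by ring.
  by apply/andP; split; lra.
Qed.

Lemma step_taylor a b : `|step b - step a - dstep a * (b - a)| <= 8 * (b - a) ^+ 2.
Proof.
have h1 := square_taylor a b; have h2 := square_taylor (a - 2^-1) (b - 2^-1).
have h3 := square_taylor (a - 1) (b - 1).
have e c : b - c - (a - c) = b - a by ring.
rewrite !e in h2 h3; rewrite /step /dstep.
move: h1 h2 h3; move: (Num.max 0 b) (Num.max 0 a) (Num.max 0 (b - _)) (Num.max 0 (a - _)).
move=> x1 y1 x2 y2; move: (Num.max 0 (b - _)) (Num.max 0 (a - _)) => x3 y3.
move: (x1 ^+ 2) (x2 ^+ 2) (x3 ^+ 2) (y1 ^+ 2) (y2 ^+ 2) (y3 ^+ 2) => p1 p2 p3 q1 q2 q3.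
rewrite !ler_norml => /andP[? ?] /andP[? ?] /andP[? ?]; apply/andP; split; nra.
Qed.

Lemma step_le0 v : v <= 0 -> step v = 0.
Proof.
by move=> v0; rewrite /step !max_l; [ring|lra..].
Qed.

Lemma step_ge1 v : 1 <= v -> step v = 1.
Proof. by move=> v1; rewrite /step !max_r; [field|lra..]. Qed.

Lemma dstep_le0 v : v <= 0 -> dstep v = 0.
Proof. by move=> v0; rewrite /dstep !max_l; [ring|lra..]. Qed.

Lemma dstep_ge1 v : 1 <= v -> dstep v = 0.
Proof. by move=> v1; rewrite /dstep !max_r; [field|lra..]. Qed.

Lemma step_ge0 v : 0 <= step v.
Proof.
rewrite /step; case: (leP 0 v) => h1; case: (leP 0 (v - 2^-1)) => h2; case: (leP 0 (v - 1)) => h3; nra.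
Qed.

Lemma step_le1 v : step v <= 1.
Proof.
rewrite /step; case: (leP 0 v) => h1; case: (leP 0 (v - 2^-1)) => h2; case: (leP 0 (v - 1)) => h3; nra.
Qed.

Lemma norm_step v : `|step v| <= 1.
Proof. by rewrite ger0_norm ?step_ge0 ?step_le1. Qed.

Lemma norm_dstep v : `|dstep v| <= 2.
Proof.
rewrite /dstep ler_norml; case: (leP 0 v) => h1; case: (leP 0 (v - 2^-1)) => h2;
  case: (leP 0 (v - 1)) => h3; apply/andP; split; lra.
Qed.

Lemma step_lip a b : `|step b - step a| <= 10 * `|b - a|.
Proof.
have [h|h] := leP 1 `|b - a|.
  have := step_ge0 a; have := step_le1 a; have := step_ge0 b; have := step_le1 b.
  move: (step a) (step b) `|b - a| h => x y z *; rewrite ler_norml; apply/andP; split; lra.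
have h1 := step_taylor a b; have h2 := norm_dstep a.
have h3 : `|step b - step a| <= `|dstep a| * `|b - a| + 8 * (b - a) ^+ 2.
  rewrite -normrM -{1}(subrK (dstep a * (b - a)) (step b - step a)).
  by rewrite (le_trans (ler_normD _ _))// addrC lerD2l.
apply: (le_trans h3); rewrite -[X in 8 * X](real_normK (num_real _)) expr2 mulrA -mulrDl ler_wpM2r//.
by have := normr_ge0 (b - a); lra.
Qed.
End smoothstep.

Section sequence_derivative_rules.
Context {R : realType} {k : nat}.
Notation ST := ('rV[R]_k * R)%type.
Variables (t : nat -> R) (a : option 'I_k) (X : ST).
Hypotheses (t0 : forall m, 0 < t m) (too : t @ \oo --> +oo).
Notation Z m := (X + (t m)^-1 *: evec a).

(** Chain rule for outer functions with a quadratic Taylor remainder. *)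
Lemma seq_deriv_quad_comp (s ds : R -> R) (L : R) (f : ST -> R) (d : R) :
  (forall u v, `|s v - s u - ds u * (v - u)| <= L * (v - u) ^+ 2) ->
  seq_deriv t (evec a) X f d ->
  seq_deriv t (evec a) X (fun Y => s (f Y)) (ds (f X) * d).
Proof.
move=> hs hf.
pose w m := t m * (f (Z m) - f X).
have err : (fun m => t m * (s (f (Z m)) - s (f X) - ds (f X) * (f (Z m) - f X))) @ \oo --> (0 : R).
  have z1 : (fun m => L * (w m * w m * (t m)^-1)) @ \oo --> L * (d * d * 0).
    apply: cvgM; first exact: cvg_cst.
    by apply: cvgM; [apply: cvgM; exact: hf|exact: inv_t_cvg0].
  have z2 : (fun m => - (L * (w m * w m * (t m)^-1))) @ \oo --> - (L * (d * d * 0)).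
    exact: cvgN.
  rewrite mulr0 mulr0 ?oppr0 in z1 z2.
  apply: (squeeze_cvgr _ z2 z1); near=> m.
  have -> : L * (w m * w m * (t m)^-1) = t m * (L * (f (Z m) - f X) ^+ 2).
    by rewrite /w; field; rewrite gt_eqF.
  rewrite -ler_norml normrM gtr0_norm// ler_wpM2l//; exact: ltW.
rewrite -[_ * d]add0r.
apply: (@eq_cvg_seq _ (fun m => t m * (s (f (Z m)) - s (f X) - ds (f X) * (f (Z m) - f X)) +
   ds (f X) * (t m * (f (Z m) - f X)))); first by move=> m; ring.
by apply: cvgD; [exact: err|apply: cvgM; [exact: cvg_cst|exact: hf]].
Unshelve. all: by end_near. Qed.

(** At a critical value of s the composite with a Lipschitz function is flat,
    whether or not that function is differentiable. *)
Lemma seq_deriv_flat (s ds : R -> R) (L M : R) (f : ST -> R) :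
  (forall u v, `|s v - s u - ds u * (v - u)| <= L * (v - u) ^+ 2) -> 0 <= L -> 0 <= M ->
  (forall H, `|f (X + H) - f X| <= M * `|H|) -> ds (f X) = 0 ->
  seq_deriv t (evec a) X (fun Y => s (f Y)) 0.
Proof.
move=> hs L0 M0 hf d0.
have z1 : (fun m => L * M ^+ 2 * (t m)^-1) @ \oo --> L * M ^+ 2 * 0.
  by apply: cvgM; [exact: cvg_cst|exact: inv_t_cvg0].
have z2 : (fun m => - (L * M ^+ 2 * (t m)^-1)) @ \oo --> - (L * M ^+ 2 * 0) by exact: cvgN.
rewrite mulr0 ?oppr0 in z1 z2.
apply: (squeeze_cvgr _ z2 z1); near=> m.
rewrite -ler_norml normrM gtr0_norm//.
have := hs (f X) (f (Z m)); rewrite d0 mul0r subr0 => h.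
have h3 : `|f (Z m) - f X| <= M * (t m)^-1.
  rewrite (le_trans (hf _))// ler_wpM2l// normrZ gtr0_norm ?invr_gt0//.
  by rewrite ler_piMr ?norm_evec// invr_ge0 ltW.
have -> : L * M ^+ 2 / t m = t m * (L * (M * (t m)^-1) ^+ 2) by field; rewrite gt_eqF.
rewrite ler_wpM2l ?(ltW (t0 m))// (le_trans h)// ler_wpM2l//.
by rewrite -(real_normK (num_real _)) lerXn2r ?nnegrE// mulr_ge0// invr_ge0 ltW.
Unshelve. all: by end_near. Qed.


Lemma seq_deriv_space (f : 'rV[R]_k -> R) (v : 'rV[R]_k) :
  is_gradient [set: 'rV[R]_k] f X.1 v ->
  seq_deriv t (evec a) X (fun Y => f Y.1) (if a is Some j then v 0 j else 0).
Proof.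
move=> hf; case: a => [j|]; last first.
  apply: (@eq_cvg_seq _ (fun=> 0)); last exact: cvg_cst.
  by move=> m; rewrite /= scaler0 addr0 subrr mulr0.
have -> : v 0 j = dotp (delta_mx 0 j) v.
  rewrite /dotp (bigD1 j)//= mxE !eqxx mul1r big1 ?addr0// => i ij.
  by rewrite mxE eqxx (negbTE ij) mul0r.
apply: (@gradient_chain_seq _ _ setT f X.1 v (delta_mx 0 j)
   (fun m => X.1 + (t m)^-1 *: delta_mx 0 j) t 1 hf t0 too).
- by near=> m.
- move=> m; rewrite addrC addKr normrZ gtr0_norm ?invr_gt0// mulrC ler_pM2r ?invr_gt0//.
  have /spacetime_norm_leP[h _] := @norm_evec R k (Some j); exact: h.
- move=> l; apply: (@eq_cvg_seq _ (fun=> (delta_mx 0 j : 'rV[R]_k) 0 l)); last exact: cvg_cst.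
  move=> m; have e (u w : 'rV[R]_k) (c : R) : (u + c *: w) 0 l - u 0 l = c * w 0 l.
    by rewrite mxE [X in _ + X - _]mxE addrC addKr.
  by rewrite e mulrA divff ?mul1r// gt_eqF.
Unshelve. all: by end_near. Qed.

Lemma seq_deriv_time (f : R^o -> R^o) : derivable f X.2 1 ->
  seq_deriv t (evec a) X (fun Y => f Y.2) (if a is Some _ then 0 else (f^`())%classic X.2).
Proof.
move=> df; case: a => [j|].
  apply: (@eq_cvg_seq _ (fun=> 0)); last exact: cvg_cst.
  by move=> m; rewrite /= scaler0 addr0 subrr mulr0.
rewrite derive1E.
have h : (fun m => (t m)^-1) @ \oo --> 0^'.
  move=> P [e /= e0 hP]; change (\forall m \near \oo, P (t m)^-1); near=> m.
  apply: hP; last by rewrite lt0r_neq0 ?invr_gt0.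
  near: m; have /cvgrPdist_lt/(_ e e0) := inv_t_cvg0 t0 too.
  exact: filterS.
have := cvg_comp _ _ h df.
apply: eq_cvg_seq => m; rewrite /= invrK.
by rewrite [_%:A]mulr1 [_ + X.2]addrC.
Unshelve. all: by end_near. Qed.
End sequence_derivative_rules.

Section upper_derivative.
Context {R : realType} {k : nat}.
Notation ST := ('rV[R]_k * R)%type.
Notation mST := ('rV[R]_k * measurableTypeR R)%type.
Variables (f : ST -> R) (L : R) (a : option 'I_k).
Hypothesis (f_lip : forall X H, `|f (X + H) - f X| <= L * `|H|).

Definition quotient (m : nat) (X : ST) : R :=
  m.+1%:R * (f (X + m.+1%:R^-1 *: evec a) - f X).

(** A function that is measurable, and bounded, by construction, and that
    agrees with the partial derivative wherever the latter exists. *)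
Definition upper_deriv (X : ST) : R := limn_sup (quotient ^~ X).

Let L0 : 0 <= L.
Proof.
have := f_lip 0 (evec None).
have -> : `|evec (None : option 'I_k) : ST| = 1.
  apply/le_anti; rewrite norm_evec /=.
  by rewrite -[X in X <= _](@normr1 R) le_max lexx orbT.
by rewrite mulr1; apply: le_trans.
Qed.

Lemma norm_quotient m X : `|quotient m X| <= L.
Proof.
rewrite /quotient normrM ger0_norm//.
apply: (@le_trans _ _ (m.+1%:R * (L * m.+1%:R^-1))); last first.
  by rewrite mulrCA divff ?mulr1// pnatr_eq0.
rewrite ler_wpM2l// (le_trans (f_lip _ _))// ler_wpM2l// normrZ ger0_norm ?invr_ge0//.
by rewrite ler_piMr ?norm_evec ?invr_ge0.
Qed.

Let q_ub X : has_ubound (range (quotient ^~ X)).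
Proof.
by exists L => _ [m _ <-]; rewrite (le_trans (ler_norm _))// norm_quotient.
Qed.
Let q_lb X : has_lbound (range (quotient ^~ X)).
Proof.
exists (- L) => _ [m _ <-]; have := norm_quotient m X.
by rewrite ler_norml => /andP[].
Qed.

Lemma measurable_upper_deriv : measurable_fun setT (upper_deriv : mST -> R).
Proof.
apply: measurable_fun_limn_sup => [X _|X _|m]; [exact: q_ub|exact: q_lb|].
have cf : continuous (f : ST -> R).
  move=> X; apply: (continuous_of_lip ltr01 (L := L)) => Y H _; exact: f_lip.
apply: continuous_measurable_spacetime; first exact: openT.
move=> X _; apply: (continuous_of_lip ltr01 (L := m.+1%:R * (L + L))) => Y H _.
rewrite /quotient -mulrBr normrM ger0_norm// -mulrA ler_wpM2l//.
have e1 := f_lip (Y + m.+1%:R^-1 *: evec a) H; have e2 := f_lip Y H.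
rewrite [Y + H + _]addrAC mulrDl.
move: e1 e2; move: (f _) (f (Y + H)) (f _) (f Y) (L * `|H|) => x1 x2 x3 x4 c.
by rewrite !ler_norml => /andP[? ?] /andP[? ?]; apply/andP; split; lra.
Qed.

Lemma norm_upper_deriv X : `|upper_deriv X| <= L.
Proof.
have qb : bounded_fun (quotient ^~ X).
  exists L; split; first exact: num_real.
  by move=> M LM m _; exact: le_trans (norm_quotient m X) (ltW LM).
rewrite /upper_deriv limn_supE// ler_norml; apply/andP; split.
  apply: lb_le_inf; first by exists (sups (quotient ^~ X) 0); exists 0.
  move=> _ [m _ <-]; apply: (@le_trans _ _ (quotient m X)).
    by have := norm_quotient m X; rewrite ler_norml => /andP[].
  apply: ub_le_sup; last by exists m => /=.
  exact: has_ubound_sdrop.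
apply: (@le_trans _ _ (sups (quotient ^~ X) 0)).
  by apply: ge_inf; [exact: bounded_fun_has_lbound_sups|exists 0].
apply: ge_sup; first by exists (quotient 0 X); exists 0.
by move=> _ [m _ <-]; rewrite (le_trans (ler_norm _))// norm_quotient.
Qed.

Lemma upper_derivE X d :
  seq_deriv (fun m => m.+1%:R) (evec a) X f d -> upper_deriv X = d.
Proof. by move=> h; have [_] := cvg_limn_inf_sup h. Qed.
End upper_derivative.

(** * Test functions in time *)

Lemma open_avoid {R : realType} (S : set R) (c : R) : closed S -> ~ S c ->
  exists2 r : R, 0 < r & forall s, S s -> r <= `|s - c|.
Proof.
move=> cS Sc.
have /nbhs_ballP[r /= r0 hr] : nbhs c (~` S).
  by apply: open_nbhs_nbhs; split => //; exact: closed_openC.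
exists r => // s Ss; rewrite leNgt; apply/negP => h.
by apply: (hr s) => //; rewrite -ball_normE /= distrC.
Qed.

(** A test function in time is bounded and Lipschitz, with support at positive
    distance from both ends of the interval. *)
Lemma test_time_bounds {R : realType} (T : R) (chi : R^o -> R^o) : C1c `]0, T[ chi ->
  exists M rho : R, [/\ 0 <= M, 0 < rho,
    forall s, derivable chi s 1,
    (forall s, `|chi s| <= M) /\ (forall s u, `|chi u - chi s| <= M * `|u - s|) &
    (forall s, `|(chi^`())%classic s| <= M) /\
    (forall s, chi s != 0 \/ (chi^`())%classic s != 0 -> rho <= s <= T - rho)].
Proof.
move=> [dchi cD cS SD]; set S := closure _ in cS SD.
have dS s : derivable chi s 1 by apply/derivable1_diffP.
have clS : closed S by exact: closed_closure.
have S0 : ~ S 0 by move=> /SD; rewrite /= in_itv /= ltxx.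
have ST : ~ S T by move=> /SD; rewrite /= in_itv /= ltxx andbF.
have [r1 r10 h1] := open_avoid clS S0; have [r2 r20 h2] := open_avoid clS ST.
have SI s : S s -> Num.min r1 r2 <= s <= T - Num.min r1 r2.
  move=> Ss; have := SD _ Ss; rewrite /= in_itv /= => /andP[s0 sT].
  have a := h2 _ Ss; have b := h1 _ Ss.
  rewrite distrC gtr0_norm ?subr_gt0// in a; rewrite subr0 gtr0_norm// in b.
  apply/andP; split; first by rewrite ge_min b.
  by rewrite lerBrDr -lerBrDl ge_min a orbT.
have chi0 s : ~ S s -> chi s = 0.
  by move=> Ss; apply: contrapT => /eqP h; apply: Ss; exact: subset_closure.
have dchi0 s : ~ S s -> (chi^`())%classic s = 0.
  move=> Ss; rewrite derive1E (@near_eq_derive _ _ _ chi (cst 0)) ?derive_cst//.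
  have : nbhs s (~` S) by apply: open_nbhs_nbhs; split => //; exact: closed_openC.
  by apply: filterS => u /chi0.
have bdd (f : R^o -> R^o) : continuous f -> exists2 M : R, 0 <= M & forall s, S s -> `|f s| <= M.
  move=> cf; have : compact (f @` S).
    by apply: continuous_compact => //; exact: continuous_subspaceT.
  move=> /compact_bounded[M [_ hM]]; exists (`|M| + 1) => [|s Ss]; first by rewrite addr_ge0.
  by apply: hM; [rewrite (le_lt_trans (ler_norm _))// ltrDl|exists s].
have [M1 M10 hM1] : exists2 M : R, 0 <= M & forall s, S s -> `|chi s| <= M.
  by apply: bdd => s; apply: differentiable_continuous.
have [M2 M20 hM2] : exists2 M : R, 0 <= M & forall s, S s -> `|'D_1 chi s| <= M.
  by apply: bdd; exact: cD.
have M12 : M1 <= M1 + M2 by rewrite lerDl.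
have M22 : M2 <= M1 + M2 by rewrite lerDr.
have b2 s : `|(chi^`())%classic s| <= M1 + M2.
  have [Ss|Ss] := pselect (S s); last by rewrite dchi0// normr0 addr_ge0.
  by rewrite derive1E (le_trans (hM2 s Ss)).
exists (M1 + M2), (Num.min r1 r2); split.
- by rewrite addr_ge0.
- by rewrite lt_min r10.
- exact: dS.
- split=> [s|].
    have [Ss|Ss] := pselect (S s); last by rewrite chi0// normr0 addr_ge0.
    by rewrite (le_trans (hM1 s Ss)).
  have mvt s u : s <= u -> `|chi u - chi s| <= (M1 + M2) * `|u - s|.
    move=> su; have [c _ ->] : exists2 c, c \in `[s, u]%R & chi u - chi s = (chi^`())%classic c * (u - s).
      apply: MVT_segment => // [x _|].
        by have := @derivableP _ _ _ chi x 1 (dS x); rewrite derive1E.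
      by apply: derivable_within_continuous => x _; exact: dS.
    by rewrite normrM ler_wpM2r.
  move=> s u; have [su|us] := leP s u; first exact: mvt.
  by rewrite distrC [`|u - s|]distrC; apply: mvt; exact: ltW.
- split=> // s [h|h]; apply: SI; apply: contrapT => Ss.
    by rewrite chi0// eqxx in h.
  by rewrite dchi0// eqxx in h.
Unshelve. all: by end_near. Qed.

(** * Cutoffs near the boundary and at infinity *)

(** A null set of positions stays null when any time is allowed. *)
Lemma ae_space {R : realType} (k : nat) (Pr : 'rV[R]_k -> Prop) :
  {ae rV_lebesgue k, forall x, Pr x} ->
  {ae @spacetime_lebesgue R k, forall X, Pr X.1}.
Proof.
move=> [N [mN N0 hN]]; exists (N `*` setT); split.
- exact: measurableX.
- rewrite /spacetime_lebesgue product_measure1E//.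
  by rewrite [X in (X * _)%E](_ : _ = 0%E) ?mul0e//; exact: N0.
- by move=> X hX; split => //; exact: hN.
Qed.

Section cutoff.
Context {R : realType} {k : nat}.
Notation ST := ('rV[R]_k * R)%type.
Notation mST := ('rV[R]_k * measurableTypeR R)%type.
Notation mu := (@spacetime_lebesgue R k).
Notation K := (k.+1%:R : R).
Variables (Omega : set 'rV[R]_k) (T e r : R) (chi : R^o -> R^o) (M rho : R).
Hypotheses (oO : open Omega) (e0 : 0 < e) (e1 : e < 1) (r1 : 1 <= r) (rho0 : 0 < rho)
  (dchi : forall s, derivable chi s 1) (chiM : forall s, `|chi s| <= M)
  (chiL : forall s u, `|chi u - chi s| <= M * `|u - s|)
  (chi_supp : forall s, chi s != 0 \/ (chi^`())%classic s != 0 -> rho <= s <= T - rho).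
Let r0 : 0 < r. Proof. exact: lt_le_trans r1. Qed.

(** layer_cut vanishes up to distance e / 4 from the boundary and is 1 beyond e / 2;
    far_cut is 1 up to distance r from the origin and vanishes beyond 2 r. *)
Definition layer_cut (x : 'rV[R]_k) : R := step (4 / e * depth Omega x - 1).
Definition far_cut (x : 'rV[R]_k) : R := step (2 - (r ^+ 2)^-1 * dotp x x).
Definition cutoff (X : ST) : R := chi X.2 * (layer_cut X.1 * far_cut X.1).

Definition normal_at (x : 'rV[R]_k) : 'rV[R]_k := outer_normal Omega (bdry_proj Omega x).
Definition dlayer_cut (a : option 'I_k) (x : 'rV[R]_k) : R :=
  dstep (4 / e * depth Omega x - 1) * (4 / e * (if a is Some j then (- normal_at x) 0 j else 0)).
Definition dfar_cut (a : option 'I_k) (x : 'rV[R]_k) : R :=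
  dstep (2 - (r ^+ 2)^-1 * dotp x x) *
    (- (r ^+ 2)^-1 * (if a is Some j then (2 *: x) 0 j else 0)).
(** The derivative given by the product rule wherever the collar is regular.  The
    normal field being possibly non-measurable, it serves only to evaluate
    upper_deriv almost everywhere. *)
Definition dcutoff (a : option 'I_k) (X : ST) : R :=
  (if a is Some _ then 0 else (chi^`())%classic X.2) * (layer_cut X.1 * far_cut X.1) +
  chi X.2 * (dlayer_cut a X.1 * far_cut X.1 + layer_cut X.1 * dfar_cut a X.1).

Lemma layer_cut_lip x y : `|layer_cut y - layer_cut x| <= 40 / e * K * `|y - x|.
Proof.
rewrite (le_trans (step_lip _ _))//.
have -> : 4 / e * depth Omega y - 1 - (4 / e * depth Omega x - 1) =
  4 / e * (depth Omega y - depth Omega x) by ring.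
have e4 : 0 <= 4 / e by rewrite divr_ge0// ltW.
rewrite normrM (ger0_norm e4).
have -> : 40 / e * K * `|y - x| = 10 * (4 / e * (K * `|y - x|)) by field; rewrite gt_eqF.
by rewrite ler_wpM2l// ler_wpM2l// depth_lip_sup.
Qed.

Lemma far_cut_eq0 x : 2 * r <= enorm x -> far_cut x = 0.
Proof.
move=> rx; apply: step_le0; rewrite subr_le0 -sqr_enorm ler_pdivlMl ?exprn_gt0//.
have h : (2 * r) ^+ 2 <= enorm x ^+ 2 by rewrite lerXn2r ?nnegrE ?enorm_ge0// mulr_ge0// ltW.
by rewrite (le_trans _ h)// exprMn mulrC ler_wpM2r ?exprn_ge0 ?ltW// -natrX ltr_nat.
Qed.

(** The square of the norm is Lipschitz on bounded sets only; far from the origin,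
    and for distant pairs of points, the boundedness of far_cut takes over. *)
Lemma far_cut_lip x y : `|far_cut y - far_cut x| <= 50 * K * `|y - x|.
Proof.
suff h : `|far_cut y - far_cut x| <= 50 * enorm (y - x).
  by rewrite (le_trans h)// -mulrA ler_wpM2l// enorm_le.
have [h|h] := leP (r / 2) (enorm (y - x)).
  have := @step_ge0 R (2 - (r ^+ 2)^-1 * dotp x x); have := @step_le1 R (2 - (r ^+ 2)^-1 * dotp x x).
  have := @step_ge0 R (2 - (r ^+ 2)^-1 * dotp y y); have := @step_le1 R (2 - (r ^+ 2)^-1 * dotp y y).
  rewrite -/(far_cut x) -/(far_cut y) => *; rewrite ler_norml; apply/andP.
  by have := r1; split; lra.
have [hx|hx] := leP (2 * r) (enorm x); have [hy|hy] := leP (2 * r) (enorm y).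
- by rewrite !far_cut_eq0// subrr normr0 mulr_ge0 ?enorm_ge0.
all: have := enorm_lip y x; rewrite ler_norml => /andP[l1 l2].
all: have [bx byy] : enorm x <= 5 / 2 * r /\ enorm y <= 5 / 2 * r by split; lra.
all: rewrite (le_trans (step_lip _ _))//.
all: have -> : 2 - (r ^+ 2)^-1 * dotp y y - (2 - (r ^+ 2)^-1 * dotp x x) =
  - (r ^+ 2)^-1 * ((enorm y - enorm x) * (enorm y + enorm x))
  by rewrite -!sqr_enorm; ring.
all: have c0 : 0 <= (r ^+ 2)^-1 by rewrite invr_ge0 exprn_ge0// ltW.
all: rewrite normrM normrN (ger0_norm c0) normrM.
all: have s0 : 0 <= enorm y + enorm x by rewrite addr_ge0 ?enorm_ge0.
all: rewrite (ger0_norm s0).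
all: apply: (@le_trans _ _ (10 * ((r ^+ 2)^-1 * (enorm (y - x) * (5 * r))))).
1,3,5: rewrite ler_wpM2l// ler_wpM2l ?invr_ge0 ?exprn_ge0 ?(ltW r0)//.
1,2,3: by apply: ler_pM => //; [exact: enorm_lip|lra].
all: have -> : 10 * ((r ^+ 2)^-1 * (enorm (y - x) * (5 * r))) = 50 * enorm (y - x) / r
  by field; rewrite gt_eqF.
all: by rewrite ler_pdivrMr// ler_peMr// mulr_ge0// enorm_ge0.
Qed.

Lemma cutoff_bounds : exists2 C1 : R, 0 <= C1 &
  (forall X, `|cutoff X| <= C1) /\ (forall X H, `|cutoff (X + H) - cutoff X| <= C1 * `|H|).
Proof.
have M0 : 0 <= M by exact: le_trans (chiM 0).
have b1 : bounded_lip setT 1 (fun X : ST => chi X.2).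
  apply: (@bounded_lipW _ _ _ _ _ M M) => [X _|X Z _ _ _]; first exact: chiM.
  rewrite (le_trans (chiL _ _))// ler_wpM2l//.
  by have /spacetime_norm_leP[] := lexx `|Z - X|.
have b2 : bounded_lip setT 1 (fun X : ST => layer_cut X.1).
  apply: (@bounded_lipW _ _ _ _ _ 1 (40 / e * K)) => [X _|X Z _ _ _]; first exact: norm_step.
  rewrite (le_trans (layer_cut_lip _ _))// ler_wpM2l// ?mulr_ge0 ?invr_ge0 ?(ltW e0)//.
  by have /spacetime_norm_leP[] := lexx `|Z - X|.
have b3 : bounded_lip setT 1 (fun X : ST => far_cut X.1).
  apply: (@bounded_lipW _ _ _ _ _ 1 (50 * K)) => [X _|X Z _ _ _]; first exact: norm_step.
  rewrite (le_trans (far_cut_lip _ _))// ler_wpM2l// ?mulr_ge0//.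
  by have /spacetime_norm_leP[] := lexx `|Z - X|.
have [L L0 [h1 h2]] := bounded_lipM b1 (bounded_lipM b2 b3).
exists (2 * L); first by rewrite mulr_ge0.
have LL : L <= 2 * L by rewrite ler_peMl// ler1n.
split=> [X|X H]; first exact: le_trans (h1 X I) LL.
have [H1|H1] := leP `|H| 1.
  have XH : X + H - X = H by rewrite addrC addKr.
  have := h2 X (X + H) I I; rewrite XH => /(_ H1) h.
  by apply: (le_trans h); rewrite ler_wpM2r.
rewrite (le_trans (ler_normB _ _))//.
apply: (@le_trans _ _ (2 * L)); last by rewrite ler_peMr ?mulr_ge0// ltW.
have := h1 (X + H) I; have := h1 X I; rewrite -/(cutoff X) -/(cutoff (X + H)); lra.
Qed.

Lemma dstep_layer x : dstep (4 / e * depth Omega x - 1) != 0 -> e / 4 < depth Omega x < e / 2.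
Proof.
move=> h.
have h1 : 0 < 4 / e * depth Omega x - 1.
  by rewrite ltNge; apply/negP => /dstep_le0 h1; rewrite h1 eqxx in h.
have h2 : 4 / e * depth Omega x - 1 < 1.
  by rewrite ltNge; apply/negP => /dstep_ge1 h2; rewrite h2 eqxx in h.
have e4 : 0 < 4 / e by rewrite divr_gt0.
apply/andP; split; rewrite -(ltr_pM2l e4).
  by rewrite (_ : 4 / e * (e / 4) = 1); [lra|field; rewrite gt_eqF].
by rewrite (_ : 4 / e * (e / 2) = 2); [lra|field; rewrite gt_eqF].
Qed.

Lemma far_cut_derivative X a (t : nat -> R) : (forall m, 0 < t m) -> t @ \oo --> +oo ->
  seq_deriv t (evec a) X (fun Y => far_cut Y.1) (dfar_cut a X.1).
Proof.
move=> t0 too.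
apply: (@seq_deriv_quad_comp _ _ _ _ _ t0 too step dstep 8
  (fun Y => 2 - (r ^+ 2)^-1 * dotp Y.1 Y.1)); first exact: step_taylor.
apply: (@seq_deriv_quad_comp _ _ _ _ _ t0 too (fun u => 2 - (r ^+ 2)^-1 * u)
  (fun=> - (r ^+ 2)^-1) 0 (fun Y => dotp Y.1 Y.1)).
  by move=> u v; rewrite mul0r (_ : _ - _ = 0) ?normr0//; ring.
apply: (seq_deriv_space t0 too (f := fun x => dotp x x)) => eps eps0'.
apply/nbhs_ballP; exists (eps / K); first by rewrite /= divr_gt0.
move=> y; rewrite -ball_normE /= distrC => h _.
have -> : dotp y y - dotp X.1 X.1 - dotp (y - X.1) (2 *: X.1) = enorm (y - X.1) ^+ 2.
  rewrite sqr_enorm -(subrK X.1 y); move: (y - X.1) => z.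
  rewrite addrK !dotpDl !dotpDr dotpZr (dotpC X.1 z); ring.
rewrite ger0_norm ?exprn_ge0 ?enorm_ge0// expr2 ler_wpM2r ?enorm_ge0//.
by rewrite ltW// (lt_le_trans (enorm_lt h))// mulrC divfK ?pnatr_eq0.
Qed.

(** The collar is used only where the layer cutoff is not flat, that is between
    the distances e / 4 and e / 2. *)
Lemma cutoff_derivative (eps0 : R) : e <= eps0 -> regular_collar Omega eps0 ->
  {ae mu, forall X, forall a (t : nat -> R), (forall m, 0 < t m) -> t @ \oo --> +oo ->
     seq_deriv t (evec a) X cutoff (dcutoff a X)}.
Proof.
move=> ee0 hcol; apply: ae_imp (ae_space hcol) => X hX a t t0 too.
have daff (c d : R) : forall u v : R, `|(c * v + d) - (c * u + d) - c * (v - u)| <= 0 * (v - u) ^+ 2.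
  by move=> u v; rewrite mul0r (_ : _ - _ = 0) ?normr0//; ring.
apply: (seq_derivM t0 too); last apply: (seq_derivM t0 too).
- exact: seq_deriv_time.
- have [d0|d0] := eqVneq (dstep (4 / e * depth Omega X.1 - 1)) 0.
    rewrite /dlayer_cut d0 mul0r.
    apply: (@seq_deriv_flat _ _ _ _ _ t0 too step dstep 8 (4 / e * K)
      (fun Y => 4 / e * depth Omega Y.1 - 1)) => //; first exact: step_taylor.
      by rewrite mulr_ge0// divr_ge0// ltW.
    move=> H; rewrite (_ : _ - _ = 4 / e * (depth Omega (X.1 + H.1) - depth Omega X.1)); last first.
      by rewrite /=; ring.
    have e4 : 0 <= 4 / e by rewrite divr_ge0// ltW.
    rewrite normrM (ger0_norm e4) -[leRHS]mulrA ler_wpM2l// (le_trans (depth_lip_sup _ _ _))// ler_wpM2l//.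
    rewrite addrC addKr; by have /spacetime_norm_leP[] := lexx `|H|.
  have /andP[d1 d2] := dstep_layer d0.
  have Ox : Omega X.1.
    by apply: (@depth_gt0 _ _ Omega); apply: lt_trans d1; rewrite divr_gt0.
  have dd1 : depth Omega X.1 < 1.
    by rewrite (lt_trans d2)// ltr_pdivrMr// mul1r (lt_trans e1)// ltr1n.
  have [] := hX Ox.
    rewrite bdry_dist_depth// lte_fin (lt_trans d2)// (lt_le_trans _ ee0)//.
    by rewrite ltr_pdivrMr// ltr_pMr// ltr1n.
  move=> _ _ /(is_gradient_depth oO Ox dd1) hg.
  apply: (@seq_deriv_quad_comp _ _ _ _ _ t0 too step dstep 8
    (fun Y => 4 / e * depth Omega Y.1 - 1)); first exact: step_taylor.
  apply: (@seq_deriv_quad_comp _ _ _ _ _ t0 too (fun u => 4 / e * u - 1) (fun=> 4 / e) 0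
    (fun Y => depth Omega Y.1)); first exact: daff.
  exact: seq_deriv_space.
- exact: far_cut_derivative.
Qed.
End cutoff.

(** * Entropy flux through the cutoff layers *)

Lemma sum_option (V : nmodType) (k : nat) (F : option 'I_k -> V) :
  \sum_a F a = F None + \sum_j F (Some j).
Proof.
rewrite (bigD1 None)//=; congr (_ + _).
rewrite (reindex_omap Some id); last by case.
by apply: eq_bigl => j; rewrite /= eqxx.
Qed.

Lemma open_prod (U V : topologicalType) (A : set U) (B : set V) :
  open A -> open B -> open (A `*` B).
Proof.
move=> oA oB; rewrite openE => -[x t] [/= Ax Bt].
by exists (A, B) => //=; split; exact: open_nbhs_nbhs.
Qed.

Section inner_domain.
Context {R : realType} {k : nat}.
Notation ST := ('rV[R]_k * R)%type.
Notation mST := ('rV[R]_k * measurableTypeR R)%type.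
Notation mu := (@spacetime_lebesgue R k).
Notation K := (k.+1%:R : R).
Variable Omega : set 'rV[R]_k.
Hypothesis oO : open Omega.

Lemma continuous_enorm : continuous (@enorm R k).
Proof.
move=> x; apply: (iffRL (@cvgrPdist_lt _ R^o _ (nbhs x) _ (@enorm R k) (enorm x))) => e e0.
apply/nbhs_ballP; exists (e / K) => [|y]; first by rewrite /= divr_gt0.
rewrite -ball_normE /= => h; rewrite (le_lt_trans (enorm_lip _ _))//.
by rewrite (lt_le_trans (enorm_lt h))// mulrC divfK ?pnatr_eq0.
Qed.

Definition inner (c s : R) : set 'rV[R]_k := [set x | c < depth Omega x /\ enorm x < s].

Lemma open_inner c s : open (inner c s).
Proof.
apply: openI; first exact: open_depth_gt.
change (open (@enorm R k @^-1` [set u | u < s])).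
by apply: open_comp; [move=> x _; exact: continuous_enorm|exact: open_lt].
Qed.

Lemma closure_inner c s : closure (inner c s) `<=` [set x | c <= depth Omega x /\ enorm x <= s].
Proof.
have cl : closed [set x : 'rV[R]_k | c <= depth Omega x /\ enorm x <= s].
  apply: closedI; first exact: closed_depth_ge.
  change (closed (@enorm R k @^-1` [set u | u <= s])).
  by apply: closed_comp; [move=> x _; exact: continuous_enorm|exact: closed_le].
move: cl => /closure_id ->; apply: closureS => x [h1 h2]; split; exact: ltW.
Qed.

Lemma inner_compactly c s : 0 < c -> compactly_inside (inner c s) Omega.
Proof.
move=> c0; split; last first.
  by move=> x /closure_inner[h _]; apply: (@depth_gt0 _ _ Omega); exact: lt_le_trans h.
apply: bounded_closed_compact; last exact: closed_closure.
exists s; split; first exact: num_real.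
move=> M sM x /closure_inner[_ xs] /=.
by rewrite (le_trans (norm_le_enorm x))// (le_trans xs)// ltW.
Qed.

Lemma inner_prod_finite c s (T : R) : (mu (inner c s `*` `]0%R, T[ : set mST) < +oo)%E.
Proof.
pose B : R := Num.max 1 (Num.max s T).
have B0 : 0 < B by rewrite lt_max ltr01.
have : (mu (ball (0%R : ST) B : set mST) < +oo)%E by rewrite spacetime_lebesgue_ball// ltry.
apply: le_lt_trans; apply: le_measure; rewrite ?inE.
- apply: measurable_spacetime_open; apply: open_prod; first exact: open_inner.
  exact: interval_open.
- exact: measurable_spacetime_ball0.
move=> [x t] [[/= _ xs]]; rewrite in_itv /= => /andP[t0 tT].
rewrite -ball_normE /= sub0r normrN; apply/spacetime_norm_ltP; split => /=.
  by rewrite (le_lt_trans (norm_le_enorm x))// (lt_le_trans xs)// /B !le_max lexx orbT.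
by rewrite gtr0_norm// (lt_le_trans tT)// /B !le_max lexx !orbT.
Qed.

Lemma inner_depth c s c' s' d x y : inner c s x -> c' + K * d <= c -> s + K * d <= s' ->
  `|x - y| < d -> inner c' s' y.
Proof.
move=> [h1 h2] hc hs xy.
have h : enorm (x - y) < K * d by exact: enorm_lt.
have := depth_lip Omega x y; have := enorm_lip x y.
by rewrite !ler_norml => /andP[? ?] /andP[? ?]; split; lra.
Qed.
End inner_domain.

Section localized_estimate.
Context {R : realType} {k n : nat}.
Notation ST := ('rV[R]_k * R)%type.
Notation mST := ('rV[R]_k * measurableTypeR R)%type.
Notation mu := (@spacetime_lebesgue R k).
Notation K := (k.+1%:R : R).
Variables (O : set 'rV[R]_n) (G : option 'I_k -> 'I_n -> 'rV[R]_n -> R)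
  (DG : option 'I_k -> 'I_n -> 'rV[R]_n -> 'rV[R]_n)
  (Q : option 'I_k -> 'rV[R]_n -> R) (B : 'I_n -> 'rV[R]_n -> R)
  (DB : 'I_n -> 'rV[R]_n -> 'rV[R]_n) (C : R).
Hypotheses (cO : convex_set O) (ES : entropy_system O G DG Q B DB C).
Variables (Omega : set 'rV[R]_k) (T eps0 : R) (U : ST -> 'rV[R]_n).
Notation Dom := (Omega `*` `]0, T[ : set ST).
Hypotheses (oO : open Omega) (hcol : regular_collar Omega eps0)
  (UO : forall X, Dom X -> O (U X))
  (weak : forall psi : ST -> 'rV[R]_n, C1c Dom psi ->
    Rintegral mu Dom (fun X => \sum_a \sum_i ('D_(evec a) psi X) 0 i * G a i (U X)) = 0)
  (UL3 : forall Omega1 : set 'rV[R]_k, open Omega1 -> compactly_inside Omega1 Omega ->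
      L3 (Omega1 `*` `]0, T[) U)
  (U_regular : forall Omega1 : set 'rV[R]_k, open Omega1 -> compactly_inside Omega1 Omega ->
      limf_einf (cubic_modulus (Omega1 `*` `]0, T[) U) 0^'+ = 0%E).
Variables (e r : R) (chi : R^o -> R^o) (M rho : R).
Hypotheses (e0 : 0 < e) (e1 : e < 1) (ee0 : e <= eps0) (r1 : 1 <= r) (rho0 : 0 < rho)
  (dchi : forall s, derivable chi s 1) (chiM : forall s, `|chi s| <= M)
  (chiL : forall s u, `|chi u - chi s| <= M * `|u - s|)
  (chi_supp : forall s, chi s != 0 \/ (chi^`())%classic s != 0 -> rho <= s <= T - rho).
Let r0 : 0 < r. Proof. exact: lt_le_trans r1. Qed.
Notation phi := (cutoff Omega e r chi).

(** The cutoff is supported at depth at least e / 4 and at times in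
    [rho, T - rho], which leaves room for P and D around its support. *)
Let D : set ST := inner Omega (e / 16) (2 * r + 2) `*` `]0, T[.
Let P : set ST := inner Omega (e / 8) (2 * r + 1) `*` `]rho / 2, T - rho / 2[.

Let e16 : 0 < e / 16. Proof. by rewrite divr_gt0. Qed.
Let e8 : 0 < e / 8. Proof. by rewrite divr_gt0. Qed.

Let oP : open P.
Proof. by apply: open_prod; [exact: open_inner|exact: interval_open]. Qed.
Let mP : measurable (P : set mST). Proof. exact: measurable_spacetime_open. Qed.
Let mD : measurable (D : set mST).
Proof. by apply: measurable_spacetime_open; apply: open_prod; [exact: open_inner|exact: interval_open]. Qed.

Let PD : P `<=` D.
Proof.
move=> [x t] [[/= h1 h2]]; rewrite in_itv /= => /andP[t1 t2]; split; last first.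
  by rewrite /= in_itv /=; apply/andP; have := rho0; split; lra.
by split => /=; have := e0; lra.
Qed.

Let DDom : D `<=` Dom.
Proof.
move=> [x t] [[/= h1 h2] ht]; split => //=.
by apply: (@depth_gt0 _ _ Omega); exact: lt_trans h1.
Qed.

Let UOD X : D X -> O (U X). Proof. by move=> /DDom; exact: UO. Qed.

Let Kc : set ST := closure (inner Omega (e / 8) (2 * r + 1)) `*` `[rho / 2, T - rho / 2].

Let cKc : compact Kc.
Proof.
by apply: compact_setX; [have [] := inner_compactly Omega (2 * r + 1) e8|exact: segment_compact].
Qed.

Let KcDom : Kc `<=` Dom.
Proof.
move=> [x t] [/= hx]; rewrite in_itv /= => /andP[t1 t2]; split => /=.
  by have [_] := inner_compactly Omega (2 * r + 1) e8; apply.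
by rewrite in_itv /=; apply/andP; have := rho0; split; lra.
Qed.

Let PKc : P `<=` Kc.
Proof.
move=> [x t] [/= hx]; rewrite in_itv /= => /andP[t1 t2]; split => /=.
  exact: subset_closure.
by rewrite in_itv /= !ltW.
Qed.

Let hL3 : L3 D U.
Proof. by apply: UL3; [exact: open_inner|exact: inner_compactly]. Qed.

Let mU : measurable_fun (D : set mST) U. Proof. by have [] := hL3. Qed.

Let U3 : rint mu D (fun X => `|U X| ^+ 3).
Proof.
have [_ h] := hL3.
apply/integrableP; split.
  apply/measurable_EFinP; apply: measurable_funX.
  by apply: measurable_norm_comp; [exact: mD|exact: mU].
apply: le_lt_trans h; apply: le_integral_sub => [X _|X _|X DX _] /=.
- by rewrite ?lee_fin ?normr_ge0 ?abse_ge0.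
- by rewrite lee_fin exprn_ge0// enorm_ge0.
split=> //; rewrite lee_fin normrX normr_id.
by rewrite lerXn2r ?nnegrE ?enorm_ge0// norm_le_enorm.
Qed.

Let rr : R := Num.min (e / 16 / K) (rho / 2).
Let rr0 : 0 < rr. Proof. by rewrite lt_min !divr_gt0. Qed.
Let rrK : K * rr <= e / 16.
Proof. by rewrite mulrC -ler_pdivlMr// ge_min lexx. Qed.
Let rrrho : rr <= rho / 2. Proof. by rewrite ge_min lexx orbT. Qed.

Let Pdeep Y X : P Y -> `|Y - X| < rr -> D X.
Proof.
move=> [hY]; rewrite /= in_itv /= => /andP[t1 t2] /spacetime_norm_ltP[/= d1 d2]; split.
  by apply: (inner_depth hY _ _ d1); have := rrK; have := e0; have := e1; lra.
rewrite /= in_itv /=; apply/andP.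
by move: d2; rewrite ltr_norml => /andP[? ?]; have := rrrho; split; lra.
Qed.

Lemma cutoff_support X : chi X.2 != 0 \/ (chi^`())%classic X.2 != 0 ->
  layer_cut Omega e X.1 != 0 -> far_cut r X.1 != 0 ->
  inner Omega (e / 4) (2 * r) X.1 /\ rho <= X.2 <= T - rho.
Proof.
move=> hchi hl hf; split; last exact: chi_supp.
split; last by rewrite ltNge; apply/negP => /(far_cut_eq0 r1) h; rewrite h eqxx in hf.
rewrite ltNge; apply/negP => h; move: hl; rewrite /layer_cut step_le0 ?eqxx// subr_le0.
apply: (@le_trans _ _ (4 / e * (e / 4))); last by rewrite (_ : _ * _ = 1)//; field; rewrite gt_eqF.
by rewrite ler_wpM2l// divr_ge0// ltW.
Qed.

Let phi_supp X Y : phi X != 0 -> `|X - Y| < rr -> P Y.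
Proof.
rewrite /cutoff !mulf_eq0 !negb_or => /andP[h1 /andP[h2 h3]].
have [hX /andP[t1 t2]] := cutoff_support (or_introl h1) h2 h3.
move=> /spacetime_norm_ltP[/= d1 d2]; split.
  by apply: (inner_depth hX _ _ d1); have := rrK; have := e0; have := e1; lra.
rewrite /= in_itv /=; apply/andP.
by move: d2; rewrite ltr_norml => /andP[? ?]; have := rrrho; split; lra.
Qed.

Notation dphi := (upper_deriv phi).

Let dphi_facts : exists2 C1 : R, 0 <= C1 & forall a,
  measurable_fun setT (dphi a : mST -> R) /\ forall X, `|dphi a X| <= C1.
Proof.
have [C1 C10 [_ hl]] := cutoff_bounds Omega e0 r1 chiM chiL.
by exists C1 => // a; split; [exact: measurable_upper_deriv _ hl|exact: norm_upper_deriv _ hl].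
Qed.

Let nat_steps : (forall m : nat, 0 < m.+1%:R :> R) /\ (fun m : nat => m.+1%:R : R) @ \oo --> +oo.
Proof. by split=> //; rewrite (cvg_shiftS (fun m : nat => m%:R : R)); exact: cvgr_idn. Qed.

Let dphi_ae : {ae mu, forall X, forall a, dphi a X = dcutoff Omega e r chi a X}.
Proof.
apply: (@ae_imp _ mST R mu _ _ _ (cutoff_derivative r oO e0 e1 dchi ee0 hcol)) => X h a.
apply: upper_derivE; have [h1 h2] := nat_steps; exact: h.
Qed.

Let dphi_time X : dphi None X = (chi^`())%classic X.2 * (layer_cut Omega e X.1 * far_cut r X.1).
Proof.
apply: upper_derivE; have [h1 h2] := nat_steps.
suff : seq_deriv (fun m => m.+1%:R) (evec None) X phi
    ((chi^`())%classic X.2 * (layer_cut Omega e X.1 * far_cut r X.1) + chi X.2 * 0).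
  by rewrite mulr0 addr0.
apply: (seq_derivM h1 h2 (f := fun Y => chi Y.2)
  (g := fun Y => layer_cut Omega e Y.1 * far_cut r Y.1)).
  exact: (@seq_deriv_time _ _ _ None X h1 h2 chi (@dchi X.2)).
apply: (@eq_cvg_seq _ (fun=> 0)); last exact: cvg_cst.
by move=> m; rewrite /= scaler0 addr0 subrr mulr0.
Qed.

(** The local balance for the weight phi, on nested subdomains with margins
    proportional to e. *)
Lemma localized_balance :
  \sum_a Rintegral mu P (fun Y => dphi a Y * Q a (U Y)) = 0.
Proof.
have [C1 C10 [hb hl]] := cutoff_bounds Omega e0 r1 chiM chiL.
apply: (@local_entropy_balance _ _ _ O G DG Q B DB C cO ES U D mD _ mU UOD U3 P rr phi
  (fun a => dphi a) C1 rr0 oP PD Pdeep phi_supp hb hl _ _ _ Dom Kc cKc KcDom PKc DDom weak).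
- exact: inner_prod_finite.
- by move=> a; exact: measurable_upper_deriv _ hl.
- by move=> a X; exact: norm_upper_deriv _ hl _.
- apply: (@ae_imp _ mST R mu _ _ _ (cutoff_derivative r oO e0 e1 dchi ee0 hcol)) => X h a t t0 too.
  rewrite (upper_derivE (d := dcutoff Omega e r chi a X)); first exact: h.
  by have [h1 h2] := nat_steps; exact: h.
- by apply: U_regular; [exact: open_inner|exact: inner_compactly].
Qed.

Variables (q : 'rV[R]_n -> 'rV[R]_k) (rinf : R).
Hypotheses (Qq : forall V j, Q (Some j) V = q V 0 j) (rinfr : rinf <= r)
  (iq : mu.-integrable ([set x | Omega x /\ rinf < enorm x] `*` `]0, T[ : set mST)
    (fun X => (enorm (q (U X)))%:E)).
Notation Sinf := ([set x | Omega x /\ rinf < enorm x] `*` `]0, T[ : set ST).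

Let far_part (X : ST) : R := chi X.2 * (layer_cut Omega e X.1 *
  \sum_(j < k) dfar_cut r (Some j) X.1 * q (U X) 0 j).
Let layer_part (X : ST) : R := \sum_j dphi (Some j) X * q (U X) 0 j - far_part X.

Let i_Q a : rint mu P (fun X => Q a (U X)).
Proof.
apply: (rintS mD mP PD); apply: (rint_Q ES mD _ mU UOD U3).
exact: inner_prod_finite.
Qed.

Let i_q j : rint mu P (fun X => q (U X) 0 j).
Proof.
apply: (@eq_rint _ mST R mu _ (fun X => Q (Some j) (U X))); [exact: mP| |exact: i_Q].
by move=> X _; rewrite Qq.
Qed.

Lemma measurable_layer_cut : measurable_fun setT (fun X : mST => layer_cut Omega e X.1).
Proof.
apply: continuous_measurable_spacetime; first exact: openT.
move=> X _; apply: (continuous_of_lip ltr01 (L := 40 / e * K)) => Y H _.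
rewrite (le_trans (layer_cut_lip _ e0 _ _))// ler_wpM2l// ?mulr_ge0 ?invr_ge0 ?(ltW e0)//.
rewrite addrC addKr; by have /spacetime_norm_leP[] := lexx `|H|.
Qed.

Lemma far_cut_lip_spacetime (X H : ST) : `|far_cut r (X + H).1 - far_cut r X.1| <= 50 * K * `|H|.
Proof.
rewrite (le_trans (far_cut_lip r1 _ _))// ler_wpM2l// ?mulr_ge0//.
rewrite addrC addKr; by have /spacetime_norm_leP[] := lexx `|H|.
Qed.

Lemma measurable_far_cut : measurable_fun setT (fun X : mST => far_cut r X.1).
Proof.
apply: continuous_measurable_spacetime; first exact: openT.
by move=> X _; apply: (continuous_of_lip ltr01 (L := 50 * K)) => Y H _; exact: far_cut_lip_spacetime.
Qed.

Let measurable_chi : measurable_fun setT (fun X : mST => chi X.2).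
Proof.
apply: continuous_measurable_spacetime; first exact: openT.
have M0 : 0 <= M by exact: le_trans (chiM 0).
move=> X _; apply: (continuous_of_lip ltr01 (L := M)) => Y H _.
rewrite (le_trans (chiL _ _))// ler_wpM2l//.
rewrite addrC addKr; by have /spacetime_norm_leP[] := lexx `|H|.
Qed.

Let dfarE j (X : ST) : upper_deriv (fun Y : ST => far_cut r Y.1) (Some j) X = dfar_cut r (Some j) X.1.
Proof.
apply: upper_derivE; have [h1 h2] := nat_steps; exact: far_cut_derivative.
Qed.

Let i_far : rint mu P far_part.
Proof.
apply: (@rintMb _ mST R mu _ _ _ M); [exact: mP|exact: measurable_funTS|by move=> X _; exact: chiM|].
apply: (@rintMb _ mST R mu _ _ _ 1);
  [exact: mP|by apply: measurable_funTS; exact: measurable_layer_cut|by move=> X _; exact: norm_step|].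
apply: rint_sum; first exact: mP.
move=> j; apply: (@rintMb _ mST R mu _ _ _ (50 * K)); [exact: mP| | |exact: i_q].
  apply: measurable_funTS; under eq_fun do rewrite -dfarE.
  exact: measurable_upper_deriv _ far_cut_lip_spacetime.
by move=> X _; rewrite -dfarE; exact: norm_upper_deriv _ far_cut_lip_spacetime _.
Qed.

Let i_dphi a : rint mu P (fun X => dphi a X * Q a (U X)).
Proof.
have [C1 _ /(_ a)[h1 h2]] := dphi_facts.
apply: (@rintMb _ mST R mu _ _ _ C1); [exact: mP|exact: measurable_funTS| |exact: i_Q].
by move=> X _; exact: h2.
Qed.

Let i_layer : rint mu P layer_part.
Proof.
apply: rintB; [exact: mP| |exact: i_far].
apply: rint_sum; first exact: mP.
move=> j; apply: (@eq_rint _ mST R mu _ (fun X => dphi (Some j) X * Q (Some j) (U X))).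
- exact: mP.
- by move=> X _; rewrite Qq.
- exact: i_dphi.
Qed.

Let time_part_le :
  `|Rintegral mu P (fun X => (chi^`())%classic X.2 *
      (layer_cut Omega e X.1 * far_cut r X.1) * Q None (U X))| <=
  Rintegral mu P (fun X => `|far_part X|) + Rintegral mu P (fun X => `|layer_part X|).
Proof.
have -> : Rintegral mu P (fun X => (chi^`())%classic X.2 *
      (layer_cut Omega e X.1 * far_cut r X.1) * Q None (U X)) =
   - Rintegral mu P (fun X => far_part X + layer_part X).
  apply/eqP; rewrite -addr_eq0 -[X in _ == X]localized_balance sum_option; apply/eqP.
  congr (_ + _).
    by apply: eq_RintegralS => X _; rewrite dphi_time.
  transitivity (Rintegral mu P (fun X => \sum_j dphi (Some j) X * Q (Some j) (U X))).
    apply: eq_RintegralS => X _; rewrite /layer_part addrC subrK.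
    by apply: eq_bigr => j _; rewrite Qq.
  rewrite Rintegral_sum; [by []|exact: mP|move=> j; exact: i_dphi].
rewrite normrN -RintegralD; [|exact: mP|by apply: rint_norm; [exact: mP|exact: i_far]
  |by apply: rint_norm; [exact: mP|exact: i_layer]].
apply: norm_Rintegral_le; first exact: mP.
- by apply: rint_measurable; apply: rintD; [exact: mP|exact: i_far|exact: i_layer].
- by apply: rintD; [exact: mP|apply: rint_norm; [exact: mP|exact: i_far]
  |apply: rint_norm; [exact: mP|exact: i_layer]].
- by move=> X _; exact: ler_normD.
Qed.

(** Where the far cutoff varies, |x| is comparable to r, so that its gradient is
    at most 8 / r there. *)
Let far_part_le X : P X -> far_part X != 0 ->
  Sinf X /\ `|far_part X| <= 8 * M / r * enorm (q (U X)).
Proof.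
move=> PX.
have -> : far_part X = chi X.2 * (layer_cut Omega e X.1 *
    (dstep (2 - (r ^+ 2)^-1 * dotp X.1 X.1) * (- (r ^+ 2)^-1 * (2 * dotp X.1 (q (U X)))))).
  rewrite /far_part; congr (_ * (_ * _)).
  set s := dstep _; have -> : dotp X.1 (q (U X)) = \sum_(j < k) X.1 0 j * q (U X) 0 j by [].
  rewrite !mulr_sumr; apply: eq_bigr => j _; rewrite /dfar_cut -/s mxE; ring.
rewrite !mulf_eq0 !negb_or => /andP[_ /andP[_ /andP[ds _]]].
have M0 : 0 <= M by exact: le_trans (chiM 0).
have r2 : 0 < (r ^+ 2)^-1 by rewrite invr_gt0 exprn_gt0.
have s1 : r < enorm X.1.
  rewrite ltNge; apply/negP => h; move: ds; rewrite dstep_ge1 ?eqxx//.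
  suff : (r ^+ 2)^-1 * dotp X.1 X.1 <= 1 by lra.
  by rewrite ler_pdivrMl ?exprn_gt0// mulr1 -sqr_enorm lerXn2r ?nnegrE ?enorm_ge0// ltW.
have s2 : enorm X.1 <= 2 * r.
  rewrite leNgt; apply/negP => h; move: ds; rewrite dstep_le0 ?eqxx//.
  suff : 2 <= (r ^+ 2)^-1 * dotp X.1 X.1 by lra.
  rewrite ler_pdivlMl ?exprn_gt0// -sqr_enorm.
  have h2 : (2 * r) ^+ 2 <= enorm X.1 ^+ 2 by rewrite lerXn2r ?nnegrE ?enorm_ge0 ?mulr_ge0// ltW.
  by rewrite (le_trans _ h2)// exprMn mulrC ler_wpM2r ?exprn_ge0 ?(ltW r0)// -natrX ler_nat.
split.
  have [OX tX] := DDom (PD PX); split => //=; split; first exact: OX.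
  exact: le_lt_trans s1.
rewrite !normrM normrN (gtr0_norm r2) (ger0_norm (_ : 0 <= 2))//.
have h1 := chiM X.2; have h2 := norm_step (4 / e * depth Omega X.1 - 1).
have h3 := norm_dstep (2 - (r ^+ 2)^-1 * dotp X.1 X.1).
have h4 : `|dotp X.1 (q (U X))| <= 2 * r * enorm (q (U X)).
  by rewrite (le_trans (cauchy_schwarz _ _))// ler_wpM2r ?enorm_ge0.
apply: (@le_trans _ _ (M * (1 * (2 * ((r ^+ 2)^-1 * (2 * (2 * r * enorm (q (U X))))))))).
  do 3! (apply: ler_pM => //; try by rewrite !mulr_ge0 ?(ltW r2)).
  by rewrite ler_wpM2l ?(ltW r2)// ler_wpM2l.
by rewrite le_eqVlt; apply/orP; left; apply/eqP; field; rewrite gt_eqF.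
Qed.

Let far_integral_le : Rintegral mu P (fun X => `|far_part X|) <=
  8 * M / r * Rintegral mu Sinf (fun X => enorm (q (U X))).
Proof.
have M0 : 0 <= M by exact: le_trans (chiM 0).
have c0 : 0 <= 8 * M / r by rewrite divr_ge0 ?mulr_ge0// ltW.
have mS : measurable (Sinf : set mST).
  apply: measurable_spacetime_open; apply: open_prod; last exact: interval_open.
  apply: openI => //; change (open (@enorm R k @^-1` [set u | rinf < u])).
  by apply: open_comp; [move=> x _; exact: continuous_enorm|exact: open_gt].
have iq' : rint mu (Sinf : set mST) (fun X => enorm (q (U X))) by exact: iq.
rewrite -RintegralZl; [|exact: mS|exact: iq'].
rewrite -lee_fin -EFin_Rintegral; [|exact: mP|by apply: rint_norm; [exact: mP|exact: i_far]].
rewrite -EFin_Rintegral; [|exact: mS|by apply: rintZl; [exact: mS|exact: iq']].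
apply: le_integral_sub => [X _|X _|X PX h].
- by rewrite lee_fin normr_ge0.
- by rewrite lee_fin mulr_ge0 ?enorm_ge0.
rewrite lee_fin; apply: far_part_le => //.
by apply: contra h => /eqP ->; rewrite normr0.
Qed.

(** Where layer_cut varies, its gradient is the normal at the nearest boundary
    point times a factor at most 8 / e, up to a null set. *)
Let layer_part_le : exists2 N : set mST, measurable N /\ mu N = 0%E & forall X, P X -> ~ N X ->
  layer_part X != 0 ->
  [/\ X.2 \in `]0, T[, Omega X.1, ((e / 4)%:E <= bdry_dist Omega X.1 <= (e / 2)%:E)%E &
    `|layer_part X| <= 8 * M / e *
      `|dotp (q (U X)) (outer_normal Omega (bdry_proj Omega X.1))|].
Proof.
have [N [mN N0 hN]] := dphi_ae.
exists N => // X PX NX.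
have dE a : dphi a X = dcutoff Omega e r chi a X.
  by have : ~ ~ (forall a, dphi a X = dcutoff Omega e r chi a X);
    [move=> h; apply: NX; exact: hN|move=> /contrapT; apply].
have -> : layer_part X = chi X.2 * (far_cut r X.1 * (dstep (4 / e * depth Omega X.1 - 1) *
    (4 / e * - dotp (q (U X)) (normal_at Omega X.1)))).
  rewrite /layer_part /far_part (eq_bigr _ (fun j _ => congr2 _ (dE (Some j)) erefl)).
  set s := dstep _; set l := layer_cut _ _ _; set f := far_cut _ _.
  have -> : dotp (q (U X)) (normal_at Omega X.1) =
    \sum_(j < k) q (U X) 0 j * normal_at Omega X.1 0 j by [].
  rewrite -sumrN !mulr_sumr -sumrB; apply: eq_bigr => j _.
  by rewrite /dcutoff /dlayer_cut -/s -/l -/f mxE; ring.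
rewrite !mulf_eq0 !negb_or => /andP[_ /andP[_ /andP[ds _]]].
have /andP[d1 d2] := dstep_layer e0 ds.
have [OX tX] := DDom (PD PX).
have dd1 : depth Omega X.1 < 1.
  by rewrite (lt_trans d2)// ltr_pdivrMr// mul1r (lt_trans e1)// ltr1n.
have M0 : 0 <= M by exact: le_trans (chiM 0).
have e4 : 0 <= 4 / e by rewrite divr_ge0// ltW.
split=> //; first by rewrite bdry_dist_depth// !lee_fin !ltW.
rewrite !normrM (ger0_norm (_ : 0 <= 4))// (ger0_norm (_ : 0 <= e^-1)) ?invr_ge0 ?(ltW e0)//.
rewrite normrN; set z := `|dotp _ _|.
have z0 : 0 <= z by exact: normr_ge0.
apply: (@le_trans _ _ (M * (1 * (2 * (4 / e * z))))).
  apply: ler_pM => //; first by rewrite !mulr_ge0 ?invr_ge0 ?(ltW e0).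
  apply: ler_pM => //; first by rewrite !mulr_ge0 ?invr_ge0 ?(ltW e0).
    exact: norm_step.
  by rewrite ler_wpM2r ?norm_dstep// mulr_ge0.
by rewrite le_eqVlt; apply/orP; left; apply/eqP; field; rewrite gt_eqF.
Qed.

(** Tonelli's theorem compares the space-time integral with the iterated integral of the boundary
    flux, whose integrand is not known to be measurable. *)
Let flux_integral_le :
  (((8 * M + 1)^-1 * Rintegral mu P (fun X => `|layer_part X|))%:E <= bdry_flux Omega T q U e)%E.
Proof.
have M0 : 0 <= M by exact: le_trans (chiM 0).
have c0 : 0 < 8 * M + 1 by rewrite ltr_wpDl// mulr_ge0.
have [N [mN N0] hN] := layer_part_le.
pose h (X : mST) : R := (8 * M + 1)^-1 * `|layer_part X|.
pose g : mST -> R := h \_ (P `\` N).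
have mPN : measurable ((P : set mST) `\` N) by exact: measurableD.
have i_h : rint mu P h.
  by apply: rintZl; [exact: mP|apply: rint_norm; [exact: mP|exact: i_layer]].
have i_g : rint mu setT g.
  apply: rint_patch; first exact: mPN.
  by apply: (rintS mP mPN _ i_h) => X [].
have hE : Rintegral mu P h = Rintegral mu setT g.
  rewrite /g -Rintegral_mkcond [RHS]Rintegral_mkcond [LHS]Rintegral_mkcond.
  apply: eq_Rintegral_ae.
  - exact: measurableT.
  - by apply: rint_measurable; apply: rint_patch; [exact: mP|exact: i_h].
  - apply: rint_measurable; exact: i_g.
  exists N; split=> // X /= hX; apply: contrapT => NX; apply: hX => _.
  rewrite /patch; case: (boolP (X \in P)) => [/set_mem PX|/negP nP].
    by rewrite mem_set.
  by rewrite memNset// => -[PX _]; apply: nP; exact: mem_set.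
rewrite -RintegralZl; [|exact: mP|by apply: rint_norm; [exact: mP|exact: i_layer]].
rewrite -/h hE -EFin_Rintegral; [|exact: measurableT|exact: i_g].
have g0 X : 0 <= g X.
  by rewrite /g /patch; case: ifP => // _; rewrite mulr_ge0 ?invr_ge0// ltW.
have mg : measurable_fun setT (EFin \o g) by exact/measurable_EFinP/rint_measurable/i_g.
have flux x t : g (x, t) != 0 -> [/\ t \in `]0, T[, Omega x,
    ((e / 4)%:E <= bdry_dist Omega x <= (e / 2)%:E)%E &
    g (x, t) <= e^-1 * `|dotp (q (U (x, t))) (outer_normal Omega (bdry_proj Omega x))|].
  rewrite /g /patch; case: ifPn => [/set_mem[PX NX] h0|]; last by rewrite eqxx.
  have l0 : layer_part (x, t) != 0.
    by apply: contra h0 => /eqP l0; rewrite /h l0 normr0 mulr0.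
  have [h1 h2 h3 h4] := hN _ PX NX l0; split=> //.
  rewrite /h ler_pdivrMl// (le_trans h4)//.
  rewrite -/(8 * M / e) mulrA -[_ / e]/(8 * M * e^-1) ler_wpM2r// ler_wpM2r ?invr_ge0 ?(ltW e0)//.
  by rewrite lerDl.
rewrite /spacetime_lebesgue (@fubini_tonelli2 _ _ _ _ _ (rV_lebesgue k) (@lebesgue_measure R) (EFin \o g) mg); last first.
  by move=> X; rewrite lee_fin.
apply: le_integral_sub => [t _|t _|t _ ht].
- by apply: integral_ge0 => x _; rewrite lee_fin.
- apply: mule_ge0; first by rewrite lee_fin invr_ge0 ltW.
  by apply: integral_ge0 => x _; rewrite lee_fin.
have [x gx] : exists x, g (x, t) != 0.
  apply: contrapT => hx; move: ht; rewrite /fubini_G integral0_eq ?eqxx// => x _ /=.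
  by congr EFin; apply: contrapT => /eqP gx; apply: hx; exists x.
have [tT _ _ _] := flux _ _ gx; split; first exact: tT.
have m1 : measurable_fun setT (fun x => (e * g (x, t))%:E).
  apply/measurable_EFinP; apply: measurable_funM; first exact: measurable_cst.
  by apply/measurable_EFinP; exact: (measurableT_comp mg (measurable_pair2 t)).
have -> : fubini_G (rV_lebesgue k) (EFin \o g) t =
    ((e^-1)%:E * \int[rV_lebesgue k]_x (e * g (x, t))%:E)%E.
  rewrite -ge0_integralZl_EFin//.
  - by apply: eq_integral => y _; rewrite -EFinM mulKf// gt_eqF.
  - by move=> y _; rewrite lee_fin mulr_ge0// ltW.
  - by rewrite invr_ge0 ltW.
apply: lee_wpmul2l; first by rewrite lee_fin invr_ge0 ltW.
apply: le_integral_sub => [y _|y _|y _ hy].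
- by rewrite lee_fin mulr_ge0// ltW.
- by rewrite lee_fin.
have gy : g (y, t) != 0 by apply: contra hy => /eqP ->; rewrite mulr0.
have [_ Oy hd hle] := flux _ _ gy; split=> //.
by rewrite lee_fin -ler_pdivlMl// mulrC -[leRHS]mulrC.
Qed.

(** The entropy balance of the cut-off region, with both boundary contributions
    bounded. *)
Lemma localized_estimate (b : R) : (bdry_flux Omega T q U e <= b%:E)%E ->
  `|Rintegral mu Dom (fun X => layer_cut Omega e X.1 * far_cut r X.1 *
     ((chi^`())%classic X.2 * Q None (U X)))| <=
  8 * M / r * Rintegral mu Sinf (fun X => enorm (q (U X))) + (8 * M + 1) * b.
Proof.
move=> hb; have M0 : 0 <= M by exact: le_trans (chiM 0).
have c0 : 0 < 8 * M + 1 by rewrite ltr_wpDl// mulr_ge0.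
have -> : Rintegral mu Dom (fun X => layer_cut Omega e X.1 * far_cut r X.1 *
     ((chi^`())%classic X.2 * Q None (U X))) =
   Rintegral mu P (fun X => (chi^`())%classic X.2 *
      (layer_cut Omega e X.1 * far_cut r X.1) * Q None (U X)).
  rewrite Rintegral_mkcond [RHS]Rintegral_mkcond; apply: eq_RintegralS => X _.
  rewrite /patch; case: (boolP (X \in P)) => [/set_mem PX|/negP nP].
    by rewrite mem_set; [ring|exact: DDom (PD PX)].
  case: ifP => // _; apply: contrapT => /eqP.
  rewrite !mulf_eq0 !negb_or => /andP[/andP[h1 h2] /andP[h3 _]].
  have [[h4 h5] /andP[t1 t2]] := cutoff_support (or_intror h3) h1 h2.
  apply: nP; apply/mem_set; split; first by split; have := e0; lra.
  by rewrite /= in_itv /=; apply/andP; have := rho0; split; lra.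
apply: (le_trans time_part_le); apply: lerD; first exact: far_integral_le.
have := le_trans flux_integral_le hb.
by rewrite lee_fin ler_pdivrMl.
Qed.
End localized_estimate.

(** * Conservation of entropy *)

(** The positive or the negative part has an infinite integral, so the extended integral is
    infinite and its real part is 0 by convention. *)
Lemma Rintegral_not_integrable d (T : measurableType d) (R : realType)
    (mu : {measure set T -> \bar R}) (D : set T) (f : T -> R) : measurable D ->
  measurable_fun D f -> ~ rint mu D f -> Rintegral mu D f = 0.
Proof.
move=> mD mf nf; rewrite /Rintegral integralE.
have mF : measurable_fun D (EFin \o f) by exact/measurable_EFinP.
set p := (\int[mu]_(x in D) _)%E; set m := (\int[mu]_(x in D) _)%E.
have p0 : (0 <= p)%E by apply: integral_ge0.
have m0 : (0 <= m)%E by apply: integral_ge0.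
have pm : (p + m = +oo)%E.
  apply/eqP; rewrite eq_le leey leNgt; apply/negP => h; apply: nf.
  apply/integrableP; split=> //.
  rewrite (_ : (fun x => `|(EFin \o f) x|%E) = (fun x => (EFin \o f)^\+ x + (EFin \o f)^\- x)%E).
    rewrite ge0_integralD//; [exact: measurable_funepos|exact: measurable_funeneg].
  by rewrite -/(abse \o (EFin \o f)) fune_abse.
by move: p m p0 m0 pm => [p||] [m||].
Qed.

Section exhaustion.
Context {R : realType} {k n : nat}.
Notation ST := ('rV[R]_k * R)%type.
Notation mST := ('rV[R]_k * measurableTypeR R)%type.
Variable Omega : set 'rV[R]_k.
Hypothesis oO : open Omega.

Lemma depth_pos x : Omega x -> 0 < depth Omega x.
Proof.
move=> Ox; have /nbhs_ballP[r /= r0 hr] : nbhs x Omega by exact: open_nbhs_nbhs.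
apply: (@lt_le_trans _ _ (Num.min r 1)); first by rewrite lt_min r0 ltr01.
apply: lb_le_inf; first by exists 1; right.
move=> _ [[y Oy <-]|->]; last by rewrite ge_min lexx orbT.
rewrite ge_min; apply/orP; left; rewrite leNgt; apply/negP => h; apply: Oy.
by apply: hr; rewrite -ball_normE /=; exact: le_lt_trans (norm_le_enorm _) h.
Qed.

(** Omega is a countable union of compactly contained open sets. *)
Lemma measurable_local (T : R) (U : ST -> 'rV[R]_n) :
  (forall Omega1 : set 'rV[R]_k, open Omega1 -> compactly_inside Omega1 Omega ->
     measurable_fun (Omega1 `*` `]0, T[ : set mST) U) ->
  measurable_fun (Omega `*` `]0, T[ : set mST) U.
Proof.
move=> hU.
have -> : (Omega `*` `]0, T[ : set mST) =
    \bigcup_m (inner Omega m.+1%:R^-1 m.+1%:R `*` `]0, T[ : set mST).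
  apply/seteqP; split=> [[x t] [/= Ox ht]|[x t] [m _ [[/= hd _] ht]]]; last first.
    split=> //; apply: (@depth_gt0 _ _ Omega); apply: lt_trans hd.
    by rewrite invr_gt0.
  have d0 := depth_pos Ox.
  have [m hm] := ltr_add_invr (y := 0) (x := depth Omega x) d0.
  pose p := maxn m (Num.truncn (enorm x)).
  exists p => //; split=> //; split=> /=.
    rewrite add0r in hm; apply: le_lt_trans hm.
    by rewrite lef_pV2 ?posrE// ler_nat ltnS leq_maxl.
  apply: (lt_le_trans (truncnS_gt (enorm x))).
  by rewrite ler_nat ltnS leq_maxr.
apply/measurable_fun_bigcup => [m|m].
- apply: measurable_spacetime_open; apply: open_prod; first exact: open_inner.
  exact: interval_open.
- apply: hU; first exact: open_inner.
  by apply: inner_compactly; rewrite invr_gt0.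
Qed.
End exhaustion.

Theorem theorem4p1 (R : realType) (k n : nat)
    (Omega : set 'rV[R]_k) (T : R) (O : set 'rV[R]_n)
    (A : 'rV[R]_n -> 'rV[R]_n) (F : 'rV[R]_n -> 'M[R]_(n, k))
    (eta : 'rV[R]_n -> R) (q : 'rV[R]_n -> 'rV[R]_k) (B : 'rV[R]_n -> 'rV[R]_n)
    (U : 'rV[R]_k * R -> 'rV[R]_n)
    (Omega_open : open Omega)
    (bdry_bounded : bounded_set (bdry Omega))
    (bdry_lipschitz : lipschitz_boundary Omega)
    (collar : exists eps0 : R, 0 < eps0 /\ regular_collar Omega eps0)
    (T_gt0 : 0 < T)
    (O_convex : convex_set O)
    (A_C2 : forall i, C2_on (closure O) (fun V => A V 0 i))
    (F_C2 : forall i j, C2_on (closure O) (fun V => F V i j))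
    (eta_C1 : C1_on O eta)
    (q_C1 : forall j, C1_on O (fun V => q V 0 j))
    (B_C1 : forall i, C1_on O (fun V => B V 0 i))
    (DB_bounded : exists M : R, forall V, O V -> forall i l,
      `|partial O l (fun W => B W 0 i) V| <= M)
    (growth : exists C : R, forall V, O V ->
      enorm (B V) <= C * (1 + enorm V) /\
      `|eta V| + enorm (q V) <= C * (1 + enorm V ^+ 3))
    (D2A_bounded : exists M : R, forall V, O V -> forall i j l,
      `|partial (closure O) i (partial (closure O) j (fun W => A W 0 l)) V| <= M)
    (D2F_bounded : exists M : R, forall V, O V -> forall i j l m,
      `|partial (closure O) i (partial (closure O) j (fun W => F W l m)) V| <= M)
    (D_eta : forall V, O V -> forall l, partial O l eta V =
      \sum_(i < n) B V 0 i * partial (closure O) l (fun W => A W 0 i) V)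
    (D_q : forall V, O V -> forall j l, partial O l (fun W => q W 0 j) V =
      \sum_(i < n) B V 0 i * partial (closure O) l (fun W => F W i j) V)
    (U_in_O : forall X, (Omega `*` `]0, T[) X -> O (U X))
    (U_weak : weak_solution Omega T A F U)
    (U_L3 : forall Omega1 : set 'rV[R]_k, open Omega1 -> compactly_inside Omega1 Omega ->
      L3 (Omega1 `*` `]0, T[) U)
    (U_regular : forall Omega1 : set 'rV[R]_k, open Omega1 -> compactly_inside Omega1 Omega ->
      limf_einf (cubic_modulus (Omega1 `*` `]0, T[) U) 0^'+ = 0%E)
    (flux_bdry : limf_einf (bdry_flux Omega T q U) 0^'+ = 0%E)
    (flux_infinity : flux_integrable_at_infinity Omega T q U) :
  forall chi : R^o -> R^o, C1c `]0, T[ chi ->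
    \int[spacetime_lebesgue (k:=k)]_(X in Omega `*` `]0, T[)
      ((chi^`())%classic X.2 * eta (U X)) = 0.
Proof.
move=> chi hchi.
pose G (a : option 'I_k) (i : 'I_n) (V : 'rV[R]_n) : R := if a is Some j then F V i j else A V 0 i.
pose Q (a : option 'I_k) (V : 'rV[R]_n) : R := if a is Some j then q V 0 j else eta V.
have [C ES] : exists C, entropy_system O G (fun a i => gradient (closure O) (G a i)) Q
    (fun i V => B V 0 i) (fun i => gradient O (fun V => B V 0 i)) C.
  have [MB hB] := DB_bounded; have [MA hA] := D2A_bounded; have [MF hF] := D2F_bounded.
  have [Cg hg] := growth.
  (* N compares the Euclidean norm with the sup norm *)
  pose N : R := n.+1%:R.
  have N1 : 1 <= N by rewrite ler1n.
  have N0 : 0 <= N by exact: ler0n.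
  pose M := `|MB| + `|MA| + `|MF| + `|Cg| * N ^+ 3.
  have [b1 b2 b3 b4] : [/\ MB <= M, MA <= M, MF <= M & `|Cg| * N ^+ 3 <= M].
    have h1 := ler_norm MB; have h2 := ler_norm MA; have h3 := ler_norm MF.
    have h4 := normr_ge0 MB; have h5 := normr_ge0 MA; have h6 := normr_ge0 MF.
    have h7 : 0 <= `|Cg| * N ^+ 3 by rewrite mulr_ge0// exprn_ge0.
    by rewrite /M; move: (`|Cg| * _) h7 => z h7; split; lra.
  apply: (@entropy_system_exists _ _ _ O G Q (fun i V => B V 0 i) M).
  - exact: O_convex.
  - by move=> [j|] i; [exact: F_C2|exact: A_C2].
  - move=> [j|] i V OV l m; first exact: le_trans (hF V OV l m i j) b3.
    exact: le_trans (hA V OV l m i) b2.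
  - by move=> [j|]; [exact: q_C1|exact: eta_C1].
  - exact: B_C1.
  - by move=> i V OV l; exact: le_trans (hB V OV i l) b1.
  - move=> i V OV; have [h _] := hg V OV.
    apply: (le_trans (le_rV_norm _ i)); apply: (le_trans (norm_le_enorm _)); apply: (le_trans h).
    apply: (@le_trans _ _ (`|Cg| * N ^+ 3 * (1 + `|V|))); last by rewrite ler_wpM2r// addr_ge0.
    apply: (@le_trans _ _ (`|Cg| * (1 + enorm V))).
      by rewrite ler_wpM2r ?ler_norm// addr_ge0// enorm_ge0.
    rewrite -mulrA ler_wpM2l// (@le_trans _ _ (N * (1 + `|V|)))//.
      by rewrite mulrDr mulr1 lerD// enorm_le.
    by rewrite ler_wpM2r ?addr_ge0// -{1}(expr1 N) ler_weXn2l.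
  - move=> a V OV; have [_ h] := hg V OV.
    have hQ : `|Q a V| <= Cg * (1 + enorm V ^+ 3).
      apply: le_trans h; case: a => [j|] /=; last by rewrite lerDl enorm_ge0.
      by rewrite (le_trans (le_rV_norm _ j))// (le_trans (norm_le_enorm _))// lerDr.
    apply: (le_trans hQ).
    apply: (@le_trans _ _ (`|Cg| * N ^+ 3 * (1 + `|V|) ^+ 3)); last first.
      by rewrite ler_wpM2r// exprn_ge0// addr_ge0.
    apply: (@le_trans _ _ (`|Cg| * (1 + enorm V ^+ 3))).
      by rewrite ler_wpM2r ?ler_norm// addr_ge0// exprn_ge0// enorm_ge0.
    rewrite -mulrA ler_wpM2l// -exprMn.
    have h1 : enorm V <= N * `|V| by exact: enorm_le.
    apply: (@le_trans _ _ (1 + (N * `|V|) ^+ 3)).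
      by rewrite lerD2l lerXn2r ?nnegrE ?enorm_ge0// mulr_ge0.
    rewrite mulrDr mulr1; have := mulr_ge0 N0 (normr_ge0 V).
    by move: (N * `|V|) => v v0; rewrite !exprS !expr0; nra.
  - by move=> [j|] V OV l; [exact: D_q|exact: D_eta].
have [eps0 [eps00 hcol]] := collar.
have [rinf iq] := flux_infinity.
have [M [rho [M0 rho0 dchi [chiM chiL] [dchiM chi_supp]]]] := test_time_bounds hchi.
set Dom := Omega `*` `]0, T[.
have weak (psi : 'rV[R]_k * R -> 'rV[R]_n) : C1c Dom psi ->
    Rintegral (@spacetime_lebesgue R k) Dom
      (fun X => \sum_a \sum_i ('D_(evec a) psi X) 0 i * G a i (U X)) = 0.
  move=> /U_weak h; apply: etrans h.
  apply: (@eq_RintegralS _ ('rV[R]_k * measurableTypeR R)%type R) => X _.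
  by rewrite sum_option exchange_big.
have oDom : open Dom by apply: open_prod => //; exact: interval_open.
have mDom : measurable (Dom : set ('rV[R]_k * measurableTypeR R)).
  exact: measurable_spacetime_open.
have mU : measurable_fun (Dom : set ('rV[R]_k * measurableTypeR R)) U.
  by apply: measurable_local => // Omega1 o1 c1; have [] := U_L3 Omega1 o1 c1.
pose f (X : 'rV[R]_k * R) : R := (chi^`())%classic X.2 * eta (U X).
have mf : measurable_fun (Dom : set ('rV[R]_k * measurableTypeR R)) f.
  apply: measurable_funM; last exact: (measurable_Q ES None mDom mU U_in_O).
  apply: measurable_funTS.
  apply: (@measurableT_comp _ _ _ _ _ _ (chi^`())%classic _ snd) => //.
  have [_ cD _ _] := hchi; rewrite (_ : (chi^`())%classic = 'D_1 chi).
    by apply: continuous_measurable_fun; exact: cD.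
  by apply/funext => s; rewrite derive1E.
(* otherwise the integral is 0 by convention *)
have [i_f|not_i] := pselect (rint (@spacetime_lebesgue R k) (Dom : set ('rV[R]_k * measurableTypeR R)) f);
  last exact: Rintegral_not_integrable.
pose I := Rintegral (@spacetime_lebesgue R k)
  ([set x | Omega x /\ rinf < enorm x] `*` `]0, T[) (fun X => enorm (q (U X))).
(* scales along which the boundary flux vanishes, while the far cutoff is sent to
   infinity *)
have step_pos (m : nat) : 0 < Num.min (m.+1%:R^-1) (Num.min eps0 1) :> R.
  by rewrite !lt_min eps00 ltr01 invr_gt0 ltr0n.
have inv_pos (m : nat) : 0 < m.+1%:R^-1 :> R by rewrite invr_gt0 ltr0n.
have /choice[e he] (m : nat) : exists e : R, [/\ 0 < e,
    e < Num.min (m.+1%:R^-1) (Num.min eps0 1) & (bdry_flux Omega T q U e < (m.+1%:R^-1)%:E)%E].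
  exact: limf_einf0_lt flux_bdry (inv_pos m) (step_pos m).
have e0 m : 0 < e m by have [] := he m.
have [em e1 ee] : [/\ forall m, e m < m.+1%:R^-1, forall m, e m < 1 & forall m, e m <= eps0].
  by split=> m; have [_ + _] := he m; rewrite !lt_min => /and3P[? ? ?] //; exact: ltW.
pose r (m : nat) : R := m.+1%:R + `|rinf|.
have r1 m : 1 <= r m by rewrite /r ler_wpDr// ler1n.
have rr m : rinf <= r m by rewrite /r (le_trans (ler_norm _))// lerDr ler0n.
pose Fm (m : nat) (X : 'rV[R]_k * R) : R := layer_cut Omega (e m) X.1 * far_cut (r m) X.1 * f X.
pose c := 8 * M * I + (8 * M + 1).
have I0 : 0 <= I by apply: Rintegral_ge0 => X _; exact: enorm_ge0.
have estimate m : `|Rintegral (@spacetime_lebesgue R k) Dom (Fm m)| <= c * m.+1%:R^-1.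
  have [_ _ hflux] := he m.
  apply: (le_trans (localized_estimate O_convex ES Omega_open hcol U_in_O weak U_L3 U_regular
    (e0 m) (e1 m) (ee m) (r1 m) rho0 dchi chiM chiL chi_supp (q := q) (rinf := rinf)
    (fun V j => erefl) (rr m) iq (ltW hflux))).
  rewrite /c [leRHS]mulrDl; apply: lerD => //.
  rewrite mulrAC ler_wpM2l// ?mulr_ge0//.
  by rewrite lef_pV2 ?posrE ?(lt_le_trans ltr01 (r1 m))// ?ltr0n// /r lerDl.
have lim0 : (fun m => Rintegral (@spacetime_lebesgue R k) Dom (Fm m)) @ \oo --> (0 : R).
  have z1 : (fun m : nat => c * m.+1%:R^-1) @ \oo --> c * 0.
    by apply: cvgM; [exact: cvg_cst|exact: cvg_harmonic].
  have z2 : (fun m : nat => - (c * m.+1%:R^-1)) @ \oo --> - (c * 0) by exact: cvgN.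
  rewrite mulr0 ?oppr0 in z1 z2.
  by apply: (squeeze_cvgr _ z2 z1); near=> m; rewrite -ler_norml.
(* the cutoffs are eventually 1 at each point of Omega *)
have limf : (fun m => Rintegral (@spacetime_lebesgue R k) Dom (Fm m)) @ \oo -->
    Rintegral (@spacetime_lebesgue R k) Dom f.
  apply: (@Rintegral_dominated_cvg _ ('rV[R]_k * measurableTypeR R)%type R _ Dom Fm f
    (fun X => `|f X|)).
  - exact: mDom.
  - move=> m; apply: measurable_funM; last exact: mf.
    apply: measurable_funM; apply: measurable_funTS.
      exact: measurable_layer_cut.
    exact: measurable_far_cut.
  - exact: mf.
  - apply: aeW => X [OX _]; apply: cvg_near_cst.
    have d0 := depth_pos Omega_open OX.
    near=> m.
    have l1 : layer_cut Omega (e m) X.1 = 1.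
      apply: step_ge1.
      have h : e m <= depth Omega X.1.
        apply: (le_trans (ltW (em m))); rewrite -[leRHS]invrK lef_pV2 ?posrE ?ltr0n ?invr_gt0//.
        by rewrite (@le_trans _ _ m%:R)// ?ler_nat//; near: m; exact: nbhs_infty_ger.
      have e4 : 0 < 4 / e m by rewrite divr_gt0.
      have : 4 <= 4 / e m * depth Omega X.1 by rewrite mulrAC ler_pdivlMr// ler_wpM2l.
      by lra.
    have f1 : far_cut (r m) X.1 = 1.
      apply: step_ge1; rewrite lerBrDr -lerBrDl (_ : 2 - 1 = 1 :> R); last by ring.
      rewrite ler_pdivrMl ?mulr1; last by rewrite exprn_gt0// (lt_le_trans ltr01).
      rewrite -sqr_enorm lerXn2r ?nnegrE ?enorm_ge0// ?(le_trans ler01)//.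
      rewrite /r (@le_trans _ _ m%:R)//; first by near: m; exact: nbhs_infty_ger.
      by rewrite (@le_trans _ _ m.+1%:R) ?ler_nat// lerDl.
    by rewrite /Fm l1 f1 !mul1r.
  - exact: rint_norm.
  - move=> m X _; rewrite /Fm normrM ler_piMl// normrM.
    by rewrite -[leRHS]mulr1 ler_pM// norm_step.
exact: (cvg_unique _ limf lim0).
Unshelve. all: by end_near. Qed.
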